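(* Let $k$ be a field of characteristic different from $2$ and let $f\in k[x]$ be a quadratic polynomial whose postcritical orbit $P$ is infinite. Then the geometric and arithmetic iterated monodromy groups of $f$ satisfy $G^{\mathrm{geom}}=G^{\mathrm{arith}}=W$.
   Context: $T$ is the infinite rooted binary tree whose vertices are the finite words over $\{0,1\}$, with root the empty word, each word $t$ being joined by an edge to $t0$ and $t1$; $W:=\operatorname{Aut}(T)$. Iterated monodromy groups: Let $\bar k$ be a separable closure of $k$. View $f$ as a morphism $\mathbb{P}^1_k\to\mathbb{P}^1_k$ of degree $2$, let $f^n$ be its $n$-th iterate, let $C\subset\mathbb{P}^1(\bar k)$ be the set of its two critical points ($\infty$ and a point $p_0\in k$), and let $P:=\bigcup_{n\ge1}f^n(C)$ be the (strictly) postcritical orbit. Put $P_n:=\bigcup_{m=1}^n f^m(C)$. Fix a separably closed overfield $L$ of $\bar k$ and a point $x_0\in\mathbb{P}^1(L)\setminus P$. Let $T_{x_0}$ be the regular rooted binary tree with vertex set $\coprod_{n\ge0}f^{-n}(x_0)$ (fibres in $\mathbb P^1(L)$), each $x_n\in f^{-n}(x_0)$ with $n>0$ being joined to $f(x_n)\in f^{-(n-1)}(x_0)$; the root is $x_0$. Set $\pi_1^{\text{ét}}(\mathbb{P}^1_k\setminus P,x_0):=\varprojlim_n\pi_1^{\text{ét}}(\mathbb{P}^1_k\setminus P_n,x_0)$. Its monodromy actions on the sets $f^{-n}(x_0)$ (from the unramified coverings $f^n$ of $\mathbb{P}^1_k\setminus P_n$) combine to a continuous homomorphism $\rho:\pi_1^{\text{ét}}(\mathbb{P}^1_k\setminus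 P,x_0)\to\operatorname{Aut}(T_{x_0})$. Identify $T_{x_0}$ with $T$ by an isomorphism of rooted trees, so that $\operatorname{Aut}(T_{x_0})=W$. Then $G^{\mathrm{arith}}:=\rho(\pi_1^{\text{ét}}(\mathbb{P}^1_k\setminus P,x_0))$ and $G^{\mathrm{geom}}:=\rho(\pi_1^{\text{ét}}(\mathbb{P}^1_{\bar k}\setminus P,x_0))$, closed subgroups of $W$, well-defined up to conjugacy in $W$. *)

(* Defs.v *)
From HB Require Import structures.
From mathcomp Require Import all_boot all_order all_algebra fraction separable.
From mathcomp Require Import boolp classical_sets cardinality.

Set Implicit Arguments.
Unset Strict Implicit.
Unset Printing Implicit Defensive.

Import GRing.Theory.
Local Open Scope ring_scope.
Local Open Scope classical_set_scope.

Definition separably_closed (L : fieldType) : Prop :=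
  forall p : {poly L}, separable_poly p -> (1 < size p)%N -> exists x, root p x.

Definition is_separable_closure (k kbar : fieldType)
    (iota : {rmorphism k -> kbar}) : Prop :=
  separably_closed kbar /\
  forall x : kbar, exists p : {poly k},
    separable_poly p /\ root (map_poly iota p) x.

(* [None] is the point at infinity. *)
Definition P1 (F : Type) : Type := option F.

(* A nonconstant polynomial fixes infinity. *)
Definition P1_map (F : fieldType) (f : {poly F}) : P1 F -> P1 F :=
  omap (horner f).

(* The F-rational critical points of a polynomial of degree at least 2.  In
   degree 2 and characteristic other than 2, [f^`()] has degree 1, so these are
   infinity and one point of F, and there are no others over larger fields. *)
Definition critical_points (F : fieldType) (f : {poly F}) : set (P1 F) :=
  [set z | if z is Some c then root f^`() c else True].

Definition postcritical_upto (F : fieldType) (f : {poly F}) (n : nat) :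
    set (P1 F) :=
  \bigcup_(m in [set m | (1 <= m <= n)%N])
    (iter m (P1_map f) @` critical_points f).

Definition postcritical (F : fieldType) (f : {poly F}) : set (P1 F) :=
  \bigcup_(m in [set m | (1 <= m)%N]) (iter m (P1_map f) @` critical_points f).

(* x is a finite point; the base points used below are finite because infinity
   is postcritical. *)
Definition avoids (F L : fieldType) (e : {rmorphism F -> L}) (x : L)
    (S : set (P1 F)) : Prop :=
  forall z, S z -> omap e z <> Some x.

Lemma postcritical_upto_sub (F : fieldType) (f : {poly F}) n :
  postcritical_upto f n `<=` postcritical f.
Proof. by move=> z [m /= /andP[m1 _] mz]; exists m. Qed.

Lemma postcritical_upto_mono (F : fieldType) (f : {poly F}) n :
  postcritical_upto f n `<=` postcritical_upto f n.+1.
Proof.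
by move=> z [m /= /andP[m1 mn] mz]; exists m => //=; rewrite m1 (leqW mn).
Qed.

Lemma avoids_sub (F L : fieldType) (e : {rmorphism F -> L}) (x : L)
    (S S' : set (P1 F)) :
  S `<=` S' -> avoids e x S' -> avoids e x S.
Proof. by move=> sSS' H z /sSS'/H. Qed.

Lemma avoids_upto (F L : fieldType) (e : {rmorphism F -> L}) (x : L)
    (f : {poly F}) : avoids e x (postcritical f) ->
  forall n, avoids e x (postcritical_upto f n).
Proof. by move=> H n; apply: avoids_sub H; exact: postcritical_upto_sub. Qed.

Arguments postcritical_upto_mono {F} f n _ _.
Arguments avoids_upto {F L e x f} H n _ _ _.

Lemma P1_map_comp (F K : fieldType) (e : {rmorphism F -> K}) (f : {poly F}) m z :
  omap e (iter m (P1_map f) z) = iter m (P1_map (map_poly e f)) (omap e z).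
Proof.
elim: m => //= m <-; case: (iter m (P1_map f) z) => //= c.
by rewrite horner_map.
Qed.

Lemma avoids_postcritical (F K L : fieldType) (i : {rmorphism F -> K})
    (j : {rmorphism K -> L}) (x : L) (f : {poly F}) :
  avoids j x (postcritical (map_poly i f)) ->
  avoids (j \o i : {rmorphism F -> L}) x (postcritical f).
Proof.
move=> H _ [m m1 [z Cz <-]] E.
apply: (H (omap i (iter m (P1_map f) z))); last first.
  by rewrite -E; case: (iter m (P1_map f) z).
exists m => //; exists (omap i z); last by rewrite P1_map_comp.
by case: z Cz {E} => //= c /(rmorph_root i); rewrite deriv_map.
Qed.

(* The localization of F[t] at the t - c with c a finite point of S; this is the
   ring of functions on P^1 - S provided that S contains infinity. *)
Definition regular_off (F : fieldType) (S : set (P1 F)) :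
    {pred {fraction {poly F}}} :=
  fun z => `[< exists (p : {poly F}) (s : seq F),
    (forall c, c \in s -> S (Some c)) /\
    z * FracField.tofrac (\prod_(c <- s) ('X - c%:P)) = FracField.tofrac p >].

Lemma regular_off_subring (F : fieldType) (S : set (P1 F)) :
  subring_closed (regular_off S).
Proof.
split.
- by apply/asboolP; exists 1, [::]; rewrite big_nil !tofrac1 mulr1.
- move=> x y /asboolP[p [s [sS xp]]] /asboolP[q [r [rS yq]]].
  apply/asboolP; exists (p * \prod_(c <- r) ('X - c%:P)
                       - q * \prod_(c <- s) ('X - c%:P)), (s ++ r); split.
    by move=> c; rewrite mem_cat => /orP[/sS|/rS].
  rewrite big_cat/= tofracB !tofracM -xp -yq mulrBl !mulrA; congr (_ - _).
  by rewrite mulrAC.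
- move=> x y /asboolP[p [s [sS xp]]] /asboolP[q [r [rS yq]]].
  apply/asboolP; exists (p * q), (s ++ r); split.
    by move=> c; rewrite mem_cat => /orP[/sS|/rS].
  by rewrite big_cat/= !tofracM -xp -yq mulrACA.
Qed.

HB.instance Definition _ (F : fieldType) (S : set (P1 F)) :=
  GRing.isSubringClosed.Build {fraction {poly F}} (regular_off S)
    (regular_off_subring S).

Record coord_ring (F : fieldType) (S : set (P1 F)) := CoordRing {
  coord_val :> {fraction {poly F}};
  _ : coord_val \in regular_off S }.

HB.instance Definition _ (F : fieldType) (S : set (P1 F)) :=
  [isSub for @coord_val F S].
HB.instance Definition _ (F : fieldType) (S : set (P1 F)) :=
  [Choice of coord_ring S by <:].
HB.instance Definition _ (F : fieldType) (S : set (P1 F)) :=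
  [SubChoice_isSubComNzRing of coord_ring S by <:].

Lemma tofrac_regular (F : fieldType) (S : set (P1 F)) (p : {poly F}) :
  FracField.tofrac p \in regular_off S.
Proof. by apply/asboolP; exists p, [::]; rewrite big_nil tofrac1 mulr1. Qed.

Definition coord_poly (F : fieldType) (S : set (P1 F)) (p : {poly F}) :
  coord_ring S := CoordRing (tofrac_regular S p).

Lemma coord_poly_zmod (F : fieldType) (S : set (P1 F)) :
  zmod_morphism (@coord_poly F S).
Proof. by move=> p q; apply: val_inj; rewrite rmorphB /= tofracB. Qed.

Lemma coord_poly_monoid (F : fieldType) (S : set (P1 F)) :
  monoid_morphism (@coord_poly F S).
Proof.
split=> [|p q]; apply: val_inj; rewrite ?rmorph1 ?rmorphM /=;
  [exact: tofrac1|exact: tofracM].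
Qed.

HB.instance Definition _ (F : fieldType) (S : set (P1 F)) :=
  GRing.isZmodMorphism.Build _ _ (@coord_poly F S) (@coord_poly_zmod F S).
HB.instance Definition _ (F : fieldType) (S : set (P1 F)) :=
  GRing.isMonoidMorphism.Build _ _ (@coord_poly F S) (@coord_poly_monoid F S).

Lemma regular_off_sub (F : fieldType) (S S' : set (P1 F)) :
  S `<=` S' -> forall a : coord_ring S, coord_val a \in regular_off S'.
Proof.
move=> sSS' [a /= /asboolP[p [s [sS ap]]]].
by apply/asboolP; exists p, s; split=> // c /sS/sSS'.
Qed.

Definition coord_incl (F : fieldType) (S S' : set (P1 F)) (H : S `<=` S')
  (a : coord_ring S) : coord_ring S' := CoordRing (regular_off_sub H a).

Lemma coord_incl_zmod (F : fieldType) (S S' : set (P1 F)) (H : S `<=` S') :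
  zmod_morphism (coord_incl H).
Proof. by move=> a b; exact: val_inj. Qed.

Lemma coord_incl_monoid (F : fieldType) (S S' : set (P1 F)) (H : S `<=` S') :
  monoid_morphism (coord_incl H).
Proof.
by split=> [|a b]; exact: val_inj.
Qed.

HB.instance Definition _ (F : fieldType) (S S' : set (P1 F)) (H : S `<=` S') :=
  GRing.isZmodMorphism.Build _ _ (coord_incl H) (coord_incl_zmod H).
HB.instance Definition _ (F : fieldType) (S S' : set (P1 F)) (H : S `<=` S') :=
  GRing.isMonoidMorphism.Build _ _ (coord_incl H) (coord_incl_monoid H).

(* The geometric point Spec L -> P^1 - S defined by x is the quotient of the
   values at x of a numerator and a denominator prime to x; by [coord_evalE] it
   does not depend on the fraction chosen. *)
Lemma coord_eval_ex (F L : fieldType) (e : {rmorphism F -> L}) (x : L)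
    (S : set (P1 F)) (a : coord_ring S) :
  exists y : L, exists (p : {poly F}) (s : seq F),
    [/\ forall c, c \in s -> S (Some c),
        coord_val a * FracField.tofrac (\prod_(c <- s) ('X - c%:P)) =
          FracField.tofrac p
      & y = (map_poly e p).[x] / (map_poly e (\prod_(c <- s) ('X - c%:P))).[x]].
Proof.
case: a => a /= /asboolP[p [s [sS ap]]].
by exists ((map_poly e p).[x] / (map_poly e (\prod_(c <- s) ('X - c%:P))).[x]), p, s.
Qed.

Definition coord_eval (F L : fieldType) (e : {rmorphism F -> L}) (x : L)
    (S : set (P1 F)) (H : avoids e x S) (a : coord_ring S) : L :=
  projT1 (cid (coord_eval_ex e x a)).

Lemma avoids_neq0 (F L : fieldType) (e : {rmorphism F -> L}) (x : L)
    (S : set (P1 F)) (H : avoids e x S) (s : seq F) :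
  (forall c, c \in s -> S (Some c)) ->
  (map_poly e (\prod_(c <- s) ('X - c%:P))).[x] != 0.
Proof.
move=> sS; rewrite rmorph_prod horner_prod prodf_seq_neq0; apply/allP=> c cs /=.
rewrite rmorphB /= map_polyX map_polyC !hornerE subr_eq0; apply/eqP=> xc.
by apply: (H _ (sS _ cs)); rewrite /= xc.
Qed.

Lemma coord_evalE (F L : fieldType) (e : {rmorphism F -> L}) (x : L)
    (S : set (P1 F)) (H : avoids e x S) (a : coord_ring S)
    (p : {poly F}) (s : seq F) :
  (forall c, c \in s -> S (Some c)) ->
  coord_val a * FracField.tofrac (\prod_(c <- s) ('X - c%:P)) =
    FracField.tofrac p ->
  coord_eval H a =
    (map_poly e p).[x] / (map_poly e (\prod_(c <- s) ('X - c%:P))).[x].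
Proof.
move=> sS ap; rewrite /coord_eval; case: cid => y /= [q [r [rS aq ->]]].
have s0 := avoids_neq0 H sS; have r0 := avoids_neq0 H rS.
apply/eqP; rewrite eqr_div // -!hornerM -!rmorphM; apply/eqP.
congr (map_poly e _).[x]; apply/eqP; rewrite -tofrac_eq !tofracM -ap -aq.
by rewrite mulrAC.
Qed.

Lemma coord_eval_zmod (F L : fieldType) (e : {rmorphism F -> L}) (x : L)
    (S : set (P1 F)) (H : avoids e x S) : zmod_morphism (coord_eval H).
Proof.
move=> a b.
have [p [s [sS ap]]] := asboolP _ (valP a).
have [q [r [rS bq]]] := asboolP _ (valP b).
rewrite (coord_evalE H sS ap) (coord_evalE H rS bq).
have srS c : c \in s ++ r -> S (Some c) by rewrite mem_cat => /orP[/sS|/rS].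
have s0 := avoids_neq0 H sS; have r0 := avoids_neq0 H rS.
rewrite (@coord_evalE _ _ _ _ _ H _ (p * \prod_(c <- r) ('X - c%:P)
                       - q * \prod_(c <- s) ('X - c%:P)) (s ++ r)) //.
  rewrite big_cat /= rmorphB !rmorphM /= hornerD hornerN !hornerM.
  by rewrite -[X in _ = _ + X]mulNr addf_div // mulNr.
rewrite big_cat/= tofracB !tofracM -ap -bq /= mulrBl !mulrA; congr (_ - _).
by rewrite mulrAC.
Qed.

Lemma coord_eval_monoid (F L : fieldType) (e : {rmorphism F -> L}) (x : L)
    (S : set (P1 F)) (H : avoids e x S) : monoid_morphism (coord_eval H).
Proof.
split.
  rewrite (@coord_evalE _ _ _ _ _ H _ 1 [::]) //.
    by rewrite big_nil rmorph1 hornerC divr1.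
  by rewrite big_nil tofrac1 mulr1.
move=> a b.
have [p [s [sS ap]]] := asboolP _ (valP a).
have [q [r [rS bq]]] := asboolP _ (valP b).
rewrite (coord_evalE H sS ap) (coord_evalE H rS bq).
rewrite (@coord_evalE _ _ _ _ _ H _ (p * q) (s ++ r)).
- by rewrite big_cat /= !rmorphM !hornerM mulf_div.
- by move=> c; rewrite mem_cat => /orP[/sS|/rS].
- by rewrite big_cat/= !tofracM -ap -bq mulrACA.
Qed.

HB.instance Definition _ (F L : fieldType) (e : {rmorphism F -> L}) (x : L)
    (S : set (P1 F)) (H : avoids e x S) :=
  GRing.isZmodMorphism.Build _ _ (coord_eval H) (coord_eval_zmod H).
HB.instance Definition _ (F L : fieldType) (e : {rmorphism F -> L}) (x : L)
    (S : set (P1 F)) (H : avoids e x S) :=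
  GRing.isMonoidMorphism.Build _ _ (coord_eval H) (coord_eval_monoid H).

Lemma coord_eval_incl (F L : fieldType) (e : {rmorphism F -> L}) (x : L)
    (S S' : set (P1 F)) (sSS' : S `<=` S') (H : avoids e x S)
    (H' : avoids e x S') (a : coord_ring S) :
  coord_eval H' (coord_incl sSS' a) = coord_eval H a.
Proof.
have [p [s [sS ap]]] := asboolP _ (valP a).
by rewrite (coord_evalE H sS ap); apply: coord_evalE => // c /sS/sSS'.
Qed.

Lemma coord_eval_poly (F L : fieldType) (e : {rmorphism F -> L}) (x : L)
    (S : set (P1 F)) (H : avoids e x S) (p : {poly F}) :
  coord_eval H (coord_poly S p) = (map_poly e p).[x].
Proof.
rewrite (@coord_evalE _ _ _ _ _ H _ p [::]) //.
  by rewrite big_nil rmorph1 hornerC divr1.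
by rewrite big_nil tofrac1 mulr1.
Qed.

Definition functional (A B : comPzRingType) (s : {rmorphism A -> B})
    (lam : B -> A) : Prop :=
  forall a x y, lam (s a * x + y) = a * lam x + lam y.

(* B is finitely generated projective over A (it has the finite dual basis
   [(b, beta)]) and the trace form is a perfect pairing: every functional is
   y |-> Tr (x * y) for a unique x, where, as for any dual basis, the trace of
   an endomorphism u is \sum_i beta i (u (b i)). *)
Definition finite_etale (A B : comPzRingType) (s : {rmorphism A -> B}) : Prop :=
  exists (n : nat) (b : 'I_n -> B) (beta : 'I_n -> B -> A),
    [/\ forall i, functional s (beta i),
        forall x, x = \sum_(i < n) s (beta i x) * b i
      & forall lam, functional s lam ->
          exists! x, forall y, lam y = \sum_(i < n) beta i (x * y * b i)].

(* [comPzRingType] allows the zero algebra, i.e. the empty covering. *)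
Record etale_alg (A : comPzRingType) := EtaleAlg {
  alg_ring :> comPzRingType;
  alg_map : {rmorphism A -> alg_ring};
  alg_etale : finite_etale alg_map }.

(* The fibre of Spec B -> Spec A over the geometric point [pt]. *)
Record fibre (A : comPzRingType) (L : fieldType) (pt : {rmorphism A -> L})
    (B : etale_alg A) := Fibre {
  fibre_hom :> {rmorphism B -> L};
  fibre_over : forall a, fibre_hom (alg_map B a) = pt a }.

(* The automorphisms of the fibre functor.  In [pi1_natural], [phi] is the image
   of [psi] under the map of coverings Spec B' -> Spec B given by [h]. *)
Record pi1 (A : comPzRingType) (L : fieldType) (pt : {rmorphism A -> L}) := Pi1 {
  pi1_act :> forall B : etale_alg A, fibre pt B -> fibre pt B;
  pi1_bij : forall B, bijective (@pi1_act B);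
  pi1_natural : forall (B B' : etale_alg A) (h : {rmorphism B -> B'}),
    (forall a, h (alg_map B a) = alg_map B' a) ->
    forall (phi : fibre pt B) (psi : fibre pt B'),
      (forall b, phi b = psi (h b)) ->
      forall b, pi1_act phi b = pi1_act psi (h b) }.

(* B' is B tensor A', via [h]. *)
Definition is_base_change (A A' : comPzRingType) (i : {rmorphism A -> A'})
    (B : etale_alg A) (B' : etale_alg A') (h : {rmorphism B -> B'}) : Prop :=
  (forall a, h (alg_map B a) = alg_map B' (i a)) /\
  forall (D : comPzRingType) (u : {rmorphism B -> D}) (v : {rmorphism A' -> D}),
    (forall a, u (alg_map B a) = v (i a)) ->
    exists w : {rmorphism B' -> D},
      [/\ forall b, w (h b) = u b, forall a, w (alg_map B' a) = v a
        & forall w' : {rmorphism B' -> D}, (forall b, w' (h b) = u b) ->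
            (forall a, w' (alg_map B' a) = v a) -> forall b, w' b = w b].

(* The homomorphism pi1 (Spec A') -> pi1 (Spec A) induced by [i] maps [sigma']
   to [sigma]: sigma acts on the fibre of B as sigma' does on the fibre of
   B tensor A', these fibres being identified by composition with [h]. *)
Definition pi1_induced (A A' : comPzRingType) (i : {rmorphism A -> A'})
    (L : fieldType) (pt : {rmorphism A -> L}) (pt' : {rmorphism A' -> L})
    (sigma' : pi1 pt') (sigma : pi1 pt) : Prop :=
  forall (B : etale_alg A) (B' : etale_alg A') (h : {rmorphism B -> B'}),
    is_base_change i h ->
    forall (phi : fibre pt B) (psi : fibre pt' B'),
      (forall b, phi b = psi (h b)) -> forall b, sigma B phi b = sigma' B' psi (h b).

Record rooted_graph := RootedGraph {
  vertex :> Type;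
  root_vertex : vertex;
  adjacent : vertex -> vertex -> Prop }.

Definition rooted_iso (T T' : rooted_graph) (theta : T -> T') : Prop :=
  [/\ bijective theta, theta (root_vertex T) = root_vertex T'
    & forall u v, adjacent u v <-> adjacent (theta u) (theta v)].

Definition binary_tree : rooted_graph :=
  @RootedGraph (seq bool) [::] (fun u v =>
    (exists b, v = rcons u b) \/ (exists b, u = rcons v b)).

Definition W : set (binary_tree -> binary_tree) :=
  [set w | rooted_iso (T' := binary_tree) w].

(* The fibres of f^n over the finite point x contain only finite points, because
   f is a polynomial. *)
Definition preimage_vertex (L : fieldType) (f : {poly L}) (x : L) : Type :=
  {n : nat & {y : L | iter n (horner f) y == x}}.

Definition preimage_parent (L : fieldType) (f : {poly L}) (x : L)
    (u v : preimage_vertex f x) : Prop :=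
  tag v = (tag u).+1 /\ f.[val (tagged v)] = val (tagged u).

Definition preimage_tree (L : fieldType) (f : {poly L}) (x : L) : rooted_graph :=
  @RootedGraph (preimage_vertex f x)
    (existT _ 0%N (exist _ x (eqxx x)))
    (fun u v => preimage_parent u v \/ preimage_parent v u).

Definition iterate (F : fieldType) (f : {poly F}) (n : nat) : {poly F} :=
  iter n (comp_poly f) 'X.

(* Via [q], B is A[X] / (f^n(X) - t) with A the coordinate ring of P^1 - S: it is
   the coordinate ring of the covering f^n : P^1 - f^{-n}(S) -> P^1 - S, and
   [q 'X] is the coordinate on the source. *)
Definition is_iterate_covering (F : fieldType) (f : {poly F}) (n : nat)
    (S : set (P1 F)) (B : etale_alg (coord_ring S))
    (q : {rmorphism {poly coord_ring S} -> B}) : Prop :=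
  [/\ forall a, q a%:P = alg_map B a,
      forall b, exists g, q g = b
    & forall g, q g = 0 <-> exists h,
        g = h * (map_poly (fun c => coord_poly S c%:P) (iterate f n)
                 - (coord_poly S 'X)%:P)].

(* The inverse limit of the groups pi1 (P^1 - P_n, x) over n >= 1.  The index is
   shifted because P_0 is empty, whereas P_n contains infinity for n >= 1. *)
Record pi1_postcritical (F L : fieldType) (e : {rmorphism F -> L}) (f : {poly F})
    (x : L) (H : avoids e x (postcritical f)) := Pi1Postcritical {
  pi1_level :> forall n : nat, pi1 (coord_eval (avoids_upto H n.+1));
  pi1_compatible : forall n,
    pi1_induced (coord_incl (postcritical_upto_mono f n.+1))
      (pi1_level n.+1) (pi1_level n) }.

(* [w] is the action of [sigma] on the tree of preimages of x under fL, the
   image of f over L.  The vertex u of level n.+1 corresponds to the point [phi]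
   in the fibre of the covering f^n.+1 whose coordinate is u. *)
Definition is_monodromy (F L : fieldType) (e : {rmorphism F -> L}) (f : {poly F})
    (x : L) (H : avoids e x (postcritical f)) (sigma : pi1_postcritical H)
    (fL : {poly L}) (w : preimage_tree fL x -> preimage_tree fL x) : Prop :=
  forall n : nat,
    exists (B : etale_alg (coord_ring (postcritical_upto f n.+1)))
           (q : {rmorphism {poly coord_ring (postcritical_upto f n.+1)} -> B}),
      is_iterate_covering f n.+1 q /\
      forall (u : preimage_tree fL x)
             (phi : fibre (coord_eval (avoids_upto H n.+1)) B),
        tag u = n.+1 -> val (tagged u) = phi (q 'X) ->
        tag (w u) = n.+1 /\ val (tagged (w u)) = sigma n B phi (q 'X).

(* The image of pi1 (P^1_F - P, x) in W, through the identification [theta] of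
   the tree of preimages with the binary tree. *)
Definition monodromy_group (F L : fieldType) (e : {rmorphism F -> L})
    (f : {poly F}) (x : L) (H : avoids e x (postcritical f)) (fL : {poly L})
    (theta : preimage_tree fL x -> binary_tree) :
    set (binary_tree -> binary_tree) :=
  [set g | exists (sigma : pi1_postcritical H)
                  (w : preimage_tree fL x -> preimage_tree fL x),
    [/\ rooted_iso w, is_monodromy sigma w & forall u, g (theta u) = theta (w u)]].

(* The given f has coefficients in k; x avoids the postcritical orbit in
   P^1(kbar), hence also the one in P^1(k). *)
Definition G_arith (k kbar L : fieldType) (iota : {rmorphism k -> kbar})
    (j : {rmorphism kbar -> L}) (f : {poly k}) (x : L)
    (H : avoids j x (postcritical (map_poly iota f)))
    (theta : preimage_tree (map_poly (j \o iota) f) x -> binary_tree) :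
    set (binary_tree -> binary_tree) :=
  monodromy_group (avoids_postcritical H) theta.

Definition G_geom (k kbar L : fieldType) (iota : {rmorphism k -> kbar})
    (j : {rmorphism kbar -> L}) (f : {poly k}) (x : L)
    (H : avoids j x (postcritical (map_poly iota f)))
    (theta : preimage_tree (map_poly (j \o iota) f) x -> binary_tree) :
    set (binary_tree -> binary_tree) :=
  monodromy_group H theta.

(* Main.v *)
(* Let f(y) = a (y - c)^2 + d.  A geometric point in the fibre of a finite etale
   covering Spec B at x_0 extends uniquely, by Hensel's lemma, to a homomorphism
   from B to L[[u]] over t = x_0 + u, and every homomorphism from B to L((u)) over
   t arises in this way.  A maximal partial isomorphism of L((u)), that is, an
   isomorphism between two subfields, that fixes L and t therefore acts on all
   the fibres compatibly, because its domain and its range contain the values of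
   these homomorphisms.

   So it suffices to realize each automorphism w of the tree of preimages of x_0 by
   a partial isomorphism sending the lift Y_v of each preimage v of x_0 to the lift
   of w(v).  One adjoins the Y_v by increasing level.  If v is a child of p, then
   Y_v generates a quadratic extension of the field E generated by L, the lifts up
   to the level of p and the lifts of the children of the other vertices of that
   level: there is an embedding of E into L((u)) sending Y_p to d + u, because the
   orbit of d is infinite, but it cannot be extended to Y_v, because u has no square
   root in L((u)).  Hence the two roots over p may be mapped to the two roots over
   w(p) in either order. *)

(* Working with graphs of isomorphisms between subfields of L((u)) avoids an algebraic closure of
   L((u)), since nothing is required to extend to the whole field. The price is that maximality
   yields an image only for a root of a polynomial whose transported copy splits in L((u)). For a
   finite etale B this holds because a value of a point of B is an eigenvalue of a multiplication
   matrix over A, and B becomes a product of copies of L((u)), so that the minimal polynomial of the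
   matrix splits.

   The embedding with Y_p -> d + u does not fix t: it sends t to f^n(d + u), where n is the level of
   p. It is unrelated to the isomorphism under construction and serves only to show that the domain
   of the latter does not contain Y_v. One such embedding for each p replaces a computation of
   independence in the group of square classes.

   All isomorphisms fix L, which contains the images of both k and kbar. The same argument therefore
   applies over k and over kbar, without the Galois theory of kbar over k, and each group is shown
   separately to be W. *)
Require Import Defs.
From HB Require Import structures.
From mathcomp Require Import all_boot all_order all_algebra fraction separable qpoly ring zify.
From mathcomp Require Import boolp classical_sets cardinality.

Set Implicit Arguments.
Unset Strict Implicit.
Unset Printing Implicit Defensive.

Import GRing.Theory.
Local Open Scope ring_scope.

(** * Power series over a field *)

Section PowerSeries.
Variable L : fieldType.

Definition pseries : Type := nat -> L.

HB.instance Definition _ := gen_eqMixin pseries.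
HB.instance Definition _ := gen_choiceMixin pseries.

Implicit Types a b c : pseries.

Definition ps_mul a b : pseries := fun n => \sum_(i < n.+1) a i * b (n - i)%N.
Definition ps_const (x : L) : pseries := fun n => if n is 0 then x else 0.

Lemma ps_addA : associative (fun a b => (fun n => a n + b n) : pseries).
Proof. by move=> a b c; apply/funext => n; rewrite addrA. Qed.
Lemma ps_addC : commutative (fun a b => (fun n => a n + b n) : pseries).
Proof. by move=> a b; apply/funext => n; rewrite addrC. Qed.
Lemma ps_add0 : left_id (fun _ => 0 : L) (fun a b => (fun n => a n + b n) : pseries).
Proof. by move=> a; apply/funext => n; rewrite add0r. Qed.
Lemma ps_addN : left_inverse (fun _ => 0 : L) (fun a => (fun n => - a n) : pseries)
  (fun a b => (fun n => a n + b n) : pseries).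
Proof. by move=> a; apply/funext => n; rewrite addNr. Qed.

HB.instance Definition _ :=
  GRing.isZmodule.Build pseries ps_addA ps_addC ps_add0 ps_addN.

Lemma ps_addE a b n : (a + b) n = a n + b n. Proof. by []. Qed.
Lemma ps_subE a b n : (a - b) n = a n - b n. Proof. by []. Qed.

Definition ps_trunc N a : {poly L} := \poly_(i < N) a i.

(** A coefficient of a product involves finitely many coefficients, so commutativity and
    associativity can be inherited from [{poly L}]. *)
Lemma ps_mul_trunc N a b n : (n < N)%N ->
  ps_mul a b n = (ps_trunc N a * ps_trunc N b)`_n.
Proof.
move=> nN; rewrite coefM; apply: eq_bigr => i _; rewrite !coef_poly.
by rewrite !(leq_ltn_trans _ nN) ?leq_subr // -ltnS.
Qed.

Lemma ps_mulC : commutative ps_mul.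
Proof.
by move=> a b; apply/funext => n; rewrite !(@ps_mul_trunc n.+1) // mulrC.
Qed.

Lemma ps_mulA : associative ps_mul.
Proof.
move=> a b c; apply/funext => n.
transitivity ((ps_trunc n.+1 a * (ps_trunc n.+1 b * ps_trunc n.+1 c))`_n).
  rewrite coefM; apply: eq_bigr => i _; rewrite coef_poly ltn_ord.
  by rewrite (@ps_mul_trunc n.+1) // ltnS leq_subr.
rewrite mulrA coefM; apply: eq_bigr => i _.
by rewrite (@ps_mul_trunc n.+1) // coef_poly ltnS leq_subr.
Qed.

Lemma ps_mul1 : left_id (ps_const 1) ps_mul.
Proof.
move=> a; apply/funext => n; rewrite /ps_mul big_ord_recl /= mul1r subn0.
by rewrite big1 ?addr0 // => i _; rewrite mul0r.
Qed.

Lemma ps_mulDl : left_distributive ps_mul +%R.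
Proof.
move=> a b c; apply/funext => n; rewrite ps_addE -big_split /=.
by apply: eq_bigr => i _; rewrite -mulrDl.
Qed.

Lemma ps_one_neq0 : ps_const 1 != 0 :> pseries.
Proof.
by apply/eqP => /(congr1 (fun f : pseries => f 0)) /= /eqP; rewrite oner_eq0.
Qed.

HB.instance Definition _ := GRing.Zmodule_isComNzRing.Build pseries
  ps_mulA ps_mulC ps_mul1 ps_mulDl ps_one_neq0.

Lemma ps_mulE a b n : (a * b) n = \sum_(i < n.+1) a i * b (n - i)%N.
Proof. by []. Qed.

Definition ps_coef0 a : L := a 0.

Lemma ps_coef0_zmod : zmod_morphism ps_coef0. Proof. by []. Qed.
Lemma ps_coef0_monoid : monoid_morphism ps_coef0.
Proof. by split=> // a b; rewrite /ps_coef0 ps_mulE big_ord1. Qed.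
HB.instance Definition _ :=
  GRing.isZmodMorphism.Build pseries L ps_coef0 ps_coef0_zmod.
HB.instance Definition _ :=
  GRing.isMonoidMorphism.Build pseries L ps_coef0 ps_coef0_monoid.

Lemma ps_const_zmod : zmod_morphism ps_const.
Proof.
by move=> x y; apply/funext => -[|n] //=; rewrite ps_subE subr0.
Qed.
Lemma ps_const_monoid : monoid_morphism ps_const.
Proof.
split=> // x y; apply/funext => n; rewrite ps_mulE big_ord_recl /= subn0.
rewrite big1 ?addr0 => [|i _]; last by rewrite mul0r.
by case: n => //= n; rewrite mulr0.
Qed.
HB.instance Definition _ :=
  GRing.isZmodMorphism.Build L pseries ps_const ps_const_zmod.
HB.instance Definition _ :=
  GRing.isMonoidMorphism.Build L pseries ps_const ps_const_monoid.

Lemma ps_coef0_const x : ps_coef0 (ps_const x) = x. Proof. by []. Qed.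

(** Congruence modulo the [k]-th power of the variable. *)
Definition ps_eqmod (k : nat) a b := forall i, (i < k)%N -> a i = b i.

Lemma ps_eqmod0 k a b : ps_eqmod k a b <-> ps_eqmod k (a - b) 0.
Proof.
split=> H i ik; first by rewrite ps_subE (H i ik) subrr.
by apply/eqP; rewrite -subr_eq0; move: (H i ik); rewrite ps_subE => ->.
Qed.

Lemma ps_eqmodW k l a b : (l <= k)%N -> ps_eqmod k a b -> ps_eqmod l a b.
Proof. by move=> lk H i il; apply: H; apply: leq_trans lk. Qed.

Lemma ps_eqmod1 a b : ps_eqmod 1 a b <-> ps_coef0 a = ps_coef0 b.
Proof. split=> H; first exact: (H 0%N isT).
by case=> [_|i //]; exact: H. Qed.

Lemma ps_eqmod_mul k l a b : ps_eqmod k a 0 -> ps_eqmod l b 0 ->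
  ps_eqmod (k + l) (a * b) 0.
Proof.
move=> ka lb i ikl; rewrite ps_mulE big1 // => j _.
have [jk|kj] := ltnP j k; first by rewrite ka // mul0r.
rewrite [b _]lb ?mulr0 // ltn_subLR -1?ltnS //.
by apply: leq_trans ikl _; rewrite leq_add2r.
Qed.

Lemma ps_eqmod_mull k a b : ps_eqmod k b 0 -> ps_eqmod k (a * b) 0.
Proof. by move=> kb; rewrite -[k]add0n; apply: ps_eqmod_mul. Qed.

Lemma ps_eqmod_add k a b : ps_eqmod k a 0 -> ps_eqmod k b 0 ->
  ps_eqmod k (a + b) 0.
Proof. by move=> ka kb i ik; rewrite ps_addE ka ?kb //= addr0. Qed.

Lemma ps_eqmod_sum k (I : Type) (r : seq I) (F : I -> pseries) :
  (forall i, ps_eqmod k (F i) 0) -> ps_eqmod k (\sum_(i <- r) F i) 0.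
Proof.
move=> H; elim/big_rec: _ => [//|i x _ Hx]; exact: ps_eqmod_add.
Qed.

Lemma ps_eqmod_eq a b : (forall k, ps_eqmod k a b) -> a = b.
Proof. by move=> H; apply/funext => n; apply: (H n.+1). Qed.

(** Coefficient [i] is stationary from index [i] on, so the diagonal is the limit. *)
Lemma ps_lim (s : nat -> pseries) :
  (forall k, ps_eqmod k.+1 (s k.+1) (s k)) ->
  {l : pseries | forall k, ps_eqmod k.+1 l (s k)}.
Proof.
move=> H; exists (fun i => s i i) => k i; rewrite ltnS => ik.
elim: k ik => [|k IH]; first by rewrite leqn0 => /eqP ->.
rewrite leq_eqVlt => /orP[/eqP -> //|]; rewrite ltnS => ik.
by rewrite IH // -(H k).
Qed.

Lemma ps_eqmod_sym k a b : ps_eqmod k a b -> ps_eqmod k b a.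
Proof. by move=> H i /H. Qed.
Lemma ps_eqmod_trans k b a c :
  ps_eqmod k a b -> ps_eqmod k b c -> ps_eqmod k a c.
Proof. by move=> H K i ik; rewrite H ?K. Qed.
Lemma ps_eqmodM k a b c d :
  ps_eqmod k a b -> ps_eqmod k c d -> ps_eqmod k (a * c) (b * d).
Proof.
move=> H K i ik; rewrite !ps_mulE; apply: eq_bigr => j _.
by rewrite H ?K // (leq_trans _ ik) // ltnS ?leq_subr // -ltnS.
Qed.
Lemma ps_eqmodD k a b c d :
  ps_eqmod k a b -> ps_eqmod k c d -> ps_eqmod k (a + c) (b + d).
Proof. by move=> H K i ik; rewrite !ps_addE H ?K. Qed.

Lemma ps_inv_ex a : ps_coef0 a != 0 -> exists b, b * a = 1.
Proof.
move=> a0; pose z := ps_const (ps_coef0 a)^-1.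
(* A geometric series: by [sE] the error 1 - a s_k is the (k+1)-st power of 1 - a z, which has no
   constant term. *)
pose s := fix s k := if k is k'.+1 then s k' + z * (1 - a * s k') else z.
have sE k : 1 - a * s k.+1 = (1 - a * s k) * (1 - a * z).
  by rewrite /=; ring.
have s1 : ps_eqmod 1 (1 - a * z) 0.
  by apply/ps_eqmod1; rewrite rmorphB rmorphM rmorph1 /= mulfV ?subrr ?rmorph0.
have sk k : ps_eqmod k.+1 (1 - a * s k) 0.
  by elim: k => [//|k IH]; rewrite sE -addn1; apply: ps_eqmod_mul.
have [|l lP] := @ps_lim s.
  move=> k; apply/ps_eqmod0; rewrite /= addrC addKr; exact: ps_eqmod_mull.
exists l; apply: ps_eqmod_eq => k; rewrite mulrC; apply: ps_eqmod_sym.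
apply/ps_eqmod0; apply: (@ps_eqmodW k.+1) => //.
have -> : 1 - a * l = (1 - a * s k) - a * (l - s k) by ring.
apply: ps_eqmod_add; first exact: sk.
by rewrite -mulrN; apply: ps_eqmod_mull; rewrite opprB;
   apply: (ps_eqmod0 _ _ _).1; apply: ps_eqmod_sym.
Qed.

Definition ps_unit : {pred pseries} := fun a => `[< exists b, b * a = 1 >].
Definition ps_inv a : pseries :=
  if pselect (exists b, b * a = 1) is left H then projT1 (cid H) else a.

Lemma ps_mulVr : {in ps_unit, left_inverse 1 ps_inv *%R}.
Proof.
move=> a /asboolP Ha; rewrite /ps_inv; case: pselect => // H.
by case: cid.
Qed.
Lemma ps_unitP a b : b * a = 1 -> ps_unit a.
Proof. by move=> H; apply/asboolP; exists b. Qed.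
Lemma ps_inv_out : {in [predC ps_unit], ps_inv =1 id}.
Proof.
move=> a /negP Ha; rewrite /ps_inv; case: pselect => // H.
by case: Ha; apply/asboolP.
Qed.

HB.instance Definition _ := GRing.ComNzRing_hasMulInverse.Build pseries
  ps_mulVr ps_unitP ps_inv_out.

Lemma ps_unitE a : (a \is a GRing.unit) = (ps_coef0 a != 0).
Proof.
apply/idP/idP => [/(rmorph_unit ps_coef0)|/ps_inv_ex[b ba]].
  by rewrite unitfE.
by apply/unitrP; exists b; split=> //; rewrite mulrC.
Qed.

Lemma ps_order a : a != 0 ->
  exists2 n, a n != 0 & ps_eqmod n a 0.
Proof.
move=> a0; have H : exists n, a n != 0.
  apply: contrapT => /forallNP H; case/negP: a0; apply/eqP/funext => n.
  by apply/eqP/negbNE/negP/H.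
case: (ex_minnP H) => n an min; exists n => // i ni; apply/eqP.
by rewrite -[_ == _]negbK; apply/negP => /min; rewrite leqNgt ni.
Qed.

Lemma ps_mul_lowest n m a b : ps_eqmod n a 0 -> ps_eqmod m b 0 ->
  (a * b) (n + m)%N = a n * b m.
Proof.
move=> na mb; rewrite ps_mulE.
have nlt : (n < (n + m).+1)%N by rewrite ltnS leq_addr.
rewrite (bigD1 (Ordinal nlt)) //= addKn big1 ?addr0 // => i ni.
have [ilt|ile] := ltnP i n; first by rewrite na // mul0r.
have nlti : (n < i)%N.
  by rewrite ltn_neqAle ile andbT; apply: contra ni => /eqP e; apply/eqP/val_inj.
by rewrite [b _]mb ?mulr0 // ltn_subLR ?ltn_add2r // -ltnS ltn_ord.
Qed.

Lemma ps_integral a b : a * b = 0 -> (a == 0) || (b == 0).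
Proof.
move=> ab; apply/negbNE/negP; rewrite negb_or => /andP[/ps_order[n an na]].
case/ps_order => m bm mb; have := ps_mul_lowest na mb; rewrite ab => /esym/eqP.
by rewrite mulf_eq0 (negPf an) (negPf bm).
Qed.

HB.instance Definition _ :=
  GRing.ComUnitRing_isIntegral.Build pseries ps_integral.

Definition ps_var : pseries := fun n => (n == 1%N)%:R.

Lemma ps_coef0_var : ps_coef0 ps_var = 0. Proof. by []. Qed.

(** The order in the variable is even on the left and odd on the right. *)
Lemma ps_var_nsquare a b : b != 0 -> a ^+ 2 = ps_var * b ^+ 2 -> False.
Proof.
move=> b0 E; have a0 : a != 0.
  apply: contra_eq_neq E => ->; rewrite expr0n /= eq_sym mulf_eq0 sqrf_eq0.
  rewrite (negPf b0) orbF; apply/eqP => /(congr1 (fun f : pseries => f 1%N)) /=.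
  by apply/eqP; rewrite oner_eq0.
have [n an na] := ps_order a0; have [m bm mb] := ps_order b0.
have hv : ps_eqmod 1 ps_var 0 by apply/ps_eqmod1.
have hb := ps_eqmod_mul mb mb; have hvb := ps_eqmod_mul hv hb.
have ha := ps_eqmod_mul na na.
have e1 := ps_mul_lowest na na; have e2 := ps_mul_lowest hv hb.
rewrite (ps_mul_lowest mb mb) mul1r in e2; rewrite !expr2 in E.
have [lt|gt|eq] := ltngtP (n + n)%N (1 + (m + m))%N.
- by move: e1; rewrite E hvb //= => /esym/eqP; rewrite mulf_eq0 orbb (negPf an).
- by move: e2; rewrite -E ha //= => /esym/eqP; rewrite mulf_eq0 orbb (negPf bm).
- by move/(congr1 odd): eq; rewrite oddD addbb add1n /= oddD addbb.
Qed.

Lemma ps_sqrt z r : 2%:R != 0 :> L -> r != 0 -> ps_coef0 z = r ^+ 2 ->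
  exists s, s ^+ 2 = z /\ ps_coef0 s = r.
Proof.
move=> two r0 z0; pose i := ps_const (2%:R * r)^-1.
have i2r : i * ps_const (2%:R * r) = 1.
  by rewrite -rmorphM /= mulVf ?rmorph1 // mulf_neq0.
(* Newton's iteration with the derivative frozen at 2r: each step multiplies the error by a series
   without constant term. *)
pose s := fix s k := if k is k'.+1 then s k' - i * (s k' ^+ 2 - z) else ps_const r.
have s0 k : ps_coef0 (s k) = r /\ ps_eqmod k.+1 (s k ^+ 2 - z) 0.
  elim: k => [|k [IH1 IH2]]; first split=> //.
    by apply/ps_eqmod1; rewrite rmorphB rmorphXn /= ps_coef0_const z0 subrr rmorph0.
  have d0 : ps_coef0 (s k ^+ 2 - z) = 0 by rewrite rmorphB rmorphXn /= IH1 z0 subrr.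
  split; first by rewrite /= rmorphB rmorphM /= d0 mulr0 subr0.
  have -> : s k.+1 ^+ 2 - z = (s k ^+ 2 - z) *
     (1 - (2%:R * s k) * i + i * i * (s k ^+ 2 - z)).
    rewrite /=; ring.
  rewrite -addn1; apply: ps_eqmod_mul => //; apply/ps_eqmod1.
  rewrite rmorphD rmorphB !rmorphM rmorph1 rmorph_nat /= d0 mulr0 addr0 IH1.
  by rewrite /i ps_coef0_const mulfV ?subrr ?rmorph0 // mulf_neq0.
have [|l lP] := @ps_lim s.
  move=> k; apply/ps_eqmod0; rewrite /= addrC addKr -mulNr.
  by apply: ps_eqmod_mull; case: (s0 k).
exists l; split; last by rewrite [LHS](lP 0%N).
apply: ps_eqmod_eq => k; apply/ps_eqmod0; apply: (@ps_eqmodW k.+1) => //.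
have -> : l ^+ 2 - z = (l + s k) * (l - s k) + (s k ^+ 2 - z) by ring.
apply: ps_eqmod_add; last by case: (s0 k).
by apply/ps_eqmod_mull/(ps_eqmod0 _ _ _).1/lP.
Qed.

Lemma ps_coef0_neq0 a : ps_coef0 a != 0 -> a != 0.
Proof. by apply: contraNneq => ->; rewrite rmorph0. Qed.

(** Write P = q (X - r)^m with r the constant term of [a] and q(r) nonzero: then q(a) has constant
    term q(r), and a - r is nonzero since [a] is not constant. *)
Lemma ps_transcendental a (P : {poly L}) : a != ps_const (ps_coef0 a) ->
  P != 0 -> (map_poly ps_const P).[a] != 0.
Proof.
move=> anc P0; set r := ps_coef0 a.
have [m [q qr ->]] := multiplicity_XsubC P r.
rewrite P0 /= in qr.
rewrite rmorphM rmorphXn /= rmorphB /= map_polyX map_polyC /= hornerM horner_exp.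
rewrite !hornerE mulf_neq0 //; last by rewrite expf_neq0 // subr_eq0.
apply: ps_coef0_neq0; rewrite -horner_map -map_poly_comp.
by rewrite (eq_map_poly (g := idfun)) ?map_poly_id // -/(root _ _).
Qed.
End PowerSeries.

(** * Partial isomorphisms of fields *)

Section PartialIso.
Variables K M : fieldType.

Definition pair_inv (z : K * M) : K * M := (z.1^-1, z.2^-1).

Definition field_closed (G : set (K * M)) : Prop :=
  [/\ G 1, forall z w, G z -> G w -> G (z - w),
      forall z w, G z -> G w -> G (z * w) & forall z, G z -> G (pair_inv z)].

(** This rules out zero divisors such as (1, 0), so that both projections of a closed [G] are
    injective. *)
Definition zero_compatible (G : set (K * M)) : Prop :=
  forall z, G z -> (z.1 == 0) = (z.2 == 0).

(* The graphs of the isomorphisms from a subfield of K to a subfield of M. *)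
Definition partial_iso (G : set (K * M)) := field_closed G /\ zero_compatible G.

Lemma field_closed0 G : field_closed G -> G 0.
Proof. by case=> G1 GB _ _; rewrite -(subrr 1); apply: GB. Qed.

Lemma field_closedN G z : field_closed G -> G z -> G (- z).
Proof.
by move=> Gf Gz; case: (Gf) => _ GB _ _; rewrite -sub0r; apply: GB => //; apply: field_closed0.
Qed.

Lemma field_closedD G z w : field_closed G -> G z -> G w -> G (z + w).
Proof.
move=> Gf Gz Gw; case: (Gf) => _ GB _ _; rewrite -[w]opprK; apply: GB => //.
exact: field_closedN.
Qed.

Section Carrier.
Variable G : set (K * M).
Hypothesis GG : partial_iso G.

(** The proof is an argument so that the subring instance can be attached to the predicate. *)
Definition iso_pred of partial_iso G : {pred K * M} := fun z => `[< G z >].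

Lemma iso_pred_subring : subring_closed (iso_pred GG).
Proof.
have [[G1 GB GM _] _] := GG; split; first exact/asboolP.
- by move=> x y /asboolP Gx /asboolP Gy; apply/asboolP/GB.
- by move=> x y /asboolP Gx /asboolP Gy; apply/asboolP/GM.
Qed.

End Carrier.

HB.instance Definition _ G (GG : partial_iso G) :=
  GRing.isSubringClosed.Build (K * M)%type (iso_pred GG) (iso_pred_subring GG).

(** The graph as an abstract field with two embeddings: a polynomial over it has a copy over [K] and
    a transported copy over [M]. *)
Record iso_field G (GG : partial_iso G) := IsoField {
  iso_val :> K * M; _ : iso_val \in iso_pred GG }.

Section Instances.
Variables (G : set (K * M)) (GG : partial_iso G).

HB.instance Definition _ := [isSub for @iso_val G GG].
HB.instance Definition _ := [Choice of iso_field GG by <:].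
HB.instance Definition _ := [SubChoice_isSubComNzRing of iso_field GG by <:].

Lemma iso_fieldP (z : iso_field GG) : G (iso_val z).
Proof. exact/asboolP/(valP z). Qed.

Lemma iso_inv_subproof (z : iso_field GG) : pair_inv (iso_val z) \in iso_pred GG.
Proof. by have [[_ _ _ GV] _] := GG; apply/asboolP/GV/iso_fieldP. Qed.

Definition iso_inv (z : iso_field GG) : iso_field GG :=
  IsoField (iso_inv_subproof z).

Lemma iso_val_eq0 (z : iso_field GG) : (z == 0) = ((iso_val z).1 == 0).
Proof.
apply/eqP/eqP => [-> //|z1]; apply: val_inj => /=.
have := (GG.2 _ (iso_fieldP z)); rewrite z1 eqxx => /esym/eqP z2.
by rewrite [iso_val z]surjective_pairing z1 z2.
Qed.

Lemma iso_mulVf (z : iso_field GG) : z != 0 -> iso_inv z * z = 1.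
Proof.
rewrite iso_val_eq0 => z1; have z2 := z1; rewrite (GG.2 _ (iso_fieldP z)) in z2.
by apply: val_inj; congr pair; rewrite /= mulVf.
Qed.

Lemma iso_inv0 : iso_inv 0 = 0.
Proof. by apply: val_inj; congr pair; rewrite /= invr0. Qed.

HB.instance Definition _ :=
  GRing.ComNzRing_isField.Build (iso_field GG) iso_mulVf iso_inv0.

Definition iso_fst (z : iso_field GG) : K := (iso_val z).1.
Definition iso_snd (z : iso_field GG) : M := (iso_val z).2.

Lemma iso_fst_zmod : zmod_morphism iso_fst. Proof. by []. Qed.
Lemma iso_fst_monoid : monoid_morphism iso_fst. Proof. by []. Qed.
HB.instance Definition _ :=
  GRing.isZmodMorphism.Build (iso_field GG) K iso_fst iso_fst_zmod.
HB.instance Definition _ :=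
  GRing.isMonoidMorphism.Build (iso_field GG) K iso_fst iso_fst_monoid.
Lemma iso_snd_zmod : zmod_morphism iso_snd. Proof. by []. Qed.
Lemma iso_snd_monoid : monoid_morphism iso_snd. Proof. by []. Qed.
HB.instance Definition _ :=
  GRing.isZmodMorphism.Build (iso_field GG) M iso_snd iso_snd_zmod.
HB.instance Definition _ :=
  GRing.isMonoidMorphism.Build (iso_field GG) M iso_snd iso_snd_monoid.

End Instances.
End PartialIso.

(** Without a root, [q] would be prime to every linear factor, hence to their product and to
    itself. *)
Lemma root_dvd_split (F : fieldType) (q : {poly F}) (s : seq F) :
  (1 < size q)%N -> q %| \prod_(c <- s) ('X - c%:P) -> exists c, root q c.
Proof.
move=> sq qs; apply: contrapT => /forallNP nr.
suff : coprimep q q by rewrite coprimepp => /eqP e; rewrite e in sq.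
apply: (coprimep_dvdl qs); elim: s {qs} => [|c s IH]; first by rewrite big_nil coprimep1.
by rewrite big_cons coprimepMr IH andbT coprimep_XsubC; exact/negP.
Qed.

Lemma addn_pred_leq x y :
  (0 < x)%N -> (0 < y)%N -> ((x + y).-1 <= x)%N -> y == 1%N.
Proof. lia. Qed.

(** * Extension of a partial isomorphism by an algebraic element *)

Section Extension.
Variables (K M : fieldType) (G : set (K * M)) (GG : partial_iso G).
Local Notation fst_ := (map_poly (@iso_fst _ _ _ GG)).
Local Notation snd_ := (map_poly (@iso_snd _ _ _ GG)).

(** With [m] minimal for [a], the pairs (g(a), g(b)) already form a field: if g(a) is nonzero, then
    g is prime to [m], and one Bezout coefficient inverts both values. *)
Lemma partial_iso_extend_at (a : K) (b : M) (m : {poly iso_field GG}) :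
  m != 0 -> (forall g, root (fst_ g) a -> m %| g) ->
  root (fst_ m) a -> root (snd_ m) b ->
  exists G' : set (K * M), [/\ partial_iso G', (G `<=` G')%classic & G' (a, b)].
Proof.
move=> m0 mdvd ma mb.
(* Write m = h * gcd. As [a] is not a root of the gcd, it is a root of [h], so [m] divides [h] and
   the gcd is constant. *)
have cop g : (fst_ g).[a] != 0 -> coprimep m g.
  move=> ga; rewrite coprimep_def; have dm := dvdp_gcdl m g.
  have dn0 : gcdp m g != 0 by rewrite gcdp_eq0 negb_and m0.
  have /dvdpP[h e] := dm.
  have ha : root (fst_ h) a.
    move: ma; rewrite e rmorphM rootM => /orP[//|da].
    have := dvdp_gcdr m g; case/dvdpP => k eg; case/negP: ga.
    by rewrite eg rmorphM hornerM /= (rootP da) mulr0.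
  have := mdvd _ ha => mh; have h0 : h != 0.
    by apply: contraNneq m0 => h0; rewrite e h0 mul0r.
  have := dvdp_leq h0 mh; rewrite {1}e size_mul //.
  have : (0 < size (gcdp m g))%N by rewrite size_poly_gt0.
  have : (0 < size h)%N by rewrite size_poly_gt0.
  by move=> hs ds le; exact: addn_pred_leq hs ds le.
have H0 g : ((fst_ g).[a] == 0) = ((snd_ g).[b] == 0).
  apply/idP/idP => [/mdvd/dvdpP[h ->]|gb].
    by rewrite rmorphM hornerM /= (rootP mb) mulr0.
  apply: contraLR gb => /cop.
  case/Bezout_eq1_coprimepP => -[u v] /= e.
  have := congr1 (fun q => (snd_ q).[b]) e.
  rewrite rmorphD !rmorphM /= hornerD !hornerM (rootP mb) mulr0 add0r.
  rewrite rmorph1 hornerC => e1; apply: contra_eqN e1 => /eqP ->.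
  by rewrite mulr0 eq_sym oner_eq0.
pose ev (g : {poly iso_field GG}) : K * M := ((fst_ g).[a], (snd_ g).[b]).
exists [set ev g | g in setT]%classic; split; last first.
- by exists 'X => //; rewrite /ev !map_polyX !hornerX.
- by move=> z Gz; exists (IsoField (GG := GG) (asboolT Gz))%:P => //;
    rewrite /ev !map_polyC !hornerC /= -surjective_pairing.
split; last by move=> _ [g _ <-]; apply: H0.
split.
- by exists 1 => //; rewrite /ev !rmorph1 !hornerC.
- move=> _ _ [g _ <-] [h _ <-]; exists (g - h) => //.
  by rewrite /ev !rmorphB /= !hornerD !hornerN.
- move=> _ _ [g _ <-] [h _ <-]; exists (g * h) => //.
  by rewrite /ev !rmorphM /= !hornerM.
- move=> _ [g _ <-]; have [g0|gn0] := eqVneq (fst_ g).[a] 0.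
    exists 0 => //; rewrite /ev /pair_inv /= g0.
    have := H0 g; rewrite g0 eqxx => /esym/eqP ->.
    by rewrite !rmorph0 !hornerC !invr0.
  have : coprimep g m by rewrite coprimep_sym cop.
  case/Bezout_eq1_coprimepP => -[u v] /= e; exists u => //.
  have e1 := congr1 (fun q => (fst_ q).[a]) e.
  have e2 := congr1 (fun q => (snd_ q).[b]) e.
  move: e1 e2; rewrite !rmorphD !rmorphM /= !hornerD !hornerM.
  rewrite (rootP mb) (rootP ma) !mulr0 !addr0 !rmorph1 !hornerC => e1 e2.
  congr pair => /=.
    by apply: (mulIf gn0); rewrite e1 mulVf.
  have gn0' : (snd_ g).[b] != 0 by rewrite -H0.
  by apply: (mulIf gn0'); rewrite e2 mulVf.
Qed.

(** The minimal polynomial of [a] divides [p], so its transported copy divides a split polynomial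
    and has a root. *)
Lemma partial_iso_extend (a : K) (p : {poly iso_field GG}) (s : seq M) :
  p != 0 -> root (fst_ p) a -> snd_ p %| \prod_(c <- s) ('X - c%:P) ->
  exists G' : set (K * M), [/\ partial_iso G', (G `<=` G')%classic
    & exists b, G' (a, b)].
Proof.
move=> p0 pa ps.
have exm : exists n, `[< exists m : {poly iso_field GG},
    [/\ m != 0, root (fst_ m) a & size m = n] >].
  by exists (size p); apply/asboolP; exists p.
case: (ex_minnP exm) => n /asboolP[m [m0 ma sm]] minm.
have mdvd g : root (fst_ g) a -> m %| g.
  move=> ga; apply/negPn/negP => ng; have := ltn_modp g m; rewrite m0 ltnNge.
  rewrite sm minm //; apply/asboolP; exists (g %% m); split=> //.
  move: ga; rewrite {1}(divp_eq g m) rmorphD rmorphM /= rootE hornerD hornerM.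
  by rewrite (rootP ma) mulr0 add0r.
have m1 : (1 < size m)%N.
  rewrite ltnNge; apply/negP => /size1_polyC e; move: ma m0; rewrite e map_polyC.
  by rewrite rootC /= polyC_eq0 iso_val_eq0 => ->.
have [b mb] : exists b, root (snd_ m) b.
  apply: (@root_dvd_split _ _ s); first by rewrite size_map_poly.
  by apply: dvdp_trans ps; rewrite dvdp_map; apply: mdvd.
have [G' [pG' GG' Gab]] := partial_iso_extend_at m0 mdvd ma mb.
by exists G'; split=> //; exists b.
Qed.

(** A quadratic without roots is irreducible, hence minimal for [a]. Either root on the other side
    is then allowed as [b], which is what lets a tree automorphism exchange two siblings. *)
Lemma partial_iso_extend_quadratic (a : K) (b : M) (q : {poly iso_field GG}) :
  size q = 3%N -> (forall z, ~~ root q z) ->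
  root (fst_ q) a -> root (snd_ q) b ->
  exists G' : set (K * M), [/\ partial_iso G', (G `<=` G')%classic & G' (a, b)].
Proof.
move=> q3 nr qa qb.
have [q1 qirr] : irreducible_poly q by apply: cubic_irreducible; rewrite ?q3.
apply: (@partial_iso_extend_at a b q) => //; first by rewrite -size_poly_gt0 q3.
move=> g ga; have [cop|] := boolP (coprimep q g).
  have /Bezout_eq1_coprimepP[[u v] /= e] := cop.
  have := congr1 (fun p => (fst_ p).[a]) e.
  rewrite rmorphD !rmorphM rmorph1 hornerD !hornerM hornerC /= (rootP qa) (rootP ga).
  by rewrite !mulr0 addr0 => /esym/eqP; rewrite oner_eq0.
rewrite coprimep_def => /qirr/(_ (dvdp_gcdl _ _)) dq.
by rewrite -(eqp_dvdl _ dq) dvdp_gcdr.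
Qed.

End Extension.

(** * Maximal partial isomorphisms *)

Section Maximal.
Variables K M : fieldType.
Implicit Types G : set (K * M).

Lemma field_closed_bigcup (F : set (set (K * M))) :
  (exists G, F G) ->
  (forall G H, F G -> F H -> exists I, [/\ F I, (G `<=` I)%classic & (H `<=` I)%classic]) ->
  (forall G, F G -> field_closed G) -> field_closed (\bigcup_(G in F) G)%classic.
Proof.
move=> [G0 FG0] dir Fc; split.
- by exists G0 => //; case: (Fc _ FG0).
- move=> z w [G FG Gz] [H FH Hw]; have [I [FI GI HI]] := dir _ _ FG FH.
  by exists I => //; case: (Fc _ FI) => _ + _ _; apply; [exact: GI|exact: HI].
- move=> z w [G FG Gz] [H FH Hw]; have [I [FI GI HI]] := dir _ _ FG FH.
  by exists I => //; case: (Fc _ FI) => _ _ + _; apply; [exact: GI|exact: HI].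
- by move=> z [G FG Gz]; exists G => //; case: (Fc _ FG) => _ _ _; apply.
Qed.

Lemma zero_compatible_bigcup (F : set (set (K * M))) :
  (forall G, F G -> zero_compatible G) -> zero_compatible (\bigcup_(G in F) G)%classic.
Proof. by move=> Fc z [G /Fc]; apply. Qed.

Definition maximal_iso G := partial_iso G /\
  forall G', partial_iso G' -> (G `<=` G' -> G' `<=` G)%classic.

Lemma maximal_iso_ex G0 : partial_iso G0 ->
  exists2 G, maximal_iso G & (G0 `<=` G)%classic.
Proof.
(* [Zorn_bigcup] also tests the empty chain, whose union is empty; hence [P] admits [set0]. *)
move=> pG0; pose P G := G = set0 \/ (partial_iso G /\ (G0 `<=` G)%classic).
have [|G [[G_0|[pG GG0]] maxG]] := @Zorn_bigcup _ P.
- move=> F FP totF; have [[G FG GG]|noF] := pselect (exists2 G, F G & G <> set0); last first.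
    left; apply/seteqP; split=> // z [G FG Gz]; apply: noF; exists G => // G_0.
    by rewrite G_0 in Gz.
  right; pose F' := [set H | F H /\ H <> set0]%classic.
  have F'P H : F' H -> partial_iso H /\ (G0 `<=` H)%classic.
    by case=> FH H0; case: (FP _ FH).
  have -> : (\bigcup_(X in F) X = \bigcup_(X in F') X)%classic.
    apply/seteqP; split=> [z [H FH Hz]|z [H [FH _] Hz]]; last by exists H.
    by exists H => //; split=> // H0; rewrite H0 in Hz.
  split; last by move=> z G0z; exists G => //; apply: (F'P G _).2.
  split; last by apply: zero_compatible_bigcup => H /F'P[[]].
  apply: field_closed_bigcup; first by exists G.
    move=> H H' F'H F'H'; case: (totF _ _ F'H.1 F'H'.1) => HH.
      by exists H'; split => //; exact: subset_refl.
    by exists H; split => //; exact: subset_refl.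
  by move=> H /F'P[[]].
- exfalso; apply: (maxG G0); last by right; split=> //; exact: subset_refl.
  rewrite G_0; split; first exact: sub0set.
  by move=> /(_ 1) H; apply: H; case: (pG0.1).
- exists G => //; split=> // G' pG' GG'; apply: contrapT => nGG'.
  apply: (maxG G') => //; right; split=> // z /GG0; exact: GG'.
Qed.

(** This replaces the extension of isomorphisms to algebraic closures: the extension that reaches
    [a] is contained in [G] by maximality. *)
Lemma maximal_iso_root G (maxG : maximal_iso G) (GG : partial_iso G) (a : K)
    (p : {poly iso_field GG}) (s : seq M) :
  p != 0 -> root (map_poly (@iso_fst _ _ _ GG) p) a ->
  map_poly (@iso_snd _ _ _ GG) p %| \prod_(c <- s) ('X - c%:P) ->
  exists b, G (a, b).
Proof.
move=> p0 pa ps; have [G' [pG' GG' [b Gb]]] := partial_iso_extend p0 pa ps.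
by exists b; apply: maxG.2 Gb.
Qed.

Definition field_gen (S : set (K * M)) : set (K * M) :=
  [set z | forall G, field_closed G -> (S `<=` G)%classic -> G z]%classic.

Lemma field_gen_closed S : field_closed (field_gen S).
Proof.
split.
- by move=> G [].
- by move=> z w Sz Sw G GG SG; case: (GG) => _ + _ _; apply; [apply: Sz|apply: Sw].
- by move=> z w Sz Sw G GG SG; case: (GG) => _ _ + _; apply; [apply: Sz|apply: Sw].
- by move=> z Sz G GG SG; case: (GG) => _ _ _; apply; apply: Sz.
Qed.

Lemma field_gen_sub S : (S `<=` field_gen S)%classic.
Proof. by move=> z Sz G _; apply. Qed.

Lemma field_gen_min S G : field_closed G -> (S `<=` G)%classic ->
  (field_gen S `<=` G)%classic.
Proof. by move=> GG SG z; apply. Qed.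

Lemma partial_iso_functional G a b b' : partial_iso G ->
  G (a, b) -> G (a, b') -> b = b'.
Proof.
move=> [[_ GB _ _] H] ab ab'; have := H _ (GB _ _ ab ab').
by rewrite /= subrr eqxx => /esym; rewrite subr_eq0 => /eqP.
Qed.

Lemma partial_iso_injective G a a' b : partial_iso G ->
  G (a, b) -> G (a', b) -> a = a'.
Proof.
move=> [[_ GB _ _] H] ab ab'; have := H _ (GB _ _ ab ab').
by rewrite /= subrr eqxx subr_eq0 => /eqP.
Qed.

End Maximal.

Section Swap.
Variables K M : fieldType.

(** The inverse isomorphism; it will supply the inverse of the action on fibres. *)
Definition swap_graph (G : set (K * M)) : set (M * K) :=
  [set z | G (z.2, z.1)]%classic.

Lemma swap_partial_iso G : partial_iso G -> partial_iso (swap_graph G).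
Proof.
move=> [[G1 GB GM GV] H]; split; last by move=> z /H /= ->.
split=> //= [z w|z w|z]; [exact: GB|exact: GM|exact: GV].
Qed.
End Swap.

Lemma swap_maximal_iso (K M : fieldType) (G : set (K * M)) :
  maximal_iso G -> maximal_iso (swap_graph G).
Proof.
move=> [pG maxG]; split; first exact: swap_partial_iso.
move=> G' pG' GG' [a b] G'ab; apply: (maxG (swap_graph G')) => //.
  exact: swap_partial_iso.
by move=> [x y] Gxy; apply: GG'.
Qed.

(** * Isomorphisms of simple transcendental extensions *)

Section Transcendental.
Variables (F K M : fieldType) (iK : {rmorphism F -> K}) (iM : {rmorphism F -> M}).
Variables (a : K) (b : M).

Definition transcendental (E : fieldType) (i : {rmorphism F -> E}) (x : E) :=
  forall P : {poly F}, P != 0 -> (map_poly i P).[x] != 0.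

Hypotheses (aT : transcendental iK a) (bT : transcendental iM b).

(** The isomorphism F(a) -> F(b) over [F]. *)
Definition rational_graph : set (K * M) := [set z | exists P Q : {poly F},
  Q != 0 /\ z = ((map_poly iK P).[a] / (map_poly iK Q).[a],
                 (map_poly iM P).[b] / (map_poly iM Q).[b])]%classic.

Lemma rational_graph_iso : partial_iso rational_graph.
Proof.
split; last first.
  move=> _ [P [Q [Q0 ->]]] /=; rewrite !mulf_eq0 !invr_eq0.
  rewrite (negPf (aT Q0)) (negPf (bT Q0)) !orbF.
  have [->|P0] := eqVneq P 0; first by rewrite !rmorph0 !hornerC !eqxx.
  by rewrite (negPf (aT P0)) (negPf (bT P0)).
split.
- exists 1, 1; rewrite oner_eq0; split=> //.
  by rewrite !rmorph1 !hornerC !divr1.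
- move=> _ _ [P [Q [Q0 ->]]] [R [S [S0 ->]]].
  exists (P * S - R * Q), (Q * S); split; first by rewrite mulf_neq0.
  have := (aT Q0, bT Q0, aT S0, bT S0) => -[[[H1 H2] H3] H4].
  congr pair; rewrite /= !rmorphB !rmorphM /= hornerD hornerN !hornerM.
    by rewrite -mulNr addf_div // mulNr.
  by rewrite -mulNr addf_div // mulNr.
- move=> _ _ [P [Q [Q0 ->]]] [R [S [S0 ->]]].
  exists (P * R), (Q * S); split; first by rewrite mulf_neq0.
  by congr pair; rewrite /= !rmorphM /= !hornerM mulf_div.
- move=> _ [P [Q [Q0 ->]]]; have [->|P0] := eqVneq P 0.
    exists 0, 1; rewrite oner_eq0; split=> //.
    by rewrite /pair_inv !rmorph0 !hornerC /= !mul0r !invr0.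
  by exists Q, P; split=> //; rewrite /pair_inv /= !invf_div.
Qed.

Lemma rational_graph_gen : rational_graph (a, b).
Proof.
exists 'X, 1; rewrite oner_eq0; split=> //.
by rewrite !map_polyX !rmorph1 !hornerX !hornerC !divr1.
Qed.

Lemma rational_graph_const c : rational_graph (iK c, iM c).
Proof.
exists c%:P, 1; rewrite oner_eq0; split=> //.
by rewrite !rmorph1 !map_polyC !hornerC !divr1.
Qed.

End Transcendental.

Lemma rmorphism_of (R S : pzRingType) (f : R -> S) :
  zmod_morphism f -> monoid_morphism f -> exists g : {rmorphism R -> S}, g =1 f.
Proof.
move=> fB fM.
pose fZ := GRing.isZmodMorphism.Build R S f fB.
pose fMM := GRing.isMonoidMorphism.Build R S f fM.
by exists (HB.pack_for {rmorphism R -> S} f fZ fMM).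
Qed.

(** * Geometric points of finite etale algebras *)

(* L is separably closed but perhaps not perfect, so commuting matrices over L
   need have a common eigenvector only after a Frobenius twist.  The twist can be
   undone because an idempotent equals its own q-th power. *)
Section FrobeniusTwist.
Variable L : fieldType.

(** In characteristic 0 the condition on q forces q = 1. *)
Definition frobenius_power (chi : {rmorphism L -> L}) : Prop :=
  exists q : nat, [pchar L].-nat q /\ forall a, chi a = a ^+ q.

Lemma frobenius_power_id : frobenius_power idfun.
Proof. by exists 1%N. Qed.

Lemma frobenius_power_comp (chi psi : {rmorphism L -> L}) :
  frobenius_power chi -> frobenius_power psi -> frobenius_power (chi \o psi).
Proof.
move=> [q [qn qE]] [r [rn rE]]; exists (r * q)%N; split; first by rewrite pnatM rn.
by move=> a; rewrite /= qE rE exprM.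
Qed.

Lemma frobenius_power_aut p (Lp : p \in [pchar L]) :
  frobenius_power (pFrobenius_aut Lp).
Proof.
exists p; split=> //; rewrite pnatE //; exact: pcharf_prime Lp.
Qed.

(** Induction on the degree. If P' = 0, then P = Q(X^p), and a root of a twist of Q is a root of P
    after one more Frobenius Fr, since (Fr Q)(r^p) = Fr(Q(r)). If P' is nonzero and P is
    inseparable, gcd(P, P') is a nonconstant factor of smaller degree. *)
Lemma frobenius_root (P : {poly L}) : separably_closed L -> (1 < size P)%N ->
  exists chi : {rmorphism L -> L}, frobenius_power chi /\
    exists r, root (map_poly chi P) r.
Proof.
move=> Lsep; have [n] := ubnP (size P); elim: n P => // n IH P; rewrite ltnS => Pn P1.
have P0 : P != 0 by rewrite -size_poly_gt0 ltnW.
have [dP|dP] := eqVneq P^`() 0.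
  have lead0 : P`_(size P).-1 != 0 by rewrite -lead_coefE lead_coef_eq0.
  have szP : (size P).-1.+1 = size P by rewrite prednK // ltnW.
  have P1' : (0 < (size P).-1)%N by rewrite -ltnS szP.
  have P00 : ((size P).-1%:R == 0 :> L).
    have := congr1 (fun q : {poly L} => q`_(size P).-1.-1) dP.
    rewrite coef_deriv prednK // coef0 -(mulr_natr P`__) => /eqP.
    by rewrite mulf_eq0 (negPf lead0).
  have [p Lp] := natf0_pchar P1' P00; have p_pr := pcharf_prime Lp.
  have p0 := prime_gt0 p_pr.
  have Pp i : P`_i != 0 -> (p %| i)%N.
    case: i => [//|i] Pi; rewrite (dvdn_pcharf Lp).
    have := congr1 (fun q : {poly L} => q`_i) dP.
    rewrite coef_deriv coef0 -(mulr_natr P`__) => /eqP.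
    by rewrite mulf_eq0 (negPf Pi).
  pose Q := \poly_(i < size P) P`_(p * i).
  have QP : P = Q \Po 'X^p.
    apply/polyP => i; rewrite coef_comp_poly_Xn // coef_poly.
    case: ifP => [pi|npi]; last by apply/eqP/negPn/negP => /Pp; rewrite npi.
    rewrite mulnC divnK //; case: ifP => // /negbT; rewrite -leqNgt => szi.
    by rewrite nth_default // (leq_trans szi) // leq_div.
  have [k def_d] := dvdnP (Pp _ lead0).
  have szQ : (size Q <= (k.+1))%N.
    apply/leq_sizeP => j kj; rewrite coef_poly; case: ifP => // _.
    by rewrite nth_default // -szP def_d [(p * j)%N]mulnC ltn_pmul2r.
  have Q1 : (1 < size Q)%N.
    have Qk : Q`_k != 0.
      rewrite coef_poly [(p * k)%N]mulnC -def_d ifT //.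
      by rewrite -szP def_d ltnS leq_pmulr.
    have k0 : (0 < k)%N by move: P1'; rewrite def_d muln_gt0 => /andP[].
    by rewrite ltnNge; apply: contra Qk => sQ; rewrite nth_default // (leq_trans sQ).
  have kd : (k.+1 < size P)%N.
    rewrite -szP def_d ltnS; have := prime_gt1 p_pr; move: P1'; rewrite def_d.
    by rewrite muln_gt0 => /andP[k0 _] p1; rewrite -[X in (X < _)%N]muln1 ltn_pmul2l.
  have [|chi [chiF [r rr]]] := IH Q _ Q1.
    by rewrite (leq_ltn_trans szQ) // (leq_trans kd).
  exists (pFrobenius_aut Lp \o chi); split.
    exact: frobenius_power_comp (frobenius_power_aut Lp) chiF.
  exists r; rewrite QP map_comp_poly map_polyXn rootE horner_comp hornerXn.
  rewrite map_poly_comp /= -(pFrobenius_autE Lp) horner_map.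
  by rewrite (rootP rr) rmorph0.
have [sepP|nsep] := boolP (separable_poly P).
  exists idfun; split; first exact: frobenius_power_id.
  by have [r rr] := Lsep _ sepP P1; exists r; rewrite map_poly_id.
have g1 : (1 < size (gcdp P P^`()))%N.
  rewrite ltn_neqAle eq_sym -coprimep_def.
  apply/andP; split; first by apply: contra nsep; rewrite unlock.
  by rewrite size_poly_gt0 gcdp_eq0 negb_and P0.
have [|chi [chiF [r rr]]] := IH (gcdp P P^`()) _ g1.
  apply: leq_trans Pn; apply: leq_ltn_trans (lt_size_deriv P0).
  exact: leq_gcdpr.
exists chi; split=> //; exists r; move: rr; rewrite -!dvdp_XsubCl => rr.
by apply: dvdp_trans rr _; rewrite dvdp_map dvdp_gcdl.
Qed.

(** Induction on the rank of [U]: if some [M c] is not scalar on [U], it has an eigenvalue there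
    after a twist, and [U] is cut down to the eigenspace, which is stable by commutativity. *)
Lemma twisted_eigenvector (T : Type) n (M : T -> 'M[L]_n) (U : 'M[L]_n) :
  separably_closed L -> U != 0 ->
  (forall c d, comm_mx (M c) (M d)) -> (forall c, stablemx U (M c)) ->
  exists chi : {rmorphism L -> L}, frobenius_power chi /\
    exists v : 'rV[L]_n, [/\ v != 0, (v <= map_mx chi U)%MS &
      forall c, exists l, v *m map_mx chi (M c) = l *: v].
Proof.
move=> Lsep; have [m] := ubnP (\rank U); elim: m M U => // m IH M U.
rewrite ltnS => rU U0 comM stM.
have [sc|/existsNP[c nc]] := pselect (forall c, exists l, U *m M c = l *: U).
  exists idfun; split; first exact: frobenius_power_id.
  have idE (X : 'M[L]_n) : map_mx idfun X = X by apply/matrixP => i j; rewrite mxE.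
  exists (nz_row U); split; first by rewrite nz_row_eq0.
    by rewrite idE nz_row_sub.
  move=> c; have [l e] := sc c; exists l; rewrite idE.
  have /submxP[D ->] := nz_row_sub U.
  by rewrite -mulmxA e scalemxAr.
have rU0 : (0 < \rank U)%N by rewrite lt0n mxrank_eq0.
pose N := restrictmx U (M c).
have NE : row_base U *m M c = N *m row_base U.
  by rewrite /N /conjmx mulmxKpV // stablemx_row_base.
have [|chi [chiF [r]]] := @frobenius_root (char_poly N) Lsep.
  by rewrite size_char_poly.
rewrite map_char_poly -eigenvalue_root_char => /eigenvalueP[w wN w0].
pose U' := (map_mx chi U :&: eigenspace (map_mx chi (M c)) r)%MS.
have U'0 : U' != 0.
  pose w' := w *m map_mx chi (row_base U).
  have w'0 : w' != 0.
    apply: contra w0; rewrite /w' => /eqP e.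
    have rf : row_free (map_mx chi (row_base U)) by rewrite row_free_map row_base_free.
    by apply/eqP; apply: (row_free_inj rf); rewrite e mul0mx.
  have : (w' <= U')%MS.
    rewrite sub_capmx; apply/andP; split.
      apply: submx_trans (submxMl _ _) _.
      by rewrite map_submx eq_row_base.
    apply/eigenspaceP; rewrite /w' -mulmxA -map_mxM NE map_mxM mulmxA wN.
    by rewrite scalemxAl.
  by apply: contraTneq => ->; rewrite submx0.
have comM' d d' : comm_mx (map_mx chi (M d)) (map_mx chi (M d')).
  by rewrite /comm_mx -!map_mxM comM.
(* Otherwise the twisted [M c] is the scalar [r] on the twisted [U]. Then [r] is a quotient of
   twisted matrix entries, so it lies in the image of [chi], and [M c] was already scalar on [U]. *)
have rU' : (\rank U' < \rank U)%N.
  rewrite -(mxrank_map chi U) ltnNge; apply/negP => rr; apply: nc.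
  have : (map_mx chi U <= U')%MS.
    by rewrite -(mxrank_leqif_sup (capmxSl _ _)) eqn_leq rr mxrankS ?capmxSl.
  rewrite sub_capmx => /andP[_ /eigenspaceP e].
  have [i [j Uij]] : exists i j, U i j != 0.
    apply: contrapT => H; case/negP: U0; apply/eqP/matrixP => i j; rewrite mxE.
    by apply/eqP/negPn/negP => Uij; apply: H; exists i, j.
  exists ((U *m M c) i j / U i j); apply: (map_mx_inj (f := chi)).
  have -> : map_mx chi (U *m M c) = r *: map_mx chi U by rewrite map_mxM e.
  rewrite map_mxZ fmorph_div; congr (_ *: _).
  have := congr1 (fun X : 'M_n => X i j) e; rewrite -map_mxM !mxE => ->.
  by rewrite mulfK // fmorph_eq0.
have stM' d : stablemx U' (map_mx chi (M d)).
  rewrite sub_capmx; apply/andP; split.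
    apply: submx_trans (submxMr _ (capmxSl _ _)) _.
    by rewrite -map_mxM map_submx.
  apply: submx_trans (submxMr _ (capmxSr _ _)) _.
  exact: comm_mx_stable_eigenspace.
have [chi' [chi'F [v [v0 vU vs]]]] :=
  IH (fun d => map_mx chi (M d)) U' (leq_trans rU' rU) U'0 comM' stM'.
exists (chi' \o chi); split; first exact: frobenius_power_comp.
exists v; split=> //.
  rewrite map_mx_comp; apply: submx_trans vU _; rewrite map_submx.
  exact: capmxSl.
by move=> d; rewrite map_mx_comp; apply: vs.
Qed.

Lemma frobenius_sum (R : nzRingType) q (I : Type) (r : seq I) (F : I -> R) :
  [pchar R].-nat q -> (forall i j, GRing.comm (F i) (F j)) ->
  (\sum_(i <- r) F i) ^+ q = \sum_(i <- r) F i ^+ q.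
Proof.
move=> qR; have [|q1] := leqP q 1.
  case: q qR => [|[|//]]; first by rewrite /pnat.
  move=> _ _ _; rewrite expr1.
  by apply: eq_bigr => i _; rewrite expr1.
pose p := pdiv q; have Rp : p \in [pchar R] by rewrite (pnatPpi qR) // pi_pdiv.
have /p_natP[e ->] : p.-nat q by rewrite -(eq_pnat _ (pcharf_eq Rp)).
elim: e F => [|e IH] F comF.
  by rewrite expn0 expr1; apply: eq_bigr => i _; rewrite expr1.
have step : (\sum_(i <- r) F i) ^+ p = \sum_(i <- r) F i ^+ p.
  elim: r {IH} => [|i r IHr]; first by rewrite !big_nil expr0n gtn_eqF ?prime_gt0 ?(pcharf_prime Rp).
  rewrite !big_cons -!(pFrobenius_autE Rp) pFrobenius_autD_comm.
    by rewrite !pFrobenius_autE IHr.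
  by apply: commr_sum.
rewrite expnS exprM step IH.
  by apply: eq_bigr => i _; rewrite -exprM.
by move=> i j; apply/commrX/commr_sym/commrX.
Qed.

(** Compute e = e^q termwise, the matrices commuting: the coefficient c_i^q is chi(c_i), so every
    term is in the image of [chi]. *)
Lemma frobenius_idempotent (chi : {rmorphism L -> L}) n (I : finType)
    (c : I -> L) (M : I -> 'M[L]_n) (e : 'M[L]_n) :
  frobenius_power chi -> (forall i j, comm_mx (M i) (M j)) ->
  e = \sum_i c i *: map_mx chi (M i) -> e *m e = e ->
  exists e0, e = map_mx chi e0.
Proof.
move=> [q [qL qE]] comM defe ee; case: n => [|n] in M e comM defe ee *.
  by exists 0; apply/matrixP => -[].
have q0 : (0 < q)%N by case/andP: qL.
have eq : e ^+ q = e.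
  case: q q0 {qL qE} => // q _; elim: q => [|q IH]; first by rewrite expr1.
  by rewrite exprS IH.
exists (\sum_i c i *: M i ^+ q).
rewrite -{1}eq defe frobenius_sum.
- rewrite raddf_sum /=; apply: eq_bigr => i _; rewrite exprZn map_mxZ rmorphXn /=.
  by rewrite qE.
- by rewrite (eq_pnat _ (pchar_lalg _)).
move=> i j; rewrite /GRing.comm -!scalerAl -!scalerAr !scalerA mulrC.
by congr (_ *: _); rewrite -!rmorphM /=; congr map_mx; apply: comM.
Qed.

End FrobeniusTwist.

(* [\sum_i b i (x) x i] is the separability idempotent of [B (x) B]. *)
Record separability (A B : comPzRingType) (s : {rmorphism A -> B}) (n : nat)
    (b : 'I_n -> B) (beta : 'I_n -> B -> A) (x : 'I_n -> B) : Prop := {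
  sep_functional : forall i, functional s (beta i);
  sep_dual : forall y, y = \sum_(i < n) s (beta i y) * b i;
  sep_one : \sum_(i < n) b i * x i = 1;
  sep_swap : forall k c, \sum_(i < n) s (beta k (c * b i)) * x i = c * x k }.

Section Functional.
Variables (A B : comPzRingType) (s : {rmorphism A -> B}) (l : B -> A).
Hypothesis lF : functional s l.

Lemma functionalD y z : l (y + z) = l y + l z.
Proof. by rewrite -[y]mul1r -(rmorph1 s) lF rmorph1 !mul1r. Qed.

Lemma functional0 : l 0 = 0.
Proof. by apply: (addrI (l 0)); rewrite -functionalD !addr0. Qed.

Lemma functionalZ a y : l (s a * y) = a * l y.
Proof. by rewrite -[s a * y]addr0 lF functional0 addr0. Qed.

Lemma functional_sum (I : Type) (r : seq I) (F : I -> B) :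
  l (\sum_(i <- r) F i) = \sum_(i <- r) l (F i).
Proof.
by elim/big_rec2: _ => [|i y z _ <-]; rewrite ?functional0 ?functionalD.
Qed.

End Functional.

(** The perfect trace form represents the coordinate [beta i] by an element [x i], and the
    identities may be checked under the trace. In coordinates, [sep_swap] says (c (x) 1) e = (1 (x)
    c) e for the separability idempotent e. *)
Lemma finite_etale_separability (A B : comPzRingType) (s : {rmorphism A -> B}) :
  finite_etale s -> exists n b beta x, @separability A B s n b beta x.
Proof.
move=> [n [b [beta [betaF dual perf]]]].
pose Tr z := \sum_(i < n) beta i (z * b i).
have TrF : functional s Tr.
  move=> a y z; rewrite /Tr mulr_sumr -big_split /=; apply: eq_bigr => i _.
  by rewrite mulrDl -mulrA betaF.
have uniqTr y z : (forall w, Tr (y * w) = Tr (z * w)) -> y = z.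
  move=> yz; have [|u [_ uU]] := perf (fun w => Tr (y * w)).
    by move=> a v w; rewrite mulrDr mulrCA TrF.
  by rewrite -(uU y) // (uU z).
have /choice[x xP] : forall i, exists x, forall y, beta i y = Tr (x * y).
  by move=> i; have [x [xP _]] := perf _ (betaF i); exists x.
exists n, b, beta, x; split=> //.
- apply: uniqTr => w; rewrite mulr_suml (functional_sum TrF) mul1r.
  by apply: eq_bigr => i _; rewrite xP -mulrA mulrC -mulrA.
- move=> k c; apply: uniqTr => w; rewrite mulr_suml (functional_sum TrF).
  have -> : Tr (c * x k * w) = beta k (c * w) by rewrite xP mulrCA mulrA.
  rewrite [in RHS](dual w) mulr_sumr (functional_sum (betaF k)).
  apply: eq_bigr => i _.
  by rewrite -mulrA (functionalZ TrF) -xP mulrCA (functionalZ (betaF k)) mulrC.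
Qed.

(** * Multiplication matrices and the separability idempotent *)

Section Matrices.
Variables (A B : comPzRingType) (s : {rmorphism A -> B}) (n : nat).
Variables (b : 'I_n -> B) (beta : 'I_n -> B -> A) (x : 'I_n -> B).
Hypothesis S : separability s b beta x.
Variables (E : comNzRingType) (chi : {rmorphism A -> E}).

(** As [b] need not be a basis, [mul_mx 1] is in general not the identity but the projector that
    cuts B (x) E out of E^n. *)
Definition mul_mx (c : B) : 'M[E]_n := \matrix_(i, j) chi (beta i (c * b j)).

Let betaF := sep_functional S.

Lemma mul_mxM c d : mul_mx (c * d) = mul_mx c *m mul_mx d.
Proof.
apply/matrixP => i j; rewrite !mxE -mulrA {1}(sep_dual S (d * b j)) mulr_sumr.
rewrite (functional_sum (betaF i)) rmorph_sum; apply: eq_bigr => k _.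
by rewrite !mxE mulrCA (functionalZ (betaF i)) rmorphM mulrC.
Qed.

Lemma mul_mx_lin a c d : mul_mx (s a * c + d) = chi a *: mul_mx c + mul_mx d.
Proof.
apply/matrixP => i j; rewrite !mxE mulrDl -mulrA (betaF i).
by rewrite rmorphD rmorphM.
Qed.

Lemma mul_mx_comm c d : comm_mx (mul_mx c) (mul_mx d).
Proof. by rewrite /comm_mx -!mul_mxM mulrC. Qed.

Definition lies_over (phi : B -> E) := forall a, phi (s a) = chi a.

Definition hom_row (phi : B -> E) : 'rV[E]_n := \row_j phi (b j).
(** For a point [phi], multiplication by the image of the separability idempotent under phi (x) 1,
    that is, by the idempotent of B (x) E that isolates [phi]. *)
Definition hom_idem (phi : B -> E) : 'M[E]_n := \sum_i phi (b i) *: mul_mx (x i).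
(** The separability idempotent evaluated at the pair; for points in a domain it is the indicator of
    phi = psi. *)
Definition pairing (phi psi : B -> E) : E := \sum_i phi (b i) * psi (x i).

Lemma hom_expand (phi : {rmorphism B -> E}) y : lies_over phi ->
  phi y = \sum_i chi (beta i y) * phi (b i).
Proof.
move=> phis; rewrite {1}(sep_dual S y) rmorph_sum; apply: eq_bigr => i _.
by rewrite rmorphM phis.
Qed.

(** The image under phi (x) mu of the identity (1 (x) c) e = (c (x) 1) e. *)
Lemma hom_swap (V : lmodType E) (phi : {rmorphism B -> E}) (mu : B -> V) c :
  lies_over phi -> (forall a y z, mu (s a * y + z) = chi a *: mu y + mu z) ->
  \sum_i phi (b i) *: mu (c * x i) = phi c *: \sum_i phi (b i) *: mu (x i).
Proof.
move=> phis muL.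
have mu0 : mu 0 = 0.
  have := muL 1 0 0; rewrite mulr0 addr0 rmorph1 scale1r => e.
  by apply: (addIr (mu 0)); rewrite add0r -e.
have muD y z : mu (y + z) = mu y + mu z.
  by rewrite -[y]mul1r -(rmorph1 s) muL !rmorph1 mul1r scale1r.
have mu_sum (F : 'I_n -> B) : mu (\sum_i F i) = \sum_i mu (F i).
  by apply: (big_morph mu muD mu0).
have muZ a y : mu (s a * y) = chi a *: mu y.
  by rewrite -[s a * y]addr0 muL mu0 addr0.
rewrite scaler_sumr; under [RHS]eq_bigr => i _.
  rewrite scalerA -rmorphM (hom_expand _ phis) scaler_suml.
  under eq_bigr => k _ do rewrite mulrC -scalerA -muZ.
  over.
rewrite exchange_big /=; apply: eq_bigr => k _.
by rewrite -scaler_sumr -mu_sum (sep_swap S).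
Qed.

Lemma pairing_self (phi : {rmorphism B -> E}) : pairing phi phi = 1.
Proof.
rewrite -(rmorph1 phi) -(sep_one S) rmorph_sum; apply: eq_bigr => i _.
by rewrite rmorphM.
Qed.

Lemma pairing_swap (phi psi : {rmorphism B -> E}) c : lies_over phi -> lies_over psi ->
  psi c * pairing phi psi = phi c * pairing phi psi.
Proof.
move=> phis psis.
have := @hom_swap E^o phi psi c phis _; rewrite /GRing.scale /= => <-.
  rewrite mulr_sumr; apply: eq_bigr => i _.
  by rewrite rmorphM mulrCA.
by move=> a y z; rewrite rmorphD rmorphM psis.
Qed.

Lemma mul_mx_idem (phi : {rmorphism B -> E}) c : lies_over phi ->
  mul_mx c *m hom_idem phi = phi c *: hom_idem phi.
Proof.
move=> phis; rewrite -hom_swap //; last exact: mul_mx_lin.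
by rewrite mulmx_sumr; apply: eq_bigr => i _; rewrite -scalemxAr mul_mxM.
Qed.

Lemma hom_idem_comm (phi : B -> E) (M : 'M[E]_n) :
  (forall c, comm_mx (mul_mx c) M) -> comm_mx (hom_idem phi) M.
Proof.
move=> cM; rewrite /comm_mx mulmx_suml mulmx_sumr; apply: eq_bigr => i _.
by rewrite -scalemxAl -scalemxAr cM.
Qed.

Lemma hom_idem_mul_mx (phi : {rmorphism B -> E}) c : lies_over phi ->
  hom_idem phi *m mul_mx c = phi c *: hom_idem phi.
Proof.
move=> phis; rewrite -mul_mx_idem //; apply: hom_idem_comm => d.
exact: mul_mx_comm.
Qed.

Lemma hom_rowM (phi : {rmorphism B -> E}) c : lies_over phi ->
  hom_row phi *m mul_mx c = phi c *: hom_row phi.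
Proof.
move=> phis; apply/rowP => j; rewrite !mxE -rmorphM [RHS]hom_expand //.
by apply: eq_bigr => i _; rewrite !mxE mulrC.
Qed.

Lemma hom_row_idem (phi psi : {rmorphism B -> E}) : lies_over psi ->
  hom_row psi *m hom_idem phi = pairing phi psi *: hom_row psi.
Proof.
move=> psis; rewrite mulmx_sumr scaler_suml; apply: eq_bigr => i _.
by rewrite -scalemxAr hom_rowM // scalerA.
Qed.

Lemma hom_idemM (phi psi : {rmorphism B -> E}) : lies_over psi ->
  hom_idem phi *m hom_idem psi = pairing phi psi *: hom_idem psi.
Proof.
move=> psis; rewrite mulmx_suml scaler_suml; apply: eq_bigr => i _.
by rewrite -scalemxAl mul_mx_idem // scalerA.
Qed.

Lemma hom_row_neq0 (phi : {rmorphism B -> E}) : lies_over phi -> hom_row phi != 0.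
Proof.
move=> phis; apply/eqP => e; have := oner_neq0 E; rewrite -(rmorph1 phi).
rewrite hom_expand // big1 ?eqxx // => i _.
by have := congr1 (fun v : 'rV_n => v 0 i) e; rewrite !mxE => ->; rewrite mulr0.
Qed.

(** The eigenspace of a character is a line: the functional [rho] attached to [r] satisfies rho(c
    b_j) = phi(c) r_j, so [r] is determined by [phi] and rho(1), which is the factor of
    proportionality. *)
Lemma eigen_rowE (phi : B -> E) (r : 'rV[E]_n) :
  (forall c, r *m mul_mx c = phi c *: r) -> phi 1 = 1 ->
  exists rho, r = rho *: hom_row phi.
Proof.
move=> H phi1; pose rho c := \sum_i r 0 i * chi (beta i c).
have rhoE c j : rho (c * b j) = phi c * r 0 j.
  have := congr1 (fun v : 'rV_n => v 0 j) (H c); rewrite !mxE => <-.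
  by apply: eq_bigr => i _; rewrite !mxE.
have rj j : r 0 j = rho (b j) by rewrite -[b j]mul1r rhoE phi1 mul1r.
exists (\sum_k chi (beta k 1) * r 0 k); apply/rowP => j; rewrite !mxE rj.
rewrite -[b j]mulr1 {1}(sep_dual S 1) mulr_sumr.
have -> : rho (\sum_k b j * (s (beta k 1) * b k)) =
    \sum_k chi (beta k 1) * rho (b j * b k).
  rewrite /rho; under [LHS]eq_bigr => i _ do rewrite (functional_sum (betaF i)) rmorph_sum mulr_sumr.
  rewrite exchange_big /=; apply: eq_bigr => k _; rewrite mulr_sumr; apply: eq_bigr => i _.
  by rewrite mulrCA (functionalZ (betaF i)) rmorphM mulrCA.
rewrite mulr1 mulr_suml; apply: eq_bigr => k _.
by rewrite rhoE -mulrA [phi _ * _]mulrC.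
Qed.

End Matrices.

(** * Complete splitting over a separably closed field *)

Section Splitting.
Variables (A B : comPzRingType) (s : {rmorphism A -> B}) (n : nat).
Variables (b : 'I_n -> B) (beta : 'I_n -> B -> A) (x : 'I_n -> B).
Hypothesis S : separability s b beta x.
Variables (L : fieldType) (pt : {rmorphism A -> L}).
Hypothesis Lsep : separably_closed L.

Local Notation mat := (mul_mx b beta pt).

Lemma mul_mxZ (E : comNzRingType) (chi : {rmorphism A -> E}) a c :
  mul_mx b beta chi (s a * c) = chi a *: mul_mx b beta chi c.
Proof.
apply/matrixP => i j; rewrite !mxE -mulrA (functionalZ (sep_functional S i)).
by rewrite rmorphM.
Qed.

Lemma mul_mxB (E : comNzRingType) (chi : {rmorphism A -> E}) c d :
  mul_mx b beta chi (c - d) = mul_mx b beta chi c - mul_mx b beta chi d.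
Proof.
rewrite -[c - d]addrC -[- d]mulN1r -(rmorph1 s) -rmorphN (mul_mx_lin S).
by rewrite rmorphN rmorph1 scaleN1r addrC.
Qed.

(** These are the projectors onto the factors of B (x) L that remain to be split. *)
Definition stable_idem (eps : 'M[L]_n) : Prop :=
  [/\ eps *m eps = eps, forall c, comm_mx eps (mat c) & eps *m mat 1 = eps].

Lemma eigen_hom (chi : {rmorphism A -> L}) (v : 'rV[L]_n) : v != 0 ->
  v *m mul_mx b beta chi 1 = v ->
  (forall c, exists l, v *m mul_mx b beta chi c = l *: v) ->
  exists psi : {rmorphism B -> L}, lies_over s chi psi /\
    forall c, v *m mul_mx b beta chi c = psi c *: v.
Proof.
move=> v0 v1 /choice[psi0 psi0P].
have inj l l' : l *: v = l' *: v -> l = l'.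
  by move=> /eqP; rewrite -subr_eq0 -scalerBl scaler_eq0 (negPf v0) orbF subr_eq0 => /eqP.
have psi1 : psi0 1 = 1 by apply: inj; rewrite -psi0P v1 scale1r.
have [|| psi psiE] := @rmorphism_of _ _ psi0.
- move=> c d; apply: inj.
  by rewrite -psi0P mul_mxB mulmxBr !psi0P -scalerBl.
- split=> // c d; apply: inj.
  by rewrite -psi0P (mul_mxM S) mulmxA psi0P -scalemxAl psi0P scalerA.
exists psi; split; last by move=> c; rewrite psiE.
move=> a; apply: inj; rewrite psiE -psi0P -[s a]mulr1 mul_mxZ.
by rewrite -scalemxAr v1.
Qed.

Lemma mul_mx_map (chi : {rmorphism L -> L}) c :
  mul_mx b beta (chi \o pt) c = map_mx chi (mat c).
Proof. by apply/matrixP => i j; rewrite !mxE. Qed.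

(** The idempotent [e] of [psi] is the twist of a matrix [e0]. As psi(c) is the eigenvalue in mat(c)
    e = psi(c) e, it is the twist of a ratio of entries of mat(c) e0 and e0. *)
Lemma frobenius_descent (chi : {rmorphism L -> L}) (psi : {rmorphism B -> L}) :
  frobenius_power chi -> lies_over s (chi \o pt) psi ->
  exists phi : {rmorphism B -> L}, lies_over s pt phi /\ forall c, psi c = chi (phi c).
Proof.
move=> chiF psis; pose e := hom_idem b beta x (chi \o pt) psi.
have ee : e *m e = e by rewrite (hom_idemM S) // (pairing_self S) scale1r.
have [|e0 e0E] := @frobenius_idempotent L chi n _ (fun i => psi (b i)) (fun i => mat (x i)) e chiF
   (fun i j => mul_mx_comm S pt (x i) (x j)) _ ee.
  by apply: eq_bigr => i _; rewrite mul_mx_map.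
have [i [j eij]] : exists i j, e i j != 0.
  apply: contrapT => H; have := hom_row_neq0 S psis.
  have := hom_row_idem S psi psis; rewrite (pairing_self S) scale1r => <-.
  case/eqP; rewrite -[X in _ *m X]/e.
  suff -> : e = 0 by rewrite mulmx0.
  by apply/matrixP => i j; rewrite [RHS]mxE; apply/eqP/negPn/negP => eij; apply: H; exists i, j.
have e0ij : e0 i j != 0 by move: eij; rewrite e0E mxE fmorph_eq0.
pose phi0 c := (mat c *m e0) i j / e0 i j.
have phi0E c : chi (phi0 c) = psi c.
  apply: (mulIf eij); rewrite {1}e0E mxE -rmorphM /= divfK //.
  have := congr1 (fun X : 'M_n => X i j) (mul_mx_idem S c psis); rewrite !mxE => <-.
  rewrite rmorph_sum; apply: eq_bigr => k _; rewrite rmorphM /= !mxE.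
  by rewrite -[hom_idem _ _ _ _ _]/e e0E mxE.
have chi_inj := fmorph_inj chi.
have [|| phi phiE] := @rmorphism_of _ _ phi0.
- by move=> c d; apply: chi_inj; rewrite rmorphB !phi0E rmorphB.
- split; first by apply: chi_inj; rewrite phi0E !rmorph1.
  by move=> c d; apply: chi_inj; rewrite [RHS]rmorphM !phi0E rmorphM.
exists phi; split; last by move=> c; rewrite phiE phi0E.
by move=> a; apply: chi_inj; rewrite phiE phi0E psis.
Qed.

Lemma stable_idem_hom (eps : 'M[L]_n) : eps != 0 -> stable_idem eps ->
  exists phi : {rmorphism B -> L}, lies_over s pt phi /\
    hom_row b phi *m eps = hom_row b phi.
Proof.
move=> eps0 [eps2 epsC eps1].
have [|chi [chiF [v [v0 vU vs]]]] := @twisted_eigenvector L B n (fun c => mat c) eps Lsep eps0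
   (fun c d => mul_mx_comm S pt c d).
  by move=> c; rewrite epsC submxMl.
have vE : v *m map_mx chi eps = v.
  by have /submxP[D ->] := vU; rewrite -mulmxA -map_mxM eps2.
have [||psi [psis vpsi]] := @eigen_hom (chi \o pt) v v0.
- by rewrite mul_mx_map -{1}vE -mulmxA -map_mxM eps1.
- by move=> c; have [l e] := vs c; exists l; rewrite mul_mx_map.
have [phi [phis phiE]] := frobenius_descent chiF psis.
have [|rho vrho] := eigen_rowE S vpsi; first by rewrite rmorph1.
have rowE : hom_row b psi = map_mx chi (hom_row b phi).
  by apply/rowP => i; rewrite !mxE phiE.
exists phi; split=> //; apply: (map_mx_inj (f := chi)).
have rho0 : rho != 0 by apply: contraNneq v0 => r0; rewrite vrho r0 scale0r.
rewrite map_mxM -rowE; apply: (scalerI rho0).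
by rewrite scalemxAl -vrho.
Qed.

(** One point is peeled off at a time: [hom_row b phi] lies in the row space of [eps] and is killed
    by eps - e, so the rank drops. *)
Lemma stable_idem_split (eps : 'M[L]_n) : stable_idem eps ->
  exists r (phi : 'I_r -> {rmorphism B -> L}),
    (forall i, lies_over s pt (phi i)) /\
    \sum_i hom_idem b beta x pt (phi i) = eps.
Proof.
have [m] := ubnP (\rank eps); elim: m eps => // m IH eps; rewrite ltnS => reps epsS.
have [eps0|eps0] := eqVneq eps 0.
  exists 0%N, (fun i : 'I_0 => match notF (ltn_ord i) with end).
  by split; [case|rewrite big_ord0].
have [phi [phis phieps]] := stable_idem_hom eps0 epsS.
have [eps2 epsC eps1] := epsS.
pose e := hom_idem b beta x pt phi.
have ee : e *m e = e by rewrite (hom_idemM S) // (pairing_self S) scale1r.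
have eC c : comm_mx e (mat c).
  by apply: hom_idem_comm => d; exact: (mul_mx_comm S pt d c).
have eeps : e *m eps = e.
  apply/row_matrixP => i; rewrite row_mul.
  have [||rho ->] := @eigen_rowE _ _ _ _ _ _ _ S _ pt phi (row i e).
  - by move=> c; rewrite -row_mul (hom_idem_mul_mx S) // rowE -scalemxAr -rowE.
  - by rewrite rmorph1.
  by rewrite -scalemxAl phieps.
have epse : eps *m e = e.
  rewrite -{2}eeps; apply: comm_mx_sym; apply: hom_idem_comm => c.
  exact/comm_mx_sym/epsC.
have [||r [psi [psis psiE]]] := IH (eps - e).
- apply: leq_trans reps; apply: rank_ltmx; rewrite ltmxE; apply/andP; split.
    by rewrite -{1}eps2 -[X in (_ - X <= _)%MS]eeps -mulmxBl submxMl.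
  apply/negP => H; have /submxP[D rD] : (hom_row b phi <= eps - e)%MS.
    by apply: submx_trans H; rewrite -phieps submxMl.
  have : hom_row b phi *m (eps - e) = 0.
    by rewrite mulmxBr phieps (hom_row_idem S) // (pairing_self S) scale1r subrr.
  rewrite {1}rD -mulmxA mulmxBr !mulmxBl eps2 eeps epse ee subrr subr0 -rD.
  by apply/eqP/(hom_row_neq0 S phis).
- split.
  + by rewrite mulmxBr !mulmxBl eps2 eeps epse ee subrr subr0.
  + by move=> c; rewrite /comm_mx mulmxBl mulmxBr epsC eC.
  + by rewrite mulmxBl eps1 (hom_idem_mul_mx S) // rmorph1 scale1r.
exists r.+1, (fun i => oapp psi phi (unlift ord0 i)); split.
  by move=> i; case: (unlift ord0 i) => [j|] //=; exact: psis.
rewrite big_ord_recl unlift_none /= -[RHS](subrK e) addrC; congr (_ + _).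
by rewrite -psiE; apply: eq_bigr => i _; rewrite liftK.
Qed.

Lemma etale_split : exists r (phi : 'I_r -> {rmorphism B -> L}),
    (forall i, lies_over s pt (phi i)) /\
    \sum_i hom_idem b beta x pt (phi i) = mat 1.
Proof.
apply: stable_idem_split; split.
- by rewrite -(mul_mxM S) mulr1.
- by move=> c; exact: (mul_mx_comm S pt 1 c).
- by rewrite -(mul_mxM S) mulr1.
Qed.

End Splitting.

(** * Hensel lifting and splitting over power series *)

Section Lifting.
Variables (A B : comPzRingType) (s : {rmorphism A -> B}) (n : nat).
Variables (b : 'I_n -> B) (beta : 'I_n -> B -> A) (x : 'I_n -> B).
Hypothesis S : separability s b beta x.

Definition linear_over (E : comNzRingType) (chi : {rmorphism A -> E}) (Phi : B -> E) :=
  forall a y z, Phi (s a * y + z) = chi a * Phi y + Phi z.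

Lemma linear_overD (E : comNzRingType) (chi : {rmorphism A -> E}) Phi :
  linear_over chi Phi -> {morph Phi : y z / y + z}.
Proof. by move=> H y z; rewrite -[y]mul1r -(rmorph1 s) H !rmorph1 !mul1r. Qed.

Lemma linear_over0 (E : comNzRingType) (chi : {rmorphism A -> E}) Phi :
  linear_over chi Phi -> Phi 0 = 0.
Proof. by move=> H; apply: (addrI (Phi 0)); rewrite -(linear_overD H) !addr0. Qed.

Lemma linear_over_sum (E : comNzRingType) (chi : {rmorphism A -> E}) Phi
    (I : Type) (r : seq I) (F : I -> B) (c : I -> A) : linear_over chi Phi ->
  Phi (\sum_(i <- r) s (c i) * F i) = \sum_(i <- r) chi (c i) * Phi (F i).
Proof.
move=> H; elim/big_rec2: _ => [|i y z _ <-]; first exact: linear_over0 H.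
exact: H.
Qed.

(** The identity (1 (x) c) e = (c (x) 1) e again, now for maps that are only linear, since the
    approximations of Newton's method are not multiplicative. *)
Lemma sep_bilinear (E : comNzRingType) (chi : {rmorphism A -> E}) (Phi Psi : B -> E) c :
  linear_over chi Phi -> linear_over chi Psi ->
  \sum_i Phi (b i) * Psi (c * x i) = \sum_i Phi (c * b i) * Psi (x i).
Proof.
move=> PhiL PsiL; under eq_bigr => k _.
  rewrite -(sep_swap S) (linear_over_sum _ _ _ PsiL) mulr_sumr; over.
rewrite exchange_big /=; apply: eq_bigr => i _.
rewrite [in Phi _](sep_dual S (c * b i)) (linear_over_sum _ _ _ PhiL) mulr_suml.
by apply: eq_bigr => k _; rewrite mulrCA mulrA.
Qed.

Variables (L : fieldType) (ptR : {rmorphism A -> pseries L}) (pt : {rmorphism A -> L}).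
Hypothesis ptRE : forall a, ps_coef0 (ptR a) = pt a.
Local Notation R := (pseries L).

Section Newton.
Variable phi : {rmorphism B -> L}.
Hypothesis phis : lies_over s pt phi.

(** Averaging against the separability idempotent returns [Phi] when [Phi] is multiplicative;
    dividing by the value at 1 restores the unit. *)
Definition newton_T (Phi : B -> R) (c : B) : R := \sum_i Phi (b i) * Phi (x i * c).
Definition newton_next (Phi : B -> R) (c : B) : R := newton_T Phi c / newton_T Phi 1.

Definition approx_hom k (Phi : B -> R) : Prop :=
  [/\ linear_over ptR Phi, forall c, ps_coef0 (Phi c) = phi c
    & forall c d, ps_eqmod k.+1 (Phi (c * d) - Phi c * Phi d) 0].

(* Newton's method: the separability idempotent makes the multiplicativity
   defect a coboundary, so that it can be corrected. *)
Lemma newton_step k Phi : approx_hom k Phi ->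
  approx_hom k.+1 (newton_next Phi) /\
  forall c, ps_eqmod k.+1 (newton_next Phi c) (Phi c).
Proof.
case=> PhiL Phi0 PhiM; pose T := newton_T Phi; pose D c d := Phi (c * d) - Phi c * Phi d.
have TE c d : T (c * d) = Phi c * T d + \sum_i D c (b i) * Phi (x i * d).
  rewrite /T /newton_T.
  have := @sep_bilinear _ _ Phi (fun y => Phi (y * d)) c PhiL _.
  under eq_bigr => i _ do rewrite -mulrA mulrCA.
  move=> ->; last by move=> a y z; rewrite mulrDl -mulrA PhiL.
  rewrite mulr_sumr -big_split; apply: eq_bigr => i _ /=.
  by rewrite /D; ring.
have T0 c : ps_coef0 (T c) = phi c.
  rewrite rmorph_sum -[phi c]mul1r -(pairing_self S phi) mulr_suml.
  by apply: eq_bigr => i _; rewrite rmorphM /= !Phi0 rmorphM mulrA.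
have T1u : T 1 \is a GRing.unit by rewrite ps_unitE T0 rmorph1 oner_neq0.
have dif c : T c - Phi c * T 1 = \sum_i D c (b i) * Phi (x i).
  have := TE c 1; rewrite mulr1 => ->; rewrite addrC addKr.
  by apply: eq_bigr => i _; rewrite mulr1.
have difmod c : ps_eqmod k.+1 (T c - Phi c * T 1) 0.
  rewrite dif; apply: ps_eqmod_sum => i; rewrite mulrC; apply: ps_eqmod_mull.
  exact: PhiM.
split; last first.
  move=> c; apply/ps_eqmod0.
  have -> : newton_next Phi c - Phi c = (T 1)^-1 * (T c - Phi c * T 1).
    by rewrite /newton_next -/T mulrBr mulrC mulrCA mulVr ?mulr1.
  exact: ps_eqmod_mull.
split.
- move=> a y z; rewrite /newton_next -/T mulrA -mulrDl; congr (_ / _).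
  rewrite /T /newton_T mulr_sumr -big_split; apply: eq_bigr => i _ /=.
  by rewrite mulrDr mulrCA PhiL; ring.
- move=> c; rewrite /newton_next rmorphM /= rmorphV ?T1u //=.
  by rewrite -/T !T0 rmorph1 divr1.
move=> c d.
have -> : newton_next Phi (c * d) - newton_next Phi c * newton_next Phi d =
   (T 1)^-1 * (T 1)^-1 * (T 1 * T (c * d) - T c * T d).
  rewrite /newton_next -/T; set v := (T 1)^-1.
  transitivity (v * (v * T 1) * T (c * d) - T c * v * (T d * v)); last by ring.
  by rewrite mulVr // mulr1 [v * _]mulrC.
apply: ps_eqmod_mull.
(* The old defect [D] vanishes to order k+1, and the second factor has constant term phi(x_i d) -
   phi(d) phi(x_i) = 0; together they gain one order. *)
have -> : T 1 * T (c * d) - T c * T d =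
   \sum_i D c (b i) * (T 1 * Phi (x i * d) - T d * Phi (x i)).
  have -> : T c = Phi c * T 1 + \sum_i D c (b i) * Phi (x i) by rewrite -dif addrC subrK.
  rewrite TE.
  under [RHS]eq_bigr => i _ do rewrite mulrBr ![D _ _ * (_ * _)]mulrCA.
  by rewrite sumrB -!mulr_sumr; ring.
apply: ps_eqmod_sum => i; rewrite -addn1; apply: ps_eqmod_mul; first exact: PhiM.
apply/ps_eqmod1; rewrite rmorphB !rmorphM /= !T0 !Phi0 rmorph1 mul1r.
by rewrite rmorphM mulrC subrr rmorph0.
Qed.

(** The dual basis gives a linear lift of [phi] to start from. *)
Definition newton_seq (k : nat) : B -> R :=
  iter k newton_next (fun c => \sum_i ps_const (phi (b i)) * ptR (beta i c)).

Lemma newton_seq_approx k : approx_hom k (newton_seq k).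
Proof.
elim: k => [|k IH]; last by case: (newton_step IH).
have c0 c : ps_coef0 (newton_seq 0 c) = phi c.
  rewrite rmorph_sum (hom_expand S c phis); apply: eq_bigr => i _.
  by rewrite rmorphM /= ps_coef0_const ptRE mulrC.
split=> //.
- move=> a y z; rewrite /newton_seq /= mulr_sumr -big_split; apply: eq_bigr => i _ /=.
  by rewrite (sep_functional S i) rmorphD rmorphM; ring.
move=> c d; apply/ps_eqmod1; rewrite rmorphB rmorphM /= !c0.
by rewrite rmorphM subrr rmorph0.
Qed.

Lemma lift_hom : exists Phi : {rmorphism B -> R},
  lies_over s ptR Phi /\ forall c, ps_coef0 (Phi c) = phi c.
Proof.
have lims c k : ps_eqmod k.+1 (newton_seq k.+1 c) (newton_seq k c).
  by have [_] := newton_step (newton_seq_approx k); apply.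
pose Phi c := sval (ps_lim (lims c)).
have PhiE c k : ps_eqmod k.+1 (Phi c) (newton_seq k c) by rewrite /Phi; case: ps_lim.
have eqk u v : (forall k, ps_eqmod k.+1 u v) -> u = v.
  by move=> H; apply: ps_eqmod_eq => k; apply: ps_eqmodW (H k).
have PhiL : linear_over ptR Phi.
  move=> a y z; apply: eqk => k; apply: (ps_eqmod_trans (PhiE _ k)).
  have [-> _ _] := newton_seq_approx k.
  by apply: ps_eqmodD; [apply: ps_eqmodM => // |]; apply: ps_eqmod_sym.
have PhiM c d : Phi (c * d) = Phi c * Phi d.
  apply: eqk => k; apply: (ps_eqmod_trans (PhiE _ k)).
  have [_ _ H] := newton_seq_approx k.
  apply: (@ps_eqmod_trans _ _ (newton_seq k c * newton_seq k d)).
    by apply/ps_eqmod0; apply: H.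
  by apply: ps_eqmodM; apply: ps_eqmod_sym.
have Phi0 c : ps_coef0 (Phi c) = phi c.
  by have [_ <- _] := newton_seq_approx 0; apply/ps_eqmod1/PhiE.
have Phi1 : Phi 1 = 1.
  have n0 : Phi 1 != 0 by apply: ps_coef0_neq0; rewrite Phi0 rmorph1 oner_neq0.
  by apply: (mulfI n0); rewrite -PhiM !mulr1.
have [|| Psi PsiE] := @rmorphism_of _ _ Phi.
- move=> c d; rewrite -[c - d]addrC -[- d]mulN1r -(rmorph1 s) -rmorphN PhiL.
  by rewrite rmorphN rmorph1 mulN1r addrC.
- by split.
exists Psi; split=> [a|c]; rewrite PsiE //.
by rewrite -[s a]mulr1 -[s a * 1]addr0 PhiL Phi1 (linear_over0 PhiL) mulr1 addr0.
Qed.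

End Newton.

(** The pairing of the two lifts has the same constant term as the pairing of [Psi] with itself,
    namely 1, so it is nonzero and forces equality. *)
Lemma lift_hom_unique (Phi Psi : {rmorphism B -> R}) :
  lies_over s ptR Phi -> lies_over s ptR Psi ->
  (forall c, ps_coef0 (Phi c) = ps_coef0 (Psi c)) -> Phi =1 Psi.
Proof.
move=> PhiR PsiR e c.
have p0 : pairing b x Phi Psi != 0.
  apply: ps_coef0_neq0; rewrite rmorph_sum /=.
  under eq_bigr => i _ do rewrite rmorphM /= e.
  have := congr1 (@ps_coef0 L) (pairing_self S Psi); rewrite rmorph1 rmorph_sum => e1.
  under [X in X != _]eq_bigr => i _ do rewrite -rmorphM.
  by rewrite e1 oner_neq0.
apply: (mulIf p0); apply/esym; exact: (pairing_swap S c PhiR PsiR).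
Qed.

Hypothesis Lsep : separably_closed L.

Local Notation K := {fraction (pseries L)}.
Definition frac_ps : {rmorphism pseries L -> {fraction (pseries L)}} := @FracField.tofrac (pseries L).
Definition ptK : {rmorphism A -> K} := frac_ps \o ptR.

(** Over L the idempotents of the points add up to [mul_mx 1], so the difference vanishes at u = 0
    and 1 minus it has a unit determinant. This invertibility is enough for the sequel, so the
    difference itself is not shown to be zero. *)
Lemma etale_split_lift : exists r (Phi : 'I_r -> {rmorphism B -> R}),
  (forall i, lies_over s ptR (Phi i)) /\
  1%:M - (mul_mx b beta ptR 1 - \sum_i hom_idem b beta x ptR (Phi i)) \in unitmx.
Proof.
have [r [phi [phis e]]] := etale_split S pt Lsep.
have /choice[Phi PhiP] := fun i => lift_hom (phis i).
exists r, Phi; split=> [i|]; first by have [] := PhiP i.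
rewrite unitmxE ps_unitE -det_map_mx.
suff -> : map_mx (@ps_coef0 L) (1%:M - (mul_mx b beta ptR 1 - \sum_i hom_idem b beta x ptR (Phi i))) = 1%:M.
  by rewrite det1 oner_neq0.
have matE c : map_mx (@ps_coef0 L) (mul_mx b beta ptR c) = mul_mx b beta pt c.
  by apply/matrixP => i j; rewrite !mxE; apply: ptRE.
have sumE : map_mx (@ps_coef0 L) (\sum_i hom_idem b beta x ptR (Phi i)) =
    \sum_i hom_idem b beta x pt (phi i).
  rewrite raddf_sum; apply: eq_bigr => i _; rewrite raddf_sum; apply: eq_bigr => k _ /=.
  by rewrite map_mxZ matE; congr (_ *: _); apply: (PhiP i).2.
by rewrite map_mxB map_mx1 map_mxB matE sumE e subrr subr0.
Qed.

Lemma mul_mxK c : mul_mx b beta ptK c = map_mx frac_ps (mul_mx b beta ptR c).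
Proof. by apply/matrixP => i j; rewrite !mxE. Qed.

Lemma etale_split_frac : exists r (Phi : 'I_r -> {rmorphism B -> R}),
  (forall i, lies_over s ptR (Phi i)) /\
  1%:M - (mul_mx b beta ptK 1 - \sum_i hom_idem b beta x ptK (frac_ps \o Phi i)) \in unitmx.
Proof.
have [r [Phi [PhiR u]]] := etale_split_lift; exists r, Phi; split=> //.
have sumE : map_mx frac_ps (\sum_i hom_idem b beta x ptR (Phi i)) =
    \sum_i hom_idem b beta x ptK (frac_ps \o Phi i).
  rewrite raddf_sum; apply: eq_bigr => i _; rewrite raddf_sum; apply: eq_bigr => k _ /=.
  by rewrite map_mxZ -mul_mxK.
have : map_mx frac_ps (1%:M - (mul_mx b beta ptR 1 -
    \sum_i hom_idem b beta x ptR (Phi i))) \in unitmx.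
  by rewrite unitmxE det_map_mx rmorph_unit // -unitmxE.
by rewrite map_mxB map_mx1 map_mxB -mul_mxK sumE.
Qed.

(** If [psi] paired to zero with every lifted point, the row of [psi] would be killed by the
    invertible matrix of [etale_split_frac]; a nonzero pairing makes [psi] equal to a lift. *)
Lemma etale_hom_integral (psi : {rmorphism B -> K}) : lies_over s ptK psi ->
  exists Phi : {rmorphism B -> R}, lies_over s ptR Phi /\
    forall c, psi c = frac_ps (Phi c).
Proof.
move=> psiK; have [r [Phi [PhiR u]]] := etale_split_frac.
have PhiK i : lies_over s ptK (frac_ps \o Phi i) by move=> a; rewrite /= PhiR.
have [|npair] := pselect (exists i, pairing b x (frac_ps \o Phi i) psi != 0).
  case=> i p0; exists (Phi i); split=> // c; apply: (mulIf p0).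
  exact: (pairing_swap S c (PhiK i) psiK).
exfalso; have /eqP := hom_row_neq0 S psiK; apply.
suff e : hom_row b psi *m (1%:M - (mul_mx b beta ptK 1 -
    \sum_i hom_idem b beta x ptK (frac_ps \o Phi i))) = 0.
  by rewrite -[LHS](mulmxK u) e mul0mx.
rewrite !mulmxBr mulmx1 (hom_rowM S) // rmorph1 scale1r mulmx_sumr big1 ?subr0 ?subrr //.
move=> i _; rewrite (hom_row_idem S) //.
have [-> |p0] := eqVneq (pairing b x (frac_ps \o Phi i) psi) 0; first by rewrite scale0r.
by case: npair; exists i.
Qed.

End Lifting.

Lemma horner_mx_eigen (F : fieldType) m (M N : 'M[F]_m.+1) a (p : {poly F}) :
  M *m N = a *: N -> horner_mx M p *m N = p.[a] *: N.
Proof.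
move=> MN; elim/poly_ind: p => [|p c IH]; first by rewrite rmorph0 mul0mx horner0 scale0r.
rewrite rmorphD rmorphM /= horner_mx_X horner_mx_C hornerMXaddC mulmxDl -mulmxA MN.
by rewrite -scalemxAr IH scalerA mul_scalar_mx -scalerDl mulrC.
Qed.

Lemma mxminpoly_split (F : fieldType) m (M P : 'M[F]_m.+1) r
    (e : 'I_r -> 'M[F]_m.+1) (a : 'I_r -> F) :
  M *m P = M -> (forall i, M *m e i = a i *: e i) ->
  1%:M - (P - \sum_i e i) \in unitmx ->
  exists t : seq F, mxminpoly M %| \prod_(l <- t) ('X - l%:P).
Proof.
(* The additional root 0 makes [Q] a multiple of X, so that M P = M implies Q(M) P = Q(M). *)
move=> MP Me u; pose t := 0 :: [seq a i | i : 'I_r].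
exists t; apply/mxminpoly_minP; set Q := \prod_(l <- t) _.
have Qe i : horner_mx M Q *m e i = 0.
  rewrite (horner_mx_eigen _ (Me i)) (_ : Q.[_] = 0) ?scale0r //; apply/rootP.
  by rewrite root_prod_XsubC inE; apply/orP; right; exact: (codom_f a).
have QP : horner_mx M Q *m P = horner_mx M Q.
  have -> : Q = (\prod_(l <- behead t) ('X - l%:P)) * 'X.
    by rewrite /Q /t big_cons polyC0 subr0 mulrC.
  by rewrite rmorphM /= horner_mx_X -mulmxA MP.
suff e0 : horner_mx M Q *m (1%:M - (P - \sum_i e i)) = 0.
  by rewrite -[LHS](mulmxK u) e0 mul0mx.
by rewrite !mulmxBr mulmx1 QP mulmx_sumr big1 ?subr0 ?subrr.
Qed.

(** [p1] and [p2] will be the two projections of a partial isomorphism fixing the image of A. Both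
    send the multiplication matrix over [G] to the same matrix over L((u)), which has Phi(c) as an
    eigenvalue and a split minimal polynomial. *)
Lemma etale_minpoly (A B : comPzRingType) (s : {rmorphism A -> B}) n
    (b : 'I_n -> B) (beta : 'I_n -> B -> A) (x : 'I_n -> B) (L : fieldType)
    (ptR : {rmorphism A -> pseries L}) (pt : {rmorphism A -> L}) (G : fieldType)
    (g : {rmorphism A -> G}) (p1 p2 : {rmorphism G -> {fraction (pseries L)}})
    (Phi : {rmorphism B -> pseries L}) c :
  separability s b beta x -> separably_closed L ->
  (forall a, ps_coef0 (ptR a) = pt a) ->
  (forall a, p1 (g a) = (ptK ptR) a) -> (forall a, p2 (g a) = (ptK ptR) a) ->
  lies_over s ptR Phi ->
  exists p : {poly G}, [/\ p != 0, root (map_poly p1 p) (frac_ps L (Phi c)) &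
    exists t : seq {fraction (pseries L)}, map_poly p2 p %| \prod_(l <- t) ('X - l%:P)].
Proof.
move=> S Lsep ptRE p1E p2E PhiR.
have : lies_over s (ptK ptR) (frac_ps L \o Phi) by move=> a; rewrite /= PhiR.
case: n b beta x S => [|m] b beta x S.
  move=> PhiK; have := hom_row_neq0 S PhiK; case/eqP; apply/rowP; by case.
move=> PhiK.
have mapE (p : {rmorphism G -> {fraction (pseries L)}}) : (forall a, p (g a) = (ptK ptR) a) ->
    map_mx p (mul_mx b beta g c) = mul_mx b beta (ptK ptR) c.
  by move=> pE; apply/matrixP => i j; rewrite !mxE pE.
exists (mxminpoly (mul_mx b beta g c)); split.
- exact/monic_neq0/mxminpoly_monic.
- rewrite -mxminpoly_map mapE // -eigenvalue_root_min; apply/eigenvalueP.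
  exists (hom_row b (frac_ps L \o Phi)); last exact: (hom_row_neq0 S PhiK).
  exact: (hom_rowM S c PhiK).
rewrite -mxminpoly_map mapE //; set M := mul_mx b beta (ptK ptR) c.
have [r [Psi [PsiR u]]] := etale_split_frac S ptRE Lsep.
apply: (@mxminpoly_split _ _ M (mul_mx b beta (ptK ptR) 1) r
  (fun i => hom_idem b beta x (ptK ptR) (frac_ps L \o Psi i))
  (fun i => frac_ps L (Psi i c))) => //.
- by rewrite -(mul_mxM S) mulr1.
- by move=> i; apply: (mul_mx_idem S) => a; rewrite /= PsiR.
Qed.

Section SeparablyClosedSqrt.
Variable L : fieldType.
Hypotheses (Lsep : separably_closed L) (two : 2%:R != 0 :> L).

Lemma sep_closed_sqrt (z : L) : exists r, r ^+ 2 = z.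
Proof.
have [->|z0] := eqVneq z 0; first by exists 0; rewrite expr0n.
have [||r] := Lsep (p := 'X^2 - z%:P).
- rewrite unlock derivB derivXn derivC subr0 /=.
  apply/Bezout_eq1_coprimepP; exists (- (z^-1)%:P, (z^-1)%:P * 2%:R^-1%:P * 'X) => /=.
  have e1 : (z^-1)%:P * z%:P = 1 :> {poly L} by rewrite -polyCM mulVf.
  have e2 : 2%:R^-1%:P * 2%:R = 1 :> {poly L} by rewrite -polyC_natr -polyCM mulVf.
  transitivity ((z^-1)%:P * z%:P + (z^-1)%:P * 'X^2 * (2%:R^-1%:P * 2%:R - 1)).
    by ring.
  by rewrite e1 e2 subrr mulr0 addr0.
- by rewrite size_XnsubC.
- by rewrite rootE !hornerE subr_eq0 => /eqP; exists r.
Qed.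

End SeparablyClosedSqrt.

Lemma frac_ps_div (L : fieldType) (z : {fraction (pseries L)}) :
  exists N M, M != 0 /\ z = frac_ps L N / frac_ps L M.
Proof.
elim/quotW: z => r; exists (frac r).1, (frac r).2.
have r2 := denom_ratioP r; split=> //.
apply: (canRL (mulfK _)); first by rewrite tofrac_eq0.
rewrite /frac_ps /= !piE; apply/eqmodP => /=.
rewrite FracField.equivfE /FracField.mulf !numden_Ratio ?mulf_neq0 ?oner_neq0 //.
by rewrite !mulr1 mulrC.
Qed.

(** * Partial isomorphisms inducing tree automorphisms *)

(** Over any ring, since the same quadratic is iterated on L, on L[[u]] and on L((u)). *)
Definition quad (E : pzRingType) (a c d y : E) : E := a * (y - c) ^+ 2 + d.

Lemma quad_morph (E E' : pzRingType) (h : {rmorphism E -> E'}) a c d y :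
  h (quad a c d y) = quad (h a) (h c) (h d) (h y).
Proof. by rewrite rmorphD rmorphM rmorphXn rmorphB. Qed.

Definition quad_poly (E : comNzRingType) (a c d z : E) : {poly E} :=
  a%:P * ('X - c%:P) ^+ 2 + d%:P - z%:P.

Lemma map_quad_poly (E E' : comNzRingType) (h : {rmorphism E -> E'}) a c d z :
  map_poly h (quad_poly a c d z) = quad_poly (h a) (h c) (h d) (h z).
Proof.
by rewrite rmorphB rmorphD rmorphM rmorphXn rmorphB /= map_polyX !map_polyC.
Qed.

Lemma horner_quad_poly (E : comNzRingType) (a c d z y : E) :
  (quad_poly a c d z).[y] = quad a c d y - z.
Proof. by rewrite /quad_poly hornerD hornerN hornerD hornerM horner_exp hornerXsubC !hornerC. Qed.

Lemma root_quad_poly (E : comNzRingType) (a c d y : E) :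
  root (quad_poly a c d (quad a c d y)) y.
Proof. by rewrite rootE horner_quad_poly subrr. Qed.

(** Siblings in the tree are exchanged by the reflection y -> 2c - y. *)
Lemma quad_poly_factor (E : comNzRingType) (a c d y : E) :
  quad_poly a c d (quad a c d y) = a%:P * (('X - y%:P) * ('X - (c + c - y)%:P)).
Proof.
rewrite /quad_poly /quad !rmorphB !rmorphD rmorphM rmorphXn rmorphB /=.
by ring.
Qed.

Lemma quad_poly_split (E : fieldType) (a c d y : E) : a != 0 ->
  quad_poly a c d (quad a c d y) %| \prod_(l <- [:: y; c + c - y]) ('X - l%:P).
Proof.
by move=> a0; rewrite quad_poly_factor !big_cons big_nil mulr1 mul_polyC dvdpZl.
Qed.

Lemma size_quad_poly (E : fieldType) (a c d z : E) :
  a != 0 -> size (quad_poly a c d z) = 3%N.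
Proof.
move=> a0; rewrite /quad_poly -addrA -polyCB size_polyDl mul_polyC size_scale //.
  by rewrite size_exp_XsubC.
by rewrite size_exp_XsubC (leq_ltn_trans (size_polyC_leq1 _)).
Qed.

Lemma quad_eq (E : idomainType) (a c d y y' : E) : a != 0 ->
  quad a c d y = quad a c d y' -> y = y' \/ y = c + c - y'.
Proof.
move=> a0 /eqP; rewrite -subr_eq0.
have -> : quad a c d y - quad a c d y' = a * ((y - y') * (y + y' - (c + c))).
  by rewrite /quad; ring.
rewrite !mulf_eq0 (negPf a0) /= => /orP[|]; rewrite subr_eq0 => /eqP; first by left.
by move=> e; right; rewrite -e addrK.
Qed.

Lemma quad_sibling (E : comNzRingType) (a c d y : E) :
  quad a c d (c + c - y) = quad a c d y.
Proof. by rewrite /quad; ring. Qed.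

Lemma frac_ps_eq0 (L : fieldType) (y : pseries L) : (frac_ps L y == 0) = (y == 0).
Proof. exact: tofrac_eq0. Qed.

Section Tree.
Variable L : fieldType.
Hypotheses (Lsep : separably_closed L) (two : 2%:R != 0 :> L).
Variables (a c d x : L).
Hypothesis a0 : a != 0.
Local Notation R := (pseries L).
Local Notation K := {fraction (pseries L)}.
Local Notation cR := (@ps_const L).
Local Notation "y %:K" := (frac_ps L y) (at level 2, format "y %:K").
Local Notation cK z := (frac_ps L (ps_const z)).

Local Notation q := (quad a c d).
Definition quadR : R -> R := quad (cR a) (cR c) (cR d).
Definition quadK : K -> K := quad (cK a) (cK c) (cK d).

Lemma quadR_coef0 y : ps_coef0 (quadR y) = q (ps_coef0 y).
Proof. by rewrite /quadR quad_morph. Qed.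
Lemma quadK_frac y : quadK y%:K = (quadR y)%:K.
Proof. by rewrite /quadR quad_morph. Qed.
Lemma iter_quadR_coef0 n y : ps_coef0 (iter n quadR y) = iter n q (ps_coef0 y).
Proof. by elim: n => //= n <-; rewrite quadR_coef0. Qed.
Lemma iter_quadK_frac n y : iter n quadK y%:K = (iter n quadR y)%:K.
Proof. by elim: n => //= n ->; rewrite quadK_frac. Qed.
Lemma quadR_const z : quadR (cR z) = cR (q z).
Proof. by rewrite quad_morph. Qed.
Lemma iter_quadR_const n z : iter n quadR (cR z) = cR (iter n q z).
Proof. by elim: n => //= n ->; rewrite quadR_const. Qed.

Lemma quadR_lift z y : q y = ps_coef0 z -> y != c ->
  exists2 Y, quadR Y = z & ps_coef0 Y = y.
Proof.
move=> qy yc; have [||s [s2 s0]] := @ps_sqrt L (cR a^-1 * (z - cR d)) (y - c) two.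
- by rewrite subr_eq0.
- rewrite rmorphM rmorphB /= !ps_coef0_const -qy /quad addrK mulKf //.
exists (s + cR c); last by rewrite rmorphD /= s0 ps_coef0_const subrK.
rewrite /quadR /quad addrK s2 mulrA -rmorphM mulfV // rmorph1 mul1r subrK //.
Qed.

Lemma quadR_inj Y Y' : quadR Y = quadR Y' -> ps_coef0 Y = ps_coef0 Y' ->
  ps_coef0 Y != c -> Y = Y'.
Proof.
have ca0 : cR a != 0 by rewrite fmorph_eq0.
move=> /(quad_eq ca0)[//|e] e0 /negP[].
have := congr1 (@ps_coef0 L) e; rewrite rmorphB rmorphD /= !ps_coef0_const -e0 => e1.
suff : 2%:R * (ps_coef0 Y - c) == 0 by rewrite mulf_eq0 (negPf two) subr_eq0.
have -> : 2%:R * (ps_coef0 Y - c) = ps_coef0 Y - (c + c - ps_coef0 Y) by ring.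
by rewrite -e1 subrr.
Qed.

Lemma iter_quadR_inj n Y Y' : iter n quadR Y = iter n quadR Y' ->
  ps_coef0 Y = ps_coef0 Y' -> (forall i, (i < n)%N -> iter i q (ps_coef0 Y) != c) ->
  Y = Y'.
Proof.
elim: n Y Y' => // n IH Y Y'; rewrite !iterSr => e e0 H.
apply: quadR_inj => //; last exact: (H 0%N).
apply: IH => // [|i ilt]; first by rewrite !quadR_coef0 e0.
by rewrite quadR_coef0 -iterSr; apply: H.
Qed.

Hypothesis x_avoids : forall m, iter m q d != x.

Lemma q_crit : q c = d. Proof. by rewrite /quad subrr expr0n mulr0 add0r. Qed.

Lemma level_noncrit n y i : iter n q y = x -> (i < n)%N -> iter i q y != c.
Proof.
move=> yx ilt; apply/eqP => yc; case/negP: (x_avoids (n - i.+1)).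
by rewrite -yx -{2}(subnK ilt) iterD iterS yc q_crit.
Qed.

Definition ps_base : R := cR x + ps_var L.

Definition lifts n (y : L) (Y : R) := iter n quadR Y = ps_base /\ ps_coef0 Y = y.

Lemma ps_coef0_base : ps_coef0 ps_base = x.
Proof. by rewrite rmorphD /= ps_coef0_var addr0. Qed.

Lemma lifts_level n y Y : lifts n y Y -> iter n q y = x.
Proof. by case=> e <-; rewrite -iter_quadR_coef0 e ps_coef0_base. Qed.

Lemma lifts_ex n y : iter n q y = x -> exists Y, lifts n y Y.
Proof.
elim: n y => [|n IH] y yx; first by exists ps_base; split; rewrite ?ps_coef0_base.
have [|Z [Zx Z0]] := IH (q y); first by rewrite -iterSr.
have [||Y YZ Y0] := @quadR_lift Z y; first by rewrite Z0.
  exact: (@level_noncrit _ _ 0 yx).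
by exists Y; split=> //; rewrite iterSr YZ.
Qed.

Lemma lifts_unique n y Y Y' : lifts n y Y -> lifts n y Y' -> Y = Y'.
Proof.
move=> YL [e' e0']; have yx := lifts_level YL; have [e e0] := YL.
apply: (@iter_quadR_inj n); rewrite ?e ?e' ?e0 ?e0' // => i.
exact: level_noncrit yx.
Qed.

Lemma lifts_parent n y Y : lifts n.+1 y Y -> lifts n (q y) (quadR Y).
Proof. by case=> e e0; split; rewrite -?iterSr // quadR_coef0 e0. Qed.

Lemma nonconst_base : ps_base != cR (ps_coef0 ps_base).
Proof.
apply/eqP => /(congr1 (fun f : R => f 1%N)); rewrite ps_coef0_base /ps_base ps_addE /= add0r.
by move/eqP; rewrite oner_eq0.
Qed.

Lemma nonconst_lifts n y Y : lifts n y Y -> Y != cR (ps_coef0 Y).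
Proof.
move=> [e _]; apply: contra nonconst_base => /eqP eY.
by rewrite -e eY iter_quadR_const ps_coef0_const.
Qed.

Lemma nonconst_transcendental Y : Y != cR (ps_coef0 Y) ->
  transcendental (frac_ps L \o cR) Y%:K.
Proof.
move=> Yn P P0; rewrite map_poly_comp horner_map frac_ps_eq0.
exact: ps_transcendental.
Qed.

Section Graph.
Variable H : set (K * K).
Hypothesis HH : maximal_iso H.
Hypothesis Hconst : forall z, H (cK z, cK z).

Let Hc := HH.1.1.

Lemma iso_quad Y Z : H (Y, Z) -> H (quadK Y, quadK Z).
Proof.
case: Hc => H1 HB HM _ HYZ.
have e : (quadK Y, quadK Z) = (cK a, cK a) * ((Y, Z) - (cK c, cK c)) ^+ 2 + (cK d, cK d) :> K * K.
  by [].
rewrite e; apply: field_closedD => //; apply: (HM) => //.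
by rewrite expr2; apply: (HM); apply: (HB).
Qed.

(** If the constant term of [eta] is not the critical value, the preimages of [eta] exist in L[[u]],
    so the transported quadratic splits and maximality puts [Y] into the domain. *)
Lemma iso_quad_root Y (eta : R) : H (quadK Y, eta%:K) -> ps_coef0 eta != d ->
  exists2 Z : R, H (Y, Z%:K) & quadR Z = eta.
Proof.
move=> HY etad.
have [r rE] := sep_closed_sqrt Lsep two (a^-1 * (ps_coef0 eta - d)).
have r0 : r != 0.
  apply: contraNneq etad => r0; move/eqP: rE; rewrite r0 expr0n /= eq_sym.
  by rewrite mulf_eq0 invr_eq0 (negPf a0) subr_eq0.
have [||Y1 qY1 Y10] := @quadR_lift eta (r + c).
- by rewrite /quad addrK rE mulVKf // subrK.
- by rewrite -subr_eq0 addrK.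
pose g (u v : K) (Huv : H (u, v)) : iso_field HH.1 := IsoField (GG := HH.1) (asboolT Huv).
have caK0 : cK a != 0 by rewrite frac_ps_eq0 fmorph_eq0.
pose p := quad_poly (g _ _ (Hconst a)) (g _ _ (Hconst c)) (g _ _ (Hconst d)) (g _ _ HY).
have p1 : map_poly (@iso_fst _ _ _ HH.1) p = quad_poly (cK a) (cK c) (cK d) (quadK Y).
  exact: map_quad_poly.
have p2 : map_poly (@iso_snd _ _ _ HH.1) p = quad_poly (cK a) (cK c) (cK d) (quadK Y1%:K).
  by rewrite quadK_frac qY1; exact: map_quad_poly.
have p0 : p != 0.
  rewrite -(map_poly_eq0 (@iso_snd _ _ _ HH.1)) p2 -size_poly_eq0.
  by rewrite size_quad_poly.
have [||b Hb] := @maximal_iso_root _ _ H HH HH.1 Y p [:: Y1%:K; cK c + cK c - Y1%:K] p0.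
- by rewrite p1 rootE horner_quad_poly subrr.
- by rewrite p2; apply: quad_poly_split.
have : quadK b = quadK Y1%:K.
  by rewrite quadK_frac qY1; apply: partial_iso_functional HH.1 (iso_quad Hb) HY.
case/(quad_eq caK0) => eb; first by exists Y1; rewrite -?eb.
exists (cR c + cR c - Y1); last by rewrite /quadR quad_sibling.
by rewrite rmorphB rmorphD -eb.
Qed.
End Graph.

Hypothesis orbit_inj : forall i j, (i < j)%N -> iter i q d != iter j q d.

Lemma orbit_noncrit i : iter i q d != c.
Proof.
by apply/eqP => e; have := orbit_inj (ltn0Sn i); rewrite iterS e q_crit eqxx.
Qed.

(* The isomorphism sends the preimage p of x to d + u (u the variable), where the
   covering by the children of p ramifies; the other preimages of x up to the
   level of p are sent to series whose constant term is not d. *)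
Lemma child_independent n p P u U : lifts n p P -> lifts n.+1 u U -> q u = p ->
  exists H : set (K * K), [/\ field_closed H, forall z, H (cK z, cK z),
    forall m y Y, lifts m y Y -> (m <= n)%N || (m == n.+1) && (q y != p) ->
      exists b, H (Y%:K, b)
    & ~ exists b, H (U%:K, b)].
Proof.
move=> pP uU qu; pose beta : R := cR d + ps_var L.
have beta0 : ps_coef0 beta = d by rewrite rmorphD /= ps_coef0_var addr0.
have betan : beta != cR (ps_coef0 beta).
  apply/eqP => /(congr1 (fun f : R => f 1%N)); rewrite beta0 /beta ps_addE /= add0r.
  by move/eqP; rewrite oner_eq0.
have [H HH H0H] := maximal_iso_ex (rational_graph_iso
  (nonconst_transcendental (nonconst_lifts pP)) (nonconst_transcendental betan)).
have Hpb : H (P%:K, beta%:K) by apply/H0H/rational_graph_gen.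
have Hconst z : H (cK z, cK z).
  exact/H0H/(@rational_graph_const _ _ _ (frac_ps L \o cR) (frac_ps L \o cR)).
have Hc := HH.1.1.
(* The image of t under [H]. *)
pose tt := iter n quadR beta.
have tt0 : ps_coef0 tt = iter n q d by rewrite iter_quadR_coef0 beta0.
have low m y Y : (m <= n)%N -> lifts m y Y ->
    exists2 eta : R, H (Y%:K, eta%:K) & iter m quadR eta = tt.
  elim: m y Y => [|m IH] y Y mn yY.
    exists tt => //; have [/= -> _] := yY; have [<- _] := pP.
    rewrite /tt -!iter_quadK_frac; elim: (n) => [//|k IHk] /=.
    exact: iso_quad.
  have [|eta He etat] := IH _ _ _ (lifts_parent yY); first exact: ltnW.
  have [||Z HZ ZE] := @iso_quad_root H HH Hconst Y%:K eta.
  - by rewrite quadK_frac.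
  (* An image at level m < n with constant term d would give f^m(d) = f^n(d). *)
  - apply/eqP => ed; have := orbit_inj mn.
    by rewrite -tt0 -etat iter_quadR_coef0 ed eqxx.
  by exists Z => //; rewrite iterSr ZE.
exists H; split=> //.
  move=> m y Y yY /orP[mn|/andP[/eqP mE qy]].
    by have [eta He _] := low _ _ _ mn yY; exists eta%:K.
  rewrite {m}mE in yY; have yY' := lifts_parent yY.
  have [eta He etat] := low _ _ _ (leqnn n) yY'.
  have [||Z HZ ZE] := @iso_quad_root H HH Hconst Y%:K eta.
  - by rewrite quadK_frac.
  (* Otherwise [eta] and [beta] are preimages of [tt] under f^n with the same constant term d, whose
     orbit avoids c, so they coincide; injectivity of [H] then makes the parent of y equal to p. *)
  - apply: contraNneq qy => ed.
    have eb : eta = beta.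
      apply: (@iter_quadR_inj n); rewrite ?ed ?beta0 // => i _.
      exact: orbit_noncrit.
    rewrite eb in He; have /eqP := partial_iso_injective HH.1 He Hpb.
    rewrite tofrac_eq => /eqP eP.
    by case: yY' => _ <-; rewrite eP; case: pP => _ ->.
  by exists Z%:K.
case=> b Hb; have := iso_quad HH Hconst Hb.
rewrite quadK_frac => Hqb.
have eP : quadR U = P.
  by apply: lifts_unique pP; rewrite -qu; apply: lifts_parent.
rewrite eP in Hqb; have := partial_iso_functional HH.1 Hqb Hpb.
(* An image [b] of the child would satisfy a (b - c)^2 = u; with b - c = N / M and a = r^2 this
   reads (r N)^2 = u M^2. *)
have [N [M [M0 bE]]] := frac_ps_div (b - cK c).
rewrite /quadK /quad bE /beta rmorphD addrC => /addrI.
have [r ra] := sep_closed_sqrt Lsep two a.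
rewrite exprMn exprVn mulrA => /(canRL (mulfVK _)) => e.
have MK : M%:K ^+ 2 != 0 by rewrite expf_neq0 // frac_ps_eq0.
have := e MK; rewrite -ra -!rmorphXn -!rmorphM => /eqP.
rewrite tofrac_eq => /eqP eN.
apply: (@ps_var_nsquare L (cR r * N) M) => //.
by rewrite exprMn -rmorphXn.
Qed.

Lemma zero_compatible_sub (G G' : set (K * K)) :
  (G `<=` G')%classic -> zero_compatible G' -> zero_compatible G.
Proof. by move=> GG' H z /GG'; apply: H. Qed.

Section TreeAutomorphism.
Variable w : nat -> L -> L.
Hypothesis w_root : w 0 x = x.
Hypothesis w_level : forall n y, iter n q y = x -> iter n q (w n y) = x.
Hypothesis w_parent : forall n y, iter n.+1 q y = x -> q (w n.+1 y) = w n (q y).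
Hypothesis w_inj : forall n y y', iter n q y = x -> iter n q y' = x ->
  w n y = w n y' -> y = y'.

(** [Q] lists the vertices of level [n] whose children have been adjoined, so that the induction
    handles one quadratic extension at a time. *)
Definition tree_gens n (Q : seq L) : set (K * K) :=
  [set z | (exists t, z = (cK t, cK t)) \/
    exists m y Y Y', [/\ lifts m y Y, lifts m (w m y) Y',
      (m <= n)%N || (m == n.+1) && (q y \in Q) & z = (Y%:K, Y'%:K)]]%classic.

Lemma tree_gens_sub n Q n' Q' :
  (forall m y, iter m q y = x -> (m <= n)%N || (m == n.+1) && (q y \in Q) ->
    (m <= n')%N || (m == n'.+1) && (q y \in Q')) ->
  (tree_gens n Q `<=` tree_gens n' Q')%classic.
Proof.
move=> H z [zc|[m [y [Y [Y' [yY wY mQ ->]]]]]]; first by left.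
right; exists m, y, Y, Y'; split=> //; apply: H => //; exact: lifts_level yY.
Qed.

Lemma field_gen_mono (S S' : set (K * K)) :
  (S `<=` S')%classic -> (field_gen S `<=` field_gen S')%classic.
Proof.
move=> SS'; apply: field_gen_min; first exact: field_gen_closed.
by move=> z /SS'; apply: field_gen_sub.
Qed.

Lemma tree_gens0 : zero_compatible (field_gen (tree_gens 0 [::])).
Proof.
have bT := nonconst_transcendental nonconst_base.
have GG := rational_graph_iso bT bT.
apply: zero_compatible_sub GG.2; apply: field_gen_min GG.1 _.
move=> z [[t ->]|[m [y [Y [Y' [yY wY + ->]]]]]].
  exact: (@rational_graph_const _ _ _ (frac_ps L \o cR) (frac_ps L \o cR)).
rewrite in_nil andbF orbF leqn0 => /eqP m0; rewrite {m}m0 in yY wY.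
have := lifts_level yY => /= yx; rewrite yx w_root in yY wY.
case: yY => /= -> _; case: wY => /= -> _; exact: rational_graph_gen.
Qed.

(** One child [u] of [p] is adjoined by [partial_iso_extend_quadratic]; its sibling comes for free
    by reflection. *)
Lemma tree_gens_cons n p Q : zero_compatible (field_gen (tree_gens n Q)) ->
  zero_compatible (field_gen (tree_gens n (p :: Q))).
Proof.
move=> good.
have [pQ|npQ] := boolP (p \in Q).
  apply: zero_compatible_sub good; apply: field_gen_mono; apply: tree_gens_sub => m y _.
  by rewrite inE; case: (eqVneq (q y) p) => [->|//]; rewrite pQ.
have [[u [ux qu]]|nou] := pselect (exists u, iter n.+1 q u = x /\ q u = p); last first.
  apply: zero_compatible_sub good; apply: field_gen_mono; apply: tree_gens_sub => m y yx.
  rewrite inE; case: (eqVneq (q y) p) => [qy|//]; rewrite andbT => /orP[->//|/eqP mE].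
  by case: nou; exists y; rewrite -mE.
have [U uU] := lifts_ex ux; have [V wV] := lifts_ex (w_level ux).
set G := field_gen (tree_gens n Q) in good.
have GG : partial_iso G by split=> //; exact: field_gen_closed.
have pU := lifts_parent uU; have pV := lifts_parent wV.
rewrite qu in pU; rewrite (w_parent ux) qu in pV.
have [H [Hc Hconst Hdom Hno]] := child_independent pU uU qu.
(* The domain of [H] is a field that contains the first coordinates of all generators, so it
   contains the domain of [G]. *)
have Gdom z : G z -> exists b, H (z.1, b).
  have Dc : field_closed [set z : K * K | exists b, H (z.1, b)]%classic.
    case: (Hc) => H1 HB HM HV; split.
    - by exists 1.
    - by move=> [y1 y2] [z1 z2] /= [b1 /HB h] [b2 /h]; exists (b1 - b2).
    - by move=> [y1 y2] [z1 z2] /= [b1 /HM h] [b2 /h]; exists (b1 * b2).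
    - by move=> [y1 y2] /= [b1 /HV h]; exists b1^-1.
  apply: (field_gen_min Dc) => {}z [[t ->]|[m [y [Y [Y' [yY wY mQ ->]]]]]] /=.
    by exists (cK t); apply: Hconst.
  apply: (Hdom _ _ _ yY); case/orP: mQ => [->//|/andP[-> qyQ]].
  by apply/orP; right; apply: contraNneq npQ => <-.
have Gconst t : G (cK t, cK t) by apply: field_gen_sub; left; exists t.
have Gp : G ((quadR U)%:K, (quadR V)%:K).
  by apply: field_gen_sub; right; exists n, p, (quadR U), (quadR V); rewrite leqnn.
pose g (u v : K) (Huv : G (u, v)) : iso_field GG := IsoField (GG := GG) (asboolT Huv).
have caK0 : cK a != 0 by rewrite frac_ps_eq0 fmorph_eq0.
pose f := quad_poly (g _ _ (Gconst a)) (g _ _ (Gconst c)) (g _ _ (Gconst d)) (g _ _ Gp).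
have f1 : map_poly (@iso_fst _ _ _ GG) f = quad_poly (cK a) (cK c) (cK d) (quadK U%:K).
  by rewrite quadK_frac; exact: map_quad_poly.
have f2 : map_poly (@iso_snd _ _ _ GG) f = quad_poly (cK a) (cK c) (cK d) (quadK V%:K).
  by rewrite quadK_frac; exact: map_quad_poly.
have f3 : size f = 3%N.
  by rewrite -(size_map_poly (@iso_fst _ _ _ GG)) f1 size_quad_poly.
have fU : root (map_poly (@iso_fst _ _ _ GG) f) U%:K.
  by rewrite f1; exact: root_quad_poly.
have fV : root (map_poly (@iso_snd _ _ _ GG) f) V%:K.
  by rewrite f2; exact: root_quad_poly.
(* A root in the domain of [G] would be [U] or its reflection; either would put [U] into the domain
   of [H]. *)
have fnr z : ~~ root f z.
  apply/negP => fz; have := rmorph_root (@iso_fst _ _ _ GG) fz.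
  rewrite f1 rootE horner_quad_poly subr_eq0 => /eqP /esym/(quad_eq caK0) UE.
  have [b Hb] : exists b, H (iso_fst z, b) := Gdom _ (iso_fieldP z).
  case: UE => UE; case: Hno; first by exists b; rewrite UE.
  exists (cK c + cK c - b); rewrite UE.
  have e : ((cK c + cK c - iso_fst z, cK c + cK c - b) : K * K) =
     (cK c, cK c) + (cK c, cK c) - (iso_fst z, b) by [].
  rewrite e; case: (Hc) => _ HB _ _; apply: (HB) => //; exact: field_closedD.
have [G' [pG' GG' GUV]] := partial_iso_extend_quadratic f3 fnr fU fV.
apply: zero_compatible_sub pG'.2; apply: field_gen_min pG'.1 _.
move=> _ [[t ->]|[m [y [Y [Y' [yY wY mQ ->]]]]]]; first exact: (GG' _ (Gconst t)).
have [ylow|] := boolP ((m <= n)%N || (m == n.+1) && (q y \in Q)).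
  by apply: (GG'); apply: field_gen_sub; right; exists m, y, Y, Y'.
move=> nlow; move: mQ nlow; rewrite inE; case: (eqVneq (q y) p) => [qy|_ -> //].
rewrite andbT; case: (leqP m n) => //= _ /eqP mE _; rewrite {m}mE in yY wY.
have [yu|yu] := eqVneq y u.
  rewrite yu in yY wY.
  by rewrite (lifts_unique yY uU) (lifts_unique wY wV).
have yx := lifts_level yY.
have caR0 : cR a != 0 by rewrite fmorph_eq0.
have : quadR Y = quadR U.
  by apply: lifts_unique pU; rewrite -qy; apply: lifts_parent.
case/(quad_eq caR0) => YE.
  by case/eqP: yu; case: yY => _ <-; case: uU => _ <-; rewrite YE.
(* As [w] is injective, the other child goes to the other child, so both coordinates are
   reflected. *)
have : quadR Y' = quadR V.
  by apply: lifts_unique pV; rewrite -qy -w_parent //; apply: lifts_parent.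
case/(quad_eq caR0) => YE'.
  case/eqP: yu; apply: (w_inj yx ux).
  by case: wY => _ <-; case: wV => _ <-; rewrite YE'.
have e : (Y%:K, Y'%:K) = (cK c, cK c) + (cK c, cK c) - (U%:K, V%:K) :> K * K.
  by congr pair; rewrite ?YE ?YE' rmorphB rmorphD.
rewrite e; case: (pG'.1) => _ HB _ _; apply: (HB) => //.
by apply: field_closedD pG'.1 _ _; exact: (GG' _ (Gconst c)).
Qed.

(** The next level is the directed union over the finite lists [Q], so the vertices of level [n]
    need not be enumerated. *)
Lemma tree_gens_zero_compatible n : zero_compatible (field_gen (tree_gens n [::])).
Proof.
elim: n => [|n IH]; first exact: tree_gens0.
have good Q : zero_compatible (field_gen (tree_gens n Q)).
  by elim: Q => [|p Q]; [exact: IH|exact: tree_gens_cons].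
pose F := [set G | exists Q, G = field_gen (tree_gens n Q)]%classic.
apply: (@zero_compatible_sub _ (\bigcup_(G in F) G)%classic); last first.
  by apply: zero_compatible_bigcup => _ [Q ->].
apply: field_gen_min.
  apply: field_closed_bigcup.
  - by exists (field_gen (tree_gens n [::])); exists [::].
  - move=> _ _ [Q ->] [Q' ->]; exists (field_gen (tree_gens n (Q ++ Q'))).
    split; first by exists (Q ++ Q').
      apply: field_gen_mono; apply: tree_gens_sub => m y _.
      by case: leqP => //= _ /andP[-> yQ]; rewrite mem_cat yQ.
    apply: field_gen_mono; apply: tree_gens_sub => m y _.
    by case: leqP => //= _ /andP[-> yQ]; rewrite mem_cat yQ orbT.
  - by move=> _ [Q ->]; exact: field_gen_closed.
move=> _ [[t ->]|[m [y [Y [Y' [yY wY mQ ->]]]]]].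
  exists (field_gen (tree_gens n [::])); first by exists [::].
  by apply: field_gen_sub; left; exists t.
exists (field_gen (tree_gens n [:: q y])); first by exists [:: q y].
apply: field_gen_sub; right; exists m, y, Y, Y'; split=> //.
by move: mQ; rewrite in_nil andbF orbF mem_seq1 eqxx andbT leq_eqVlt ltnS orbC.
Qed.

Lemma tree_partial_iso : exists G : set (K * K), [/\ partial_iso G,
  forall t, G (cK t, cK t) &
  forall n y Y Y', lifts n y Y -> lifts n (w n y) Y' -> G (Y%:K, Y'%:K)].
Proof.
pose F := [set G | exists n, G = field_gen (tree_gens n [::])]%classic.
exists (\bigcup_(G in F) G)%classic; split.
- split; last first.
    by apply: zero_compatible_bigcup => _ [n ->]; apply: tree_gens_zero_compatible.
  apply: field_closed_bigcup.
  + by exists (field_gen (tree_gens 0 [::])); exists 0%N.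
  + move=> _ _ [n ->] [n' ->]; exists (field_gen (tree_gens (maxn n n') [::])).
    split; first by exists (maxn n n').
      apply: field_gen_mono; apply: tree_gens_sub => m y _.
      by rewrite in_nil !andbF !orbF leq_max => ->.
    apply: field_gen_mono; apply: tree_gens_sub => m y _.
    by rewrite in_nil !andbF !orbF leq_max => ->; rewrite orbT.
  + by move=> _ [n ->]; exact: field_gen_closed.
- move=> t; exists (field_gen (tree_gens 0 [::])); first by exists 0%N.
  by apply: field_gen_sub; left; exists t.
move=> n y Y Y' yY wY; exists (field_gen (tree_gens n [::])); first by exists n.
by apply: field_gen_sub; right; exists n, y, Y, Y'; rewrite leqnn.
Qed.

End TreeAutomorphism.
End Tree.

(** * The coverings given by the iterates *)

(** With [b] and [c] dual for [tau], the trace of multiplication by w is tau(th w), th being the sum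
    of the b_i c_i. The form of [tau] is perfect, so the trace form is perfect once [th] is a
    unit. *)
Lemma frobenius_algebra_etale (A B : comPzRingType) (s : {rmorphism A -> B})
    (n : nat) (b c : 'I_n -> B) (tau : B -> A) (v : B) :
  functional s tau -> (forall y, y = \sum_i s (tau (c i * y)) * b i) ->
  v * \sum_i b i * c i = 1 -> finite_etale s.
Proof.
move=> tauF dual vth; set th := \sum_i _ in vth.
have TrE w : \sum_i tau (c i * (w * b i)) = tau (th * w).
  rewrite mulr_suml (functional_sum tauF); apply: eq_bigr => i _; congr tau.
  by rewrite mulrA mulrAC [c i * b i]mulrC.
have nondeg w : (forall y, tau (w * y) = 0) -> w = 0.
  move=> w0; rewrite (dual w) big1 // => i _.
  by rewrite mulrC mulrC [c i * w]mulrC w0 rmorph0 mul0r.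
exists n, b, (fun i y => tau (c i * y)); split=> //.
- by move=> i a y z; rewrite mulrDr mulrCA tauF.
move=> lam lamF; pose z := \sum_i s (lam (b i)) * c i.
have lamE y : lam y = tau (z * y).
  rewrite mulr_suml (functional_sum tauF) {1}(dual y) (functional_sum lamF).
  by apply: eq_bigr => i _; rewrite -mulrA (functionalZ lamF) (functionalZ tauF) mulrC.
exists (v * z); split=> [y|x' x'P].
  by rewrite lamE TrE; congr tau; rewrite -!mulrA mulrCA mulrA vth mul1r.
have : th * x' - z = 0.
  apply: nondeg => y.
  have tauN : tau (- (z * y)) = - tau (z * y).
    rewrite -mulN1r -(rmorph1 s) -rmorphN (functionalZ tauF).
    by rewrite mulN1r.
  rewrite mulrBl (functionalD tauF) tauN -lamE x'P TrE -mulrA.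
  by rewrite subrr.
by move/eqP; rewrite subr_eq0 => /eqP <-; rewrite mulrA vth mul1r.
Qed.

(** * Etale quotients by monic polynomials *)

Section MonicQuotient.
Variables (A : comNzRingType) (P : {poly A}) (n : nat).
Hypotheses (Pmonic : P \is monic) (Psize : size P = n.+2).

Local Notation B := {poly %/ P}.
Local Notation pi := (in_qpoly P).

Lemma mk_monicE : mk_monic P = P.
Proof. by rewrite /mk_monic Psize Pmonic. Qed.

Lemma pi_small (p : {poly A}) : (size p <= n.+1)%N -> pi p = p :> {poly A}.
Proof. by move=> sp; rewrite in_qpoly_small // mk_monicE Psize. Qed.

Lemma val_qpoly_size (y : B) : (size (y : {poly A}) <= n.+1)%N.
Proof. by rewrite -ltnS; apply: leq_trans (size_mk_monic y) _; rewrite mk_monicE Psize. Qed.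

Lemma pi_val (y : B) : pi (y : {poly A}) = y.
Proof. by apply: val_inj; apply: in_qpoly_small; rewrite size_mk_monic. Qed.

Lemma pi_polyC a : pi a%:P = qpolyC P a.
Proof.
by apply: val_inj; apply: pi_small; rewrite (leq_trans (size_polyC_leq1 _)).
Qed.

Lemma pi_eq0 p : pi p = 0 <-> exists q, p = q * P.
Proof.
split=> [/(congr1 val)/= e|[q ->]].
  by exists (Pdiv.CommonRing.rdivp p P); rewrite {1}(Pdiv.RingMonic.rdivp_eq Pmonic p)
    -{3}mk_monicE e addr0.
by apply: val_inj; rewrite /= mk_monicE Pdiv.RingMonic.rmodp_mull.
Qed.

Definition top_coef (y : B) : A := (y : {poly A})`_n.

Lemma top_coef_functional : functional (qpolyC P) top_coef.
Proof.
move=> a y z; rewrite /top_coef.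
have -> : qpolyC P a * y = pi (a *: (y : {poly A})).
  by rewrite -pi_polyC -{1}(pi_val y) -rmorphM mul_polyC.
rewrite poly_of_qpolyD coefD pi_small ?coefZ //.
by rewrite (leq_trans (size_scale_leq _ _)) ?val_qpoly_size.
Qed.

(** Euler's dual basis: the polynomial quotients of [P] by X^(i+1) are dual to the powers of X. *)
Lemma top_coef_dual (i j : nat) : (i <= n)%N -> (j <= n)%N ->
  top_coef (pi (drop_poly i.+1 P) * pi 'X^j) = (i == j)%:R.
Proof.
move=> ile jle; rewrite -in_qpolyM /top_coef.
have [ji|ij] := leqP j i.
  rewrite pi_small; last first.
    rewrite (leq_trans (size_polyMleq _ _)) // size_polyXn addnS /= size_drop_poly.
    by rewrite Psize; lia.
  rewrite coefMXn ltnNge jle /= coef_drop_poly.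
  have [<-|nij] := eqVneq i j.
    by rewrite addnS subnK // -[n.+1]/n.+2.-1 -Psize -lead_coefE (monicP Pmonic).
  by rewrite nth_default // Psize; lia.
(* Subtracting X^(j-i-1) P leaves the low part of [P], shifted to degree less than j, whose
   coefficient at n vanishes. *)
have -> : pi (drop_poly i.+1 P * 'X^j) = pi (- (take_poly i.+1 P * 'X^(j - i.+1))).
  apply/eqP; rewrite -subr_eq0 -rmorphB; apply/eqP/pi_eq0; exists 'X^(j - i.+1).
  have jE : j = (j - i.+1 + i.+1)%N by rewrite subnK.
  rewrite opprK {1}jE exprD -[in RHS](poly_take_drop i.+1 P).
  by ring.
have st : (size (take_poly i.+1 P * 'X^(j - i.+1))%R <= j)%N.
  rewrite (leq_trans (size_polyMleq _ _)) // size_polyXn addnS /=.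
  by rewrite -[leqRHS](subnKC ij) leq_add2r size_take_poly.
rewrite pi_small ?size_polyN; last by rewrite (leq_trans st) // ltnW.
by rewrite coefN nth_default ?oppr0 ?(leq_trans st) // (ltn_eqF ij).
Qed.

(** The coefficient of X^(k+1) in [P] contributes to X^k once for each i from 0 to k. Thus the
    element [th] of [frobenius_algebra_etale] is P'. *)
Lemma deriv_drop_poly : \sum_(i < n.+1) 'X^i * drop_poly i.+1 P = P^`().
Proof.
apply/polyP => k; rewrite coef_sum coef_deriv.
under eq_bigr => i _ do rewrite mulrC coefMXn coef_drop_poly.
have [kn|nk] := ltnP k n.+1; last first.
  rewrite nth_default ?Psize ?mul0rn // big1 // => i _; case: ifP => // ki.
  by rewrite nth_default // Psize addnS subnK ?ltnS // leqNgt ki.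
rewrite (eq_bigr (fun i : 'I_n.+1 => if (i < k.+1)%N then P`_k.+1 else 0)); last first.
  by move=> i _; rewrite ltnS; case: ltnP => // ik; rewrite addnS subnK.
rewrite -big_mkcond /= -(big_ord_widen _ (fun=> P`_k.+1)) //.
by rewrite big_const_ord iter_addr_0.
Qed.

Lemma monic_quotient_etale (u w : {poly A}) :
  u * P^`() = 1 + w * P -> finite_etale (qpolyC P).
Proof.
move=> uw; apply: (@frobenius_algebra_etale _ _ _ n.+1 (fun i => pi 'X^i)
  (fun i => pi (drop_poly i.+1 P)) top_coef (pi u)).
- exact: top_coef_functional.
- move=> y.
  have yE : y = \sum_(j < n.+1) qpolyC P (y : {poly A})`_j * pi 'X^j.
    rewrite -[LHS]pi_val -{1}(coefK (y : {poly A})) poly_def.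
    rewrite -(big_mkord xpredT (fun j => (y : {poly A})`_j *: 'X^j)).
    rewrite (big_nat_widen _ _ n.+1) ?val_qpoly_size // big_mkcond big_mkord rmorph_sum.
    apply: eq_bigr => j _ /=; rewrite -pi_polyC -rmorphM mul_polyC.
    by case: ltnP => // jy; rewrite nth_default // scale0r.
  rewrite {1}yE; apply: eq_bigr => i _; congr (qpolyC P _ * _).
  rewrite [in RHS]yE mulr_sumr (functional_sum top_coef_functional).
  rewrite (bigD1 i) //= big1 ?addr0 => [|j ji].
    by rewrite mulrCA (functionalZ top_coef_functional) top_coef_dual -1?ltnS // eqxx mulr1.
  rewrite mulrCA (functionalZ top_coef_functional) top_coef_dual -1?ltnS //.
  by rewrite eq_sym -[_ == _ :> nat]/(j == i) (negPf ji) mulr0.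
have e0 : pi (w * P) = 0 by apply/pi_eq0; exists w.
have := congr1 pi uw; rewrite in_qpolyM in_qpolyD e0 addr0 in_qpoly1 => <-.
congr (_ * _); rewrite -deriv_drop_poly rmorph_sum.
by apply: eq_bigr => i _; apply/esym; exact: in_qpolyM.
Qed.

End MonicQuotient.

(** * Unramifiedness of the iterates away from the postcritical points *)

Section IterateUnit.
Variables (A : comNzRingType) (f : {poly A}) (a c d t : A) (N : nat).
Hypothesis fE : f = a%:P * ('X - c%:P) ^+ 2 + d%:P.
Hypothesis two_a_unit : exists v, v * (2%:R * a) = 1.
Hypothesis crit_unit : forall m, (0 < m <= N)%N ->
  exists v, v * (t - iter m (horner f) c) = 1.

Local Notation Fi n := (iter n (comp_poly f) 'X).
Let Q := Fi N - t%:P.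
Let unit_mod (p : {poly A}) := exists u w, u * p = 1 + w * Q.

Lemma iter_comp_polyD m i : Fi (m + i) = Fi m \Po Fi i.
Proof.
elim: i => [|i IH]; first by rewrite addn0 comp_polyXr.
by rewrite addnS !iterS IH comp_polyA.
Qed.

Lemma horner_iter_comp m y : (Fi m).[y] = iter m (horner f) y.
Proof.
elim: m y => [|m IH] y; first by rewrite hornerX.
by rewrite iterS horner_comp IH -iterSr.
Qed.

Lemma unit_modM p p' : unit_mod p -> unit_mod p' -> unit_mod (p * p').
Proof.
move=> [u [w e]] [u' [w' e']]; exists (u * u'), (w + w' + w * w' * Q).
by rewrite mulrACA e e'; ring.
Qed.

Lemma unit_mod_unit v p : v * p = 1 -> unit_mod p.
Proof. by move=> e; exists v, 0; rewrite e mul0r addr0. Qed.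

(** f^i(X) - c divides f^N(X) - f^(N-i)(c), which is congruent to the unit t - f^(N-i)(c) modulo
    [Q]. *)
Lemma unit_mod_iterate i : (i < N)%N -> unit_mod (Fi i - c%:P).
Proof.
move=> iN; have [|v vE] := @crit_unit (N - i); first by rewrite subn_gt0 iN leq_subr.
have /factor_theorem[g gE] : root (Fi (N - i) - ((Fi (N - i)).[c])%:P) c.
  by rewrite rootE !hornerE subrr.
have := congr1 (comp_poly (Fi i)) gE.
rewrite comp_polyB comp_polyC -iter_comp_polyD subnK ?(ltnW iN) // comp_polyM.
rewrite comp_polyB comp_polyX comp_polyC horner_iter_comp => e.
exists (v%:P * (g \Po Fi i)), v%:P; rewrite -mulrA -e.
have -> : 1 = v%:P * (t%:P - (iter (N - i) (horner f) c)%:P) :> {poly A}.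
  by rewrite -polyCB -polyCM vE.
by rewrite /Q; ring.
Qed.

(** By the chain rule the derivative is a product of factors 2a (f^i(X) - c) with i < N. *)
Lemma iterate_deriv_unit : exists u w, u * Q^`() = 1 + w * Q.
Proof.
have -> : Q^`() = (Fi N)^`() by rewrite derivB derivC subr0.
have fd : f^`() = (2%:R * a)%:P * ('X - c%:P).
  rewrite fE derivD derivC addr0 derivM derivC mul0r add0r expr2 derivM derivXsubC.
  by rewrite polyCM polyC_natr; ring.
suff H n : (n <= N)%N -> unit_mod (Fi n)^`() by apply: H.
elim: n => [_|n IH nN]; first by apply: (@unit_mod_unit 1); rewrite derivX mulr1.
rewrite -[n.+1]add1n iter_comp_polyD /= comp_polyX deriv_comp fd.
rewrite comp_polyM comp_polyC comp_polyB comp_polyX comp_polyC.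
apply: unit_modM; last exact: IH (ltnW nN).
apply: unit_modM; last exact: unit_mod_iterate.
by have [v vE] := two_a_unit; apply: (@unit_mod_unit v%:P); rewrite -polyCM vE.
Qed.
End IterateUnit.

Lemma map_quadratic (R R' : comNzRingType) (h : {rmorphism R -> R'}) a c d :
  map_poly h (a%:P * ('X - c%:P) ^+ 2 + d%:P) =
    (h a)%:P * ('X - (h c)%:P) ^+ 2 + (h d)%:P.
Proof. by rewrite rmorphD rmorphM rmorphXn rmorphB /= map_polyX !map_polyC. Qed.

Lemma deriv_Cmul (R : comNzRingType) (c : R) p : (c%:P * p)^`() = c%:P * p^`().
Proof. by rewrite derivM derivC mul0r add0r. Qed.

Lemma polyC_mulKV (R : comNzRingType) (l l' : R) (p : {poly R}) :
  l * l' = 1 -> l%:P * (l'%:P * p) = p.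
Proof. by move=> e; rewrite mulrA -polyCM e mul1r. Qed.

Section Covering.
Variables (F : fieldType) (f : {poly F}) (c : F) (N : nat) (S : set (P1 F)).
Hypotheses (two : 2%:R != 0 :> F) (f3 : size f = 3%N) (fc : root f^`() c).
Hypothesis S_crit : forall m, (0 < m <= N)%N -> S (Some (iter m (horner f) c)).

Local Notation A := (coord_ring S).
Definition coord_const : {rmorphism F -> A} := @coord_poly F S \o polyC.
Local Notation t := (coord_poly S 'X).

Lemma quadratic_center :
  f = (lead_coef f)%:P * ('X - c%:P) ^+ 2 + (f.[c])%:P.
Proof.
have fE : f = (f`_2)%:P * 'X ^+ 2 + (f`_1)%:P * 'X + (f`_0)%:P.
  apply/polyP => i; rewrite !coefD coefMX coefCM coefXn !coefC.
  case: i => [|[|[|i]]] /=; rewrite ?(mulr0, mulr1, add0r, addr0) //.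
  by rewrite nth_default // f3.
have lf : lead_coef f = f`_2 by rewrite lead_coefE f3.
have f1E : f`_1 = - (2%:R * f`_2 * c).
  have := congr1 (fun p : {poly F} => p^`().[c]) fE; rewrite (rootP fc).
  rewrite !derivD !derivM !derivC !derivX !hornerE => /esym/eqP /= e.
  by apply/eqP; rewrite -subr_eq0 -[X in _ == X](eqP e); apply/eqP; ring.
have fcE : f.[c] = f`_2 * c ^+ 2 + f`_1 * c + f`_0.
  by rewrite {1}fE !(hornerD, hornerM, hornerXn, hornerC, hornerX).
rewrite lf fcE [LHS]fE f1E !polyCD !polyCN !polyCM polyC_natr.
by ring.
Qed.

Lemma size_iter_comp n : size (iter n (comp_poly f) 'X) = (2 ^ n).+1.
Proof.
elim: n => [|n IH]; first by rewrite size_polyX.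
have := size_comp_poly (iter n (comp_poly f) 'X) f; rewrite IH f3 /= -expnSr => e.
by rewrite -e prednK // ltnW // -subn_gt0 subn1 e expn_gt0.
Qed.

Lemma coord_sub_unit z : S (Some z) -> exists v, v * (t - coord_const z) = 1.
Proof.
move=> Sz; have H : (FracField.tofrac ('X - z%:P))^-1 \in regular_off S.
  apply/asboolP; exists 1, [:: z]; split; first by move=> y; rewrite mem_seq1 => /eqP ->.
  by rewrite big_seq1 mulVf ?tofrac1 // tofrac_eq0 polyXsubC_eq0.
exists (CoordRing H); apply: val_inj => /=.
by rewrite -tofracB mulVf // tofrac_eq0 polyXsubC_eq0.
Qed.

Lemma iterate_covering_ex :
  exists (B : etale_alg A) (q : {rmorphism {poly A} -> B}), is_iterate_covering f N q.
Proof.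
pose FN := map_poly coord_const (iterate f N).
pose Q := FN - t%:P; pose l := coord_const (lead_coef (iterate f N)).
have FNsize : size FN = (2 ^ N).+1 by rewrite size_map_poly size_iter_comp.
have [l' l'l] : exists l', l' * l = 1.
  exists (coord_const (lead_coef (iterate f N))^-1); rewrite -rmorphM mulVf ?rmorph1 //.
  by rewrite lead_coef_eq0 -size_poly_gt0 size_iter_comp.
have ll' : l * l' = 1 by rewrite mulrC.
have tsize : (size t%:P < size FN)%N.
  by rewrite FNsize (leq_ltn_trans (size_polyC_leq1 _)) // ltnS expn_gt0.
have Qsize : size Q = (2 ^ N).+1 by rewrite size_polyDl ?size_polyN.
have Qlead : lead_coef Q = l.
  by rewrite lead_coefDl ?size_polyN // lead_coef_map.
(* The quotient construction needs a monic polynomial; the leading coefficient is a nonzero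
   constant, hence a unit. *)
pose P := l' *: Q; have PE : P = l'%:P * Q by rewrite mul_polyC.
have l'reg : GRing.lreg l'.
  by apply: (can_inj (g := *%R l)) => z; rewrite mulrA ll' mul1r.
have Psize : size P = ((2 ^ N).-1).+2 by rewrite lreg_size // Qsize prednK ?expn_gt0.
have Pmonic : P \is monic by apply/monicP; rewrite lead_coefE coefZ lreg_size // -lead_coefE Qlead.
have QP : Q = l%:P * P by rewrite PE (polyC_mulKV _ ll').
pose fA := map_poly coord_const f.
have FNE : FN = iter N (comp_poly fA) 'X.
  rewrite /FN /iterate; elim: (N) => [|m IH]; first by rewrite /= map_polyX.
  by rewrite !iterS map_comp_poly IH.
have fAE : fA = (coord_const (lead_coef f))%:P * ('X - (coord_const c)%:P) ^+ 2
    + (coord_const f.[c])%:P.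
  by rewrite /fA {1}quadratic_center; exact: map_quadratic.
have [||u [w uw]] := @iterate_deriv_unit A fA _ _ _ t N fAE.
- exists (coord_const (2%:R * lead_coef f)^-1).
  rewrite -(rmorph_nat coord_const) -!rmorphM mulVf ?rmorph1 // mulf_neq0 //.
  by rewrite lead_coef_eq0 -size_poly_gt0 f3.
- move=> m mN; have [v vE] := coord_sub_unit (S_crit mN).
  exists v; rewrite -vE; congr (_ * (_ - _)).
  by elim: (m) => //= k ->; rewrite horner_map.
rewrite -FNE -/Q in uw.
have etP : finite_etale (qpolyC P).
  apply: (@monic_quotient_etale A P _ Pmonic Psize (u * l%:P) (w * l%:P)).
  rewrite -[RHS](_ : 1 + w * Q = _); last by rewrite {1}QP mulrA.
  rewrite -uw -mulrA; congr (u * _).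
  by rewrite PE deriv_Cmul (polyC_mulKV _ ll').
exists (EtaleAlg etP), (in_qpoly P); split.
- by move=> z; exact: (pi_polyC Pmonic Psize).
- by move=> b; exists (polyn b); exact: pi_val.
move=> g; apply: iff_trans (pi_eq0 Pmonic Psize g) _; split=> -[h hE].
  by exists (h * l'%:P); rewrite hE PE mulrA.
by exists (h * l%:P); rewrite hE -mulrA -QP.
Qed.
End Covering.

(** * Automorphisms of the fibre functor *)

Lemma rmorphism_eq (R S : pzRingType) (f g : {rmorphism R -> S}) : f =1 g -> f = g.
Proof.
move=> /funext; case: f g => [f [[f1] [f2]]] [g [[g1] [g2]]] /= e.
case: _ / e in g1 g2 *.
by rewrite (Prop_irrelevance f1 g1) (Prop_irrelevance f2 g2).
Qed.

Lemma fibre_eq (A : comPzRingType) (L : fieldType) (pt : {rmorphism A -> L})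
    (B : etale_alg A) (phi psi : fibre pt B) : phi =1 psi -> phi = psi.
Proof.
case: phi psi => [f fo] [g go] /= /rmorphism_eq e.
case: _ / e in go *; by rewrite (Prop_irrelevance fo go).
Qed.

Section FibreAction.
Variable L : fieldType.
Hypothesis Lsep : separably_closed L.
Local Notation K := {fraction (pseries L)}.
Local Notation "y %:K" := (frac_ps L y) (at level 2, format "y %:K").
Implicit Types G : set (K * K).

Section OneRing.
Variables (A : comPzRingType) (ser : {rmorphism A -> pseries L}) (pt : {rmorphism A -> L}).
Hypothesis serE : forall a, ps_coef0 (ser a) = pt a.
Variable B : etale_alg A.

Definition fibre_lift (phi : fibre pt B) (Phi : {rmorphism B -> pseries L}) :=
  lies_over (alg_map B) ser Phi /\ forall b, ps_coef0 (Phi b) = phi b.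

(** A relation rather than a map: its symmetry under [swap_graph] will yield bijectivity. *)
Definition fibre_rel G (phi psi : fibre pt B) := exists Phi Psi,
  [/\ fibre_lift phi Phi, fibre_lift psi Psi & forall b, G ((Phi b)%:K, (Psi b)%:K)].

Lemma fibre_lift_ex phi : exists Phi, fibre_lift phi Phi.
Proof.
have [n [b [beta [x S]]]] := finite_etale_separability (alg_etale B).
have [|Phi [PhiR Phi0]] := lift_hom S serE (phi := fibre_hom phi).
  by move=> a; rewrite fibre_over.
by exists Phi.
Qed.

Lemma fibre_lift_unique phi Phi Psi :
  fibre_lift phi Phi -> fibre_lift phi Psi -> Phi =1 Psi.
Proof.
have [n [b [beta [x S]]]] := finite_etale_separability (alg_etale B).
move=> [PhiR Phi0] [PsiR Psi0]; apply: (lift_hom_unique S PhiR PsiR) => c.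
by rewrite Phi0 Psi0.
Qed.

Lemma fibre_rel_functional G phi psi psi' : partial_iso G ->
  fibre_rel G phi psi -> fibre_rel G phi psi' -> psi = psi'.
Proof.
move=> pG [Phi [Psi [hPhi [_ Psi0] H]]] [Phi' [Psi' [hPhi' [_ Psi'0] H']]].
apply: fibre_eq => b; rewrite -Psi0 -Psi'0; congr (ps_coef0 _).
have := H' b; rewrite -(fibre_lift_unique hPhi hPhi') => Hb.
have /eqP := partial_iso_functional pG (H b) Hb.
by rewrite tofrac_eq => /eqP.
Qed.

Lemma fibre_rel_swap G phi psi :
  fibre_rel G phi psi <-> fibre_rel (swap_graph G) psi phi.
Proof. by split=> -[Phi [Psi [h1 h2 H]]]; exists Psi, Phi; split. Qed.

(** [etale_minpoly] and maximality give every Phi(c) an image. The images form a homomorphism from B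
    to L((u)) over A, which has values in L[[u]] by [etale_hom_integral] and reduces to the required
    point. *)
Lemma fibre_rel_total G phi : maximal_iso G ->
  (forall a, G ((ser a)%:K, (ser a)%:K)) -> exists psi, fibre_rel G phi psi.
Proof.
move=> maxG Gser; have pG := maxG.1; have [[G1 GB GM _] _] := pG.
have [n [b [beta [x S]]]] := finite_etale_separability (alg_etale B).
have [Phi hPhi] := fibre_lift_ex phi.
have [||g gE] := @rmorphism_of A (iso_field pG) (fun a => IsoField (GG := pG) (asboolT (Gser a))).
- by move=> a a'; apply: val_inj; congr pair; rewrite !rmorphB.
- by split=> [|a a']; apply: val_inj; congr pair; rewrite ?rmorph1 ?rmorphM.
have /choice[psi0 psi0P] : forall c, exists y, G ((Phi c)%:K, y).
  move=> c.
  have [||p [p0 pr [t pt_]]] := @etale_minpoly _ _ _ _ _ _ _ _ ser pt _ g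
     (@iso_fst _ _ _ pG) (@iso_snd _ _ _ pG) Phi c S Lsep serE _ _ hPhi.1.
  - by move=> a; rewrite gE.
  - by move=> a; rewrite gE.
  exact: (maximal_iso_root maxG p0 pr pt_).
have fn y z z' : G (y, z) -> G (y, z') -> z = z' by apply: partial_iso_functional.
have [||psi psiE] := @rmorphism_of _ _ psi0.
- move=> c d; apply: (fn (Phi (c - d))%:K) => //.
  by rewrite !rmorphB; exact: (GB _ _ (psi0P c) (psi0P d)).
- split=> [|c d].
    by apply: (fn (Phi 1)%:K) => //; rewrite !rmorph1.
  apply: (fn (Phi (c * d))%:K) => //.
  by rewrite !rmorphM; exact: (GM _ _ (psi0P c) (psi0P d)).
have [|Psi [PsiR PsiE]] := etale_hom_integral S serE Lsep (psi := psi).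
  move=> a; rewrite psiE; apply: (fn (ser a)%:K _ _ _ (Gser a)).
  by rewrite -hPhi.1; exact: psi0P.
have ov a : (@ps_coef0 L \o Psi) (alg_map B a) = pt a by rewrite /= PsiR serE.
exists (Fibre (fibre_hom := (@ps_coef0 L \o Psi : {rmorphism _ -> _})) ov), Phi, Psi; split=> //.
by move=> c; rewrite -PsiE psiE.
Qed.

End OneRing.

(** The identity as [i] gives naturality over one base ring, an inclusion of coordinate rings gives
    the compatibility between levels. The point psi' o h is also related to [phi], so it equals
    [psi]. *)
Lemma fibre_rel_natural G (A A' : comPzRingType) (i : {rmorphism A -> A'})
    (ser : {rmorphism A -> pseries L}) (ser' : {rmorphism A' -> pseries L})
    (pt : {rmorphism A -> L}) (pt' : {rmorphism A' -> L})
    (B : etale_alg A) (B' : etale_alg A') (h : {rmorphism B -> B'})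
    (phi psi : fibre pt B) (phi' psi' : fibre pt' B') :
  partial_iso G ->
  (forall a, ps_coef0 (ser a) = pt a) -> (forall a, ser' (i a) = ser a) ->
  (forall a, h (alg_map B a) = alg_map B' (i a)) ->
  (forall b, phi b = phi' (h b)) ->
  fibre_rel ser G phi psi -> fibre_rel ser' G phi' psi' ->
  forall b, psi b = psi' (h b).
Proof.
move=> pG serE seri hi hphi rel [Phi [Psi [[PhiR Phi0] [PsiR Psi0] H]]].
have ov a : (psi' \o h) (alg_map B a) = pt a.
  by rewrite /= hi -Psi0 PsiR seri serE.
pose psih : fibre pt B := Fibre (fibre_hom := (psi' \o h : {rmorphism _ -> _})) ov.
have : fibre_rel ser G phi psih.
  exists (Phi \o h : {rmorphism _ -> _}), (Psi \o h : {rmorphism _ -> _}); split.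
  - by split=> [a|b]; [rewrite /= hi PhiR seri|rewrite /= Phi0 hphi].
  - by split=> [a|b]; [rewrite /= hi PsiR seri|rewrite /= Psi0].
  - by move=> b; apply: H.
by move=> /(fibre_rel_functional pG rel) -> b.
Qed.

Lemma pi1_of_iso G (A : comPzRingType) (ser : {rmorphism A -> pseries L})
    (pt : {rmorphism A -> L}) :
  maximal_iso G -> (forall a, ps_coef0 (ser a) = pt a) ->
  (forall a, G ((ser a)%:K, (ser a)%:K)) ->
  exists sigma : pi1 pt, forall B (phi : fibre pt B), fibre_rel ser G phi (sigma B phi).
Proof.
move=> maxG serE Gser; have pG := maxG.1.
have tot (B : etale_alg A) (phi : fibre pt B) : exists psi, fibre_rel ser G phi psi.
  exact: fibre_rel_total.
have tot' (B : etale_alg A) (phi : fibre pt B) : exists psi, fibre_rel ser (swap_graph G) phi psi.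
  by apply: fibre_rel_total => //; apply: swap_maximal_iso.
pose act (B : etale_alg A) (phi : fibre pt B) := projT1 (cid (tot B phi)).
have actP B phi : fibre_rel ser G phi (act B phi) by rewrite /act; case: cid.
pose act' (B : etale_alg A) (phi : fibre pt B) := projT1 (cid (tot' B phi)).
have act'P B phi : fibre_rel ser (swap_graph G) phi (act' B phi) by rewrite /act'; case: cid.
have bij B : bijective (act B).
  exists (act' B) => phi.
    apply: (fibre_rel_functional (swap_partial_iso pG) (act'P B (act B phi))).
    by apply/fibre_rel_swap/actP.
  apply: (fibre_rel_functional pG (actP B (act' B phi))).
  by apply/fibre_rel_swap/act'P.
have nat_ (B B' : etale_alg A) (h : {rmorphism B -> B'}) :
    (forall a, h (alg_map B a) = alg_map B' a) ->
    forall (phi : fibre pt B) (psi : fibre pt B'),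
      (forall b, phi b = psi (h b)) -> forall b, act B phi b = act B' psi (h b).
  move=> hA phi psi hphi.
  by apply: (@fibre_rel_natural G A A idfun ser ser pt pt B B' h phi _ psi).
by exists (Pi1 bij nat_).
Qed.

End FibreAction.

(** * Expansion of regular functions at the base point *)

Section CoordSeries.
Variables (F L : fieldType) (e : {rmorphism F -> L}) (x : L).
Local Notation K := {fraction (pseries L)}.
Local Notation T := (ps_base x).

Definition series_const : {rmorphism F -> pseries L} := @ps_const L \o e.
Definition frac_const : {rmorphism F -> K} := frac_ps L \o series_const.

Variable S : set (P1 F).

(** The point x + u is not constant, so [coord_eval] applies to it over the fraction field. *)
Lemma avoids_base : avoids frac_const (frac_ps L T) S.
Proof.
move=> [c|] _ //= -[] /eqP; rewrite tofrac_eq => /eqP cT.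
by have := nonconst_base x; rewrite -cT eqxx.
Qed.

Lemma map_frac_const (p : {poly F}) :
  (map_poly frac_const p).[frac_ps L T] = frac_ps L (map_poly series_const p).[T].
Proof. by rewrite map_poly_comp horner_map. Qed.

Lemma series_const0 (p : {poly F}) :
  ps_coef0 (map_poly series_const p).[T] = (map_poly e p).[x].
Proof.
rewrite -horner_map /= ps_coef0_base -map_poly_comp.
by congr (_.[_]); apply: eq_map_poly.
Qed.

Hypothesis H : avoids e x S.

Lemma coord_series_ex (a : coord_ring S) :
  exists r, frac_ps L r = coord_eval avoids_base a.
Proof.
have [p [s [sS ap]]] := asboolP _ (valP a).
rewrite (coord_evalE avoids_base sS ap) !map_frac_const.
set D := (map_poly _ (\prod_(c <- s) _)).[_].
have Du : D \is a GRing.unit by rewrite ps_unitE series_const0 (avoids_neq0 H sS).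
exists ((map_poly series_const p).[T] / D).
by rewrite rmorphM rmorphV.
Qed.

(** Obtained from the evaluation at x + u in the fraction field, so that the morphism laws come from
    [coord_eval]; the value is a power series because the denominators do not vanish at [x]. *)
Definition coord_series (a : coord_ring S) : pseries L :=
  projT1 (cid (coord_series_ex a)).

Lemma coord_seriesK a : frac_ps L (coord_series a) = coord_eval avoids_base a.
Proof. by rewrite /coord_series; case: cid. Qed.

Lemma frac_ps_inj : injective (frac_ps L).
Proof. by move=> u v /eqP; rewrite tofrac_eq => /eqP. Qed.

Lemma coord_series_zmod : zmod_morphism coord_series.
Proof.
by move=> a b; apply: frac_ps_inj; rewrite rmorphB !coord_seriesK rmorphB.
Qed.

Lemma coord_series_monoid : monoid_morphism coord_series.
Proof.
split=> [|a b]; apply: frac_ps_inj; first by rewrite coord_seriesK !rmorph1.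
by rewrite rmorphM !coord_seriesK rmorphM.
Qed.

HB.instance Definition _ := GRing.isZmodMorphism.Build (coord_ring S) (pseries L)
  coord_series coord_series_zmod.
HB.instance Definition _ := GRing.isMonoidMorphism.Build (coord_ring S) (pseries L)
  coord_series coord_series_monoid.

Lemma coord_series_poly p : coord_series (coord_poly S p) = (map_poly series_const p).[T].
Proof. by apply: frac_ps_inj; rewrite coord_seriesK coord_eval_poly map_frac_const. Qed.

Lemma coord_series0 a : ps_coef0 (coord_series a) = coord_eval H a.
Proof.
have [p [s [sS ap]]] := asboolP _ (valP a).
rewrite (coord_evalE H sS ap).
have := coord_seriesK a; rewrite (coord_evalE avoids_base sS ap) !map_frac_const.
have D0 := avoids_neq0 H sS.
have frD : frac_ps L (map_poly series_const (\prod_(c <- s) ('X - c%:P))).[T] != 0.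
  by rewrite frac_ps_eq0 ps_coef0_neq0 // series_const0.
move/(congr1 ( *%R^~ (frac_ps L (map_poly series_const (\prod_(c <- s) ('X - c%:P))).[T]))).
rewrite /= divfK // -rmorphM => /frac_ps_inj/(congr1 (@ps_coef0 L)).
by rewrite rmorphM /= !series_const0 => <-; rewrite mulfK.
Qed.

Lemma coord_series_graph (G : set (K * K)) : field_closed G ->
  (forall t, G (frac_ps L (ps_const t), frac_ps L (ps_const t))) ->
  G (frac_ps L T, frac_ps L T) ->
  forall a, G (frac_ps L (coord_series a), frac_ps L (coord_series a)).
Proof.
move=> Gc Gconst GT.
have Gp (p : {poly F}) : G ((map_poly frac_const p).[frac_ps L T],
                            (map_poly frac_const p).[frac_ps L T]).
  elim/poly_ind: p => [|p c IH]; first by rewrite rmorph0 horner0; exact: field_closed0 Gc.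
  rewrite rmorphD rmorphM /= map_polyX map_polyC hornerMXaddC.
  case: (Gc) => _ _ GM _.
  exact: (field_closedD Gc (GM _ _ IH GT) (Gconst (e c))).
move=> a; have [p [s [sS ap]]] := asboolP _ (valP a).
rewrite coord_seriesK (coord_evalE avoids_base sS ap).
case: (Gc) => _ _ GM GV; exact: (GM _ _ (Gp p) (GV _ (Gp _))).
Qed.

End CoordSeries.

Lemma coord_series_incl (F L : fieldType) (e : {rmorphism F -> L}) (x : L)
    (S S' : set (P1 F)) (sub : (S `<=` S')%classic) (H : avoids e x S) (H' : avoids e x S') a :
  coord_series H' (coord_incl sub a) = coord_series H a.
Proof.
by apply: frac_ps_inj; rewrite !coord_seriesK (coord_eval_incl _ (@avoids_base _ _ e x S)).
Qed.

(** * Levels of the tree of preimages *)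

Section TreeLevels.
Variables (L : fieldType) (f : {poly L}) (x : L).
Local Notation T := (preimage_tree f x).

Definition mk_vertex n y (yx : iter n (horner f) y == x) : T :=
  existT (fun n => {y : L | iter n (horner f) y == x}) n (exist _ y yx).

Lemma preimage_vertexP (u : T) : iter (tag u) (horner f) (val (tagged u)) = x.
Proof. by case: u => n [y yx]; exact/eqP. Qed.

Lemma vertex_eq (u v : T) :
  tag u = tag v -> val (tagged u) = val (tagged v) -> u = v.
Proof.
case: u v => [n [y yx]] [m [z zx]] /= e; case: _ / e in zx * => /= e.
by case: _ / e in zx *; rewrite (bool_irrelevance yx zx).
Qed.

Lemma preimage_parent_unique (p p' u : T) :
  preimage_parent p u -> preimage_parent p' u -> p = p'.
Proof.
move=> [t1 v1] [t2 v2]; apply: vertex_eq; last by rewrite -v1 -v2.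
by apply: succn_inj; rewrite -t1 -t2.
Qed.

Lemma preimage_parent_ex (u : T) n : tag u = n.+1 ->
  exists p : T, preimage_parent p u.
Proof.
case: u => m [y yx] /= e; case: _ / (esym e) in yx *.
have px : iter n (horner f) f.[y] == x by rewrite -iterSr.
by exists (mk_vertex px).
Qed.

Lemma level0_root (u : T) : tag u = 0%N -> u = root_vertex T.
Proof.
move=> u0; apply: vertex_eq => //=.
by case: u u0 => m [y yx] /= e; case: _ / (esym e) in yx *; exact/eqP.
Qed.

(** Adjacency does not orient the edges, so the induction must exclude that w(u) is the parent of
    w(p) for p the parent of u: it would be the image of the parent of p, contradicting
    injectivity. *)
Lemma rooted_iso_level (w : T -> T) : rooted_iso (T' := T) w -> forall u,
  tag (w u) = tag u /\ forall p, preimage_parent p u -> preimage_parent (w p) (w u).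
Proof.
case=> wbij wroot wadj u; have [n] := ubnP (tag u); elim: n u => // n IH u.
rewrite ltnS => un.
have [m E] : exists m, tag u = m by exists (tag u).
case: m E => [|m] E.
  by rewrite (level0_root E) wroot; split=> // p [].
have [p pu] := preimage_parent_ex E.
have tp : tag p = m by apply: succn_inj; rewrite -E; case: pu.
have [twp IHp] : tag (w p) = tag p /\
    forall q, preimage_parent q p -> preimage_parent (w q) (w p).
  by apply: IH; rewrite tp -ltnS -E ltnS; apply: leq_trans un; rewrite E.
have wpu : preimage_parent (w p) (w u).
  have /wadj[//|up] : adjacent p u by left.
  have [t1 _] := up; rewrite twp tp in t1; rewrite t1 in tp.
  have [pp ppp] := preimage_parent_ex tp.
  have := preimage_parent_unique (IHp _ ppp) up.
  move/(bij_inj wbij) => e; have [tpp _] := ppp.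
  by move: tpp; rewrite e E tp t1; lia.
split; first by have [twu _] := wpu; rewrite twu twp tp E.
by move=> p' /(preimage_parent_unique pu) <-.
Qed.

(** A total function on L, as [tree_partial_iso] expects; off the level it is the identity. *)
Definition level_action (w : T -> T) (n : nat) (y : L) : L :=
  if @idP (iter n (horner f) y == x) is ReflectT yx
  then val (tagged (w (mk_vertex yx))) else y.

Lemma level_actionE (w : T -> T) (u : T) n : tag u = n ->
  level_action w n (val (tagged u)) = val (tagged (w u)).
Proof.
move=> <-; case: u => m [y yx]; rewrite /level_action /=; case: {-}_ / idP => // yx'.
by rewrite (bool_irrelevance yx' yx).
Qed.

End TreeLevels.

Lemma rmorph_sub_eq0 (R R' : pzRingType) (q : {rmorphism R -> R'}) u v :
  q (u - v) = 0 -> q u = q v.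
Proof. by rewrite rmorphB => /eqP; rewrite subr_eq0 => /eqP. Qed.

Lemma horner_morph_eval (R R'' : comNzRingType) (R' : comPzRingType) (q : {rmorphism {poly R} -> R'})
    (g : {rmorphism R -> R''}) (h : {rmorphism R' -> R''}) :
  (forall a, h (q a%:P) = g a) ->
  forall p, h (q p) = (map_poly g p).[h (q 'X)].
Proof.
move=> hq; elim/poly_ind => [|p a IH]; first by rewrite !rmorph0 horner0.
by rewrite !rmorphD !rmorphM /= map_polyX map_polyC hornerMXaddC IH hq.
Qed.

(** * Surjectivity of the monodromy action *)

Section Monodromy.
Variables (F L : fieldType) (e : {rmorphism F -> L}) (f : {poly F}) (x : L) (c : F).
Hypotheses (Lsep : separably_closed L) (two : 2%:R != 0 :> F) (f3 : size f = 3%N).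
Hypotheses (fc : root f^`() c) (H : avoids e x (postcritical f)).
Hypothesis orbit : forall i j, (i < j)%N ->
  iter i (horner f) f.[c] != iter j (horner f) f.[c].
Variable fL : {poly L}.
Hypothesis fLE : fL = map_poly e f.

Local Notation a := (e (lead_coef f)).
Local Notation d := (e f.[c]).
Local Notation K := {fraction (pseries L)}.

Lemma horner_quad (R : comNzRingType) (g : {rmorphism F -> R}) y :
  (map_poly g f).[y] = quad (g (lead_coef f)) (g c) (g f.[c]) y.
Proof.
rewrite {1}(quadratic_center f3 fc) map_quadratic.
by rewrite hornerD hornerM horner_exp hornerXsubC !hornerC.
Qed.

Lemma iter_horner_map (R : comNzRingType) (g : {rmorphism F -> R}) i y :
  iter i (horner (map_poly g f)) (g y) = g (iter i (horner f) y).
Proof. by elim: i => //= i ->; rewrite horner_map. Qed.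

Lemma horner_fL y : fL.[y] = quad a (e c) d y.
Proof. by rewrite fLE horner_quad. Qed.

Lemma iter_quad_fL i y : iter i (quad a (e c) d) y = iter i (horner fL) y.
Proof. by apply: eq_iter => z; rewrite horner_fL. Qed.

Lemma postcritical_iter n m : (0 < m <= n)%N ->
  postcritical_upto f n (Some (iter m (horner f) c)).
Proof.
move=> mn; exists m => //; exists (Some c) => //.
by elim: (m) => //= k ->.
Qed.

Lemma base_avoids_orbit m : iter m (quad a (e c) d) d != x.
Proof.
rewrite iter_quad_fL fLE iter_horner_map; apply/eqP => mx.
apply: (@avoids_upto _ _ _ _ _ H m.+1 (Some (iter m.+1 (horner f) c))).
  by apply: postcritical_iter; rewrite leqnn.
by rewrite iterSr /= mx.
Qed.

Lemma orbit_quad i j : (i < j)%N ->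
  iter i (quad a (e c) d) d != iter j (quad a (e c) d) d.
Proof.
by move=> ij; rewrite !iter_quad_fL fLE !iter_horner_map (inj_eq (fmorph_inj e)) orbit.
Qed.

(** In [B] the coordinate satisfies f^(n+1)(X) = t, and [Psi] sends t to x + u. *)
Lemma covering_lifts n (B : etale_alg (coord_ring (postcritical_upto f n.+1)))
    (q : {rmorphism {poly coord_ring (postcritical_upto f n.+1)} -> B})
    (psi : fibre (coord_eval (avoids_upto H n.+1)) B) Psi :
  is_iterate_covering f n.+1 q ->
  fibre_lift (coord_series (avoids_upto H n.+1)) psi Psi ->
  lifts a (e c) d x n.+1 (psi (q 'X)) (Psi (q 'X)).
Proof.
move=> [qA _ qker] [PsiR Psi0]; split; last exact: Psi0.
set N := n.+1 in B q psi Psi qA qker PsiR Psi0 *.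
have qser z : Psi (q z%:P) = coord_series (avoids_upto H N) z by rewrite qA PsiR.
pose sc := series_const e.
have scE : map_poly sc (iterate f N) = iter N (comp_poly (map_poly sc f)) 'X.
  by rewrite /iterate; elim: (N) => [|m IH]; rewrite ?map_polyX // !iterS map_comp_poly IH.
move: (iterate f N) qker scE => FN qker scE.
have serF : Psi (q (map_poly (fun z => coord_poly (postcritical_upto f N) z%:P) FN)) =
    (map_poly sc FN).[Psi (q 'X)].
  rewrite (horner_morph_eval (h := Psi) qser) -[map_poly (fun _ => coord_poly _ _) _]/(map_poly (coord_const _) _).
  rewrite -map_poly_comp; congr (_.[_]); apply: eq_map_poly => z.
  by rewrite -[LHS]/(coord_series _ (coord_poly _ _)) coord_series_poly map_polyC hornerC.
have serX : Psi (q (coord_poly (postcritical_upto f N) 'X)%:P) = ps_base x.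
  by rewrite qser coord_series_poly map_polyX hornerX.
have [_] := qker (map_poly (fun z => coord_poly (postcritical_upto f N) z%:P) FN
    - (coord_poly (postcritical_upto f N) 'X)%:P).
move/(_ (ex_intro _ 1 (esym (mul1r _))))/rmorph_sub_eq0 => qE.
rewrite -serX -[q _%:P]qE serF.
rewrite scE horner_iter_comp; apply: eq_iter => z.
exact: (esym (horner_quad sc z)).
Qed.

Lemma monodromy_surjective (w : preimage_tree fL x -> preimage_tree fL x) :
  rooted_iso (T' := preimage_tree fL x) w ->
  exists sigma : pi1_postcritical H, is_monodromy sigma w.
Proof.
move=> wiso; have wlev := rooted_iso_level wiso.
have twoL : 2%:R != 0 :> L by rewrite -(rmorph_nat e) fmorph_eq0.
have a0 : a != 0 by rewrite fmorph_eq0 lead_coef_eq0 -size_poly_gt0 f3.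
pose wl := level_action w.
pose v n y (yx : iter n (quad a (e c) d) y = x) : preimage_tree fL x :=
  mk_vertex (introT eqP (etrans (esym (iter_quad_fL n y)) yx)).
have wlE n y (yx : iter n (quad a (e c) d) y = x) : wl n y = val (tagged (w (v n y yx))).
  exact: (@level_actionE _ _ _ w (v n y yx) n).
have w_level n y : iter n (quad a (e c) d) y = x -> iter n (quad a (e c) d) (wl n y) = x.
  move=> yx; rewrite (wlE _ _ yx) iter_quad_fL.
  have [tw _] := wlev (v n y yx); apply: etrans (preimage_vertexP (w (v n y yx))).
  by congr (iter _ (horner fL) (val (tagged (w (v n y yx))))); exact: esym tw.
have w_parent n y : iter n.+1 (quad a (e c) d) y = x ->
    quad a (e c) d (wl n.+1 y) = wl n (quad a (e c) d y).
  move=> yx; have px : iter n (quad a (e c) d) (quad a (e c) d y) = x by rewrite -iterSr.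
  rewrite (wlE _ _ yx) (wlE _ _ px) -horner_fL.
  have [_ /(_ (v n _ px))[]] := wlev (v n.+1 y yx); last by [].
  by split=> //=; rewrite horner_fL.
have w_root : wl 0 x = x.
  rewrite (wlE 0%N x erefl); have [_ wr _] := wiso.
  have -> : v 0%N x erefl = root_vertex (preimage_tree fL x) by apply: level0_root.
  by rewrite wr.
have w_inj n y y' : iter n (quad a (e c) d) y = x -> iter n (quad a (e c) d) y' = x ->
    wl n y = wl n y' -> y = y'.
  move=> yx yx'; rewrite (wlE _ _ yx) (wlE _ _ yx') => E.
  have [wb _ _] := wiso; have : v n y yx = v n y' yx'.
    apply: (bij_inj wb); apply: vertex_eq => //.
    by rewrite !(proj1 (wlev _)).
  by move/(congr1 (fun u : preimage_tree fL x => val (tagged u))).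
have [G0 [pG0 G0const G0lift]] := tree_partial_iso Lsep twoL a0 base_avoids_orbit
  orbit_quad w_root w_level w_parent w_inj.
have [G maxG GG] := maximal_iso_ex pG0.
have Gconst t : G (frac_ps L (ps_const t), frac_ps L (ps_const t)) by exact: GG (G0const t).
have GT : G (frac_ps L (ps_base x), frac_ps L (ps_base x)).
  have l0 : lifts a (e c) d x 0 x (ps_base x) by split; rewrite ?ps_coef0_base.
  by apply: GG; apply: (G0lift _ _ _ _ l0); rewrite w_root.
have Gser n := coord_series_graph (avoids_upto H n.+1) maxG.1.1 Gconst GT.
have ser0 n := @coord_series0 _ _ _ _ _ (avoids_upto H n.+1).
(* All levels use the same [G], whence their compatibility. *)
pose sig n := projT1 (cid (pi1_of_iso Lsep maxG (ser0 n) (Gser n))).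
have sigP n B phi : fibre_rel (coord_series (avoids_upto H n.+1)) G phi (sig n B phi).
  by rewrite /sig; case: cid.
have compat n : pi1_induced (coord_incl (postcritical_upto_mono f n.+1)) (sig n.+1) (sig n).
  move=> B B' h [hA _] phi psi hphi.
  have incl z := @coord_series_incl _ _ _ _ _ _ (postcritical_upto_mono f n.+1)
    (avoids_upto H n.+1) (avoids_upto H n.+2) z.
  exact: (fibre_rel_natural maxG.1 (ser0 n) incl hA hphi (sigP n B phi) (sigP n.+1 B' psi)).
exists (Pi1Postcritical compat) => n.
have [B [q qP]] := iterate_covering_ex (S := postcritical_upto f n.+1) two f3 fc
   (@postcritical_iter n.+1).
exists B, q; split=> // u phi tu uphi.
have lft (psi : fibre (coord_eval (avoids_upto H n.+1)) B) Psi :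
    fibre_lift (coord_series (avoids_upto H n.+1)) psi Psi ->
    lifts a (e c) d x n.+1 (psi (q 'X)) (Psi (q 'X)).
  by move=> hPsi; exact: covering_lifts qP hPsi.
have [Phi [Psi [hPhi hPsi HG]]] := sigP n B phi.
have uE := level_actionE w tu; rewrite uphi -/wl in uE.
have lPhi := lft _ _ hPhi; have lPsi := lft _ _ hPsi.
(* [G] sends the series of [phi] both to the lift of its image under [w] and to the series of
   [sigma] applied to [phi]; these agree since [G] is functional. *)
have [W lW] := lifts_ex twoL a0 base_avoids_orbit (w_level _ _ (lifts_level lPhi)).
have WE := partial_iso_functional maxG.1 (HG (q 'X)) (GG _ (G0lift _ _ _ _ lPhi lW)).
split; first by rewrite (proj1 (wlev u)).
rewrite -uE; have [_ <-] := lW; have [_ <-] := lPsi.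
by rewrite (frac_ps_inj WE).
Qed.
End Monodromy.

Lemma rooted_iso_comp (T T' T'' : rooted_graph) (g : T -> T') (h : T' -> T'') :
  rooted_iso g -> rooted_iso h -> rooted_iso (h \o g).
Proof.
move=> [gb gr ga] [hb hr ha]; split; first exact: bij_comp.
  by rewrite /= gr hr.
by move=> u v; rewrite ga ha.
Qed.

Lemma rooted_iso_inv (T T' : rooted_graph) (g : T -> T') (h : T' -> T) :
  rooted_iso g -> cancel g h -> cancel h g -> rooted_iso h.
Proof.
move=> [gb gr ga] gh hg; split; first by exists g.
  by rewrite -gr gh.
by move=> u v; rewrite ga !hg.
Qed.

Lemma monodromy_group_full (F L : fieldType) (e : {rmorphism F -> L}) (f : {poly F})
    (x : L) (H : avoids e x (postcritical f)) (fL : {poly L})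
    (theta : preimage_tree fL x -> binary_tree) :
  rooted_iso theta ->
  (forall w : preimage_tree fL x -> preimage_tree fL x,
    rooted_iso (T' := preimage_tree fL x) w ->
    exists sigma : pi1_postcritical H, is_monodromy sigma w) ->
  monodromy_group H theta = W.
Proof.
move=> thetaP surj; have [[theta' tt' t't] _ _] := thetaP.
have theta'P := rooted_iso_inv thetaP tt' t't.
apply/seteqP; split=> [g [sigma [w [wP _ gE]]]|g gP].
  have -> : g = theta \o w \o theta'.
    by apply/funext => u /=; rewrite -{1}(t't u) gE.
  exact: rooted_iso_comp theta'P (rooted_iso_comp wP thetaP).
have wP : rooted_iso (T' := preimage_tree fL x) (theta' \o g \o theta).
  exact: rooted_iso_comp thetaP (rooted_iso_comp gP theta'P).
have [sigma sigmaP] := surj _ wP.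
by exists sigma, (theta' \o g \o theta); split=> // u; rewrite /= t't.
Qed.

(** * Critical point and critical orbit *)

Lemma quadratic_critical_point (F : fieldType) (f : {poly F}) :
  2%:R != 0 :> F -> size f = 3%N -> exists c, root f^`() c /\
    forall c', root f^`() c' -> c' = c.
Proof.
move=> two f3; have l0 : f`_2 != 0 by rewrite -[2%N]/3.-1 -f3 -lead_coefE lead_coef_eq0 -size_poly_gt0 f3.
have dE y : f^`().[y] = 2%:R * f`_2 * y + f`_1.
  have s2 : (size f^`() <= 2)%N.
    by rewrite -ltnS -f3 lt_size_deriv // -size_poly_gt0 f3.
  rewrite (horner_coef_wide _ s2) !big_ord_recl big_ord0 !coef_deriv /= /bump /=.
  by ring.
exists (- f`_1 / (2%:R * f`_2)); split.
  by rewrite rootE dE mulrC divfK ?mulf_neq0 // addNr.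
move=> c'; rewrite rootE dE addr_eq0 => /eqP <-.
by rewrite mulrC mulKf // mulf_neq0.
Qed.

(** If f^i(d) = f^j(d) with i < j, indices from j on can be lowered by j - i until they are below j,
    so the orbit is finite; infinity adds only itself. *)
Lemma postcritical_orbit_inj (F : fieldType) (f : {poly F}) (c : F) :
  (forall c', root f^`() c' -> c' = c) -> infinite_set (postcritical f) ->
  forall i j, (i < j)%N -> iter i (horner f) f.[c] != iter j (horner f) f.[c].
Proof.
move=> cU inf i j ij; apply/eqP => eqij; apply: inf.
have per m : exists2 m', (m' < j)%N & iter m (horner f) f.[c] = iter m' (horner f) f.[c].
  have [n] := ubnP m; elim: n m => // n IH m; rewrite ltnS => mn.
  have [mj|jm] := ltnP m j; first by exists m.
  have [|m' m'j e] := IH (m - j + i)%N; first by apply: leq_trans mn; lia.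
  exists m' => //; rewrite -e -{1}(subnK jm) !iterD; congr (iter _ _ _).
  by rewrite eqij.
pose A := ([set None] `|` [set Some (iter m (horner f) f.[c]) | m in `I_j])%classic.
apply: (@sub_finite_set _ _ A); last first.
  by rewrite finite_setU; split; [exact: finite_set1|apply: finite_image; exact: finite_II].
move=> _ [m m1 [z zc <-]].
have iterN k : iter k (P1_map f) None = None by elim: k => //= k ->.
have iterS_ k y : iter k (P1_map f) (Some y) = Some (iter k (horner f) y).
  by elim: k => //= k ->.
case: z zc => [y yc|_]; last by left; rewrite iterN.
right; rewrite (cU _ yc) iterS_; case: m m1 => // m _.
by have [m' m'j e] := per m; exists m' => //; rewrite -e -iterSr.
Qed.

Theorem theorem1p10p2 (k kbar L : fieldType) (iota : {rmorphism k -> kbar})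
    (j : {rmorphism kbar -> L}) (f : {poly k}) (x0 : L)
    (char_k : 2%N \notin [pchar k])
    (kbar_sep : is_separable_closure iota)
    (L_sep : separably_closed L)
    (f_quadratic : size f = 3%N)
    (P_infinite : infinite_set (postcritical (map_poly iota f)))
    (x0_notin_P : avoids j x0 (postcritical (map_poly iota f)))
    (theta : preimage_tree (map_poly (j \o iota) f) x0 -> binary_tree)
    (theta_iso : rooted_iso theta) :
  G_geom x0_notin_P theta = G_arith x0_notin_P theta /\
  G_arith x0_notin_P theta = W.
Proof.
have two : 2%:R != 0 :> k by move: char_k; rewrite inE /=.
have twok : 2%:R != 0 :> kbar by rewrite -(rmorph_nat iota) fmorph_eq0.
have fbar3 : size (map_poly iota f) = 3%N by rewrite size_map_poly.
have [c [fc _]] := quadratic_critical_point two f_quadratic.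
have [cbar [fcbar cU]] := quadratic_critical_point twok fbar3.
have cE : iota c = cbar by apply: cU; rewrite deriv_map rmorph_root.
have orbit := postcritical_orbit_inj cU P_infinite.
(* Over [k] the points of the critical orbit are distinct because their images in [kbar] are. *)
have arith : G_arith x0_notin_P theta = W.
  apply: monodromy_group_full => // w wP.
  apply: (monodromy_surjective L_sep two f_quadratic fc) => // i i' ii'.
  have := orbit _ _ ii'; apply: contraNneq => e.
  by rewrite -cE horner_map !iter_horner_map e.
have geom : G_geom x0_notin_P theta = W.
  apply: monodromy_group_full => // w wP.
  apply: (monodromy_surjective L_sep twok fbar3 fcbar) => //.
  by rewrite map_poly_comp.
by rewrite arith geom.
Qed.
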